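(* Let $\sigma$ be a SODE on $M$. Let $G\subset Gl(2n+1,\mathbb{R})$ be the image of the Lie-group monomorphism $$\iota\colon Gl(n,\mathbb{R})\to Gl(2n+1,\mathbb{R}),\qquad \iota(\Lambda)=\begin{pmatrix}1&0&0\\0&\Lambda&0\\0&0&\Lambda\end{pmatrix}.$$ Let $\pi\colon F(M^1)\to M^1$ be the bundle of linear frames of $M^1$, and let $P^\sigma\subset F(M^1)$ be the set of all linear frames adapted to $\sigma$. Then $\pi\colon P^\sigma\to M^1$ is a $G$-structure on $M^1$ (a reduction of $F(M^1)$ to the group $G$). Moreover, if $(U;x^i)$ is a coordinate open domain in $M$, then $$s\colon J^1(\mathbb{R},U)\to F(M^1),\qquad s(\xi)=\Bigl((X^\sigma)_\xi,(X^\sigma_i)_\xi,\bigl(\tfrac{\partial}{\partial\dot x^i}\bigr)_\xi\Bigr),\quad 1\le i\le n,$$ defines a section of $P^\sigma$ over $J^1(\mathbb{R},U)$, whose dual coframe is $(dt,\omega^i,\varpi^i)$, $1\le i\le n$, where $\omega^i=dx^i-\dot x^i\,dt$ and $\varpi^i=d\dot x^i-F^i\,dt-\tfrac12\frac{\partial F^i}{\partial\dot x^j}(dx^j-\dot x^j\,dt)$.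
   Context: $M$ is a connected smooth manifold of dimension $n$; $M^0=\mathbb{R}\times M$ with projections $p\colon M^0\to\mathbb{R}$, $p'\colon M^0\to M$; $M^r=J^r(\mathbb{R},M)$ is the manifold of $r$-jets of smooth maps $\mathbb{R}\to M$, with projections $p^{rs}\colon M^r\to M^s$ ($r>s$). Coordinates $(x^i)$ on $M$ induce coordinates $(t,x^i,\dot x^i)$ on $M^1$ and $(t,x^i,\dot x^i,\ddot x^i)$ on $M^2$. The summation convention is used. A SODE on $M$ is a smooth section $\sigma\colon M^1\to M^2$ of $p^{21}$; in coordinates $F^i=\ddot x^i\circ\sigma\in C^\infty(M^1)$, i.e. the equation $\ddot x^i=F^i(t,x,\dot x)$. Its dynamical flow is the (globally defined) vector field $X^\sigma=\frac{\partial}{\partial t}+\dot x^i\frac{\partial}{\partial x^i}+F^i\frac{\partial}{\partial\dot x^i}$ on $M^1$. Put $X^\sigma_i=\frac{\partial}{\partial x^i}+\frac12\frac{\partial F^j}{\partial\dot x^i}\frac{\partial}{\partial\dot x^j}$. $V(p^{10})\subset TM^1$ is the bundle of $p^{10}$-vertical vectors, and $\varepsilon\colon(p'\circ p^{10})^*TM\to V(p^{10})$ is the canonical isomorphism coming from the affine bundle structure of $p^{10}$ (modelled over $p'^*TM$), given by $\varepsilon(\partial/\partial x^i)=\partial/\partial\dot x^i$. $H^\sigma\colon(p^{10})^*TM^0\to TM^1$ is the splitting of $(p^{10})_*\colon TM^1\to(p^{10})^*TM^0$ given by $H^\sigma=dt\otimes X^\sigma+\omega^i\otimes X^\sigma_i$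 (it is independent of coordinates). Since $M^0=\mathbb{R}\times M$, $(p'\circ p^{10})^*TM\subset(p^{10})^*TM^0$, so $H^\sigma\circ\varepsilon^{-1}\colon V(p^{10})\to TM^1$ is defined. A linear frame $(X_0,X_1,\dots,X_{2n})\in F_\xi(M^1)$ at $\xi\in M^1$ is adapted to $\sigma$ if: (i) $X_0=(X^\sigma)_\xi$; (ii) $X_{n+i}$ is $p^{10}$-vertical for $1\le i\le n$; (iii) $X_i=(H^\sigma\circ\varepsilon^{-1})(X_{n+i})$ for $1\le i\le n$. *)

(* Defs.v *)
From HB Require Import structures.
From mathcomp Require Import all_boot all_order all_algebra generic_quotient.
From mathcomp Require Import all_classical all_reals all_analysis.

Set Implicit Arguments.
Unset Strict Implicit.
Unset Printing Implicit Defensive.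

Import Order.TTheory GRing.Theory Num.Theory.
Import numFieldNormedType.Exports.

Local Open Scope classical_set_scope.
Local Open Scope quotient_scope.
Local Open Scope ring_scope.

(** * Smooth maps between open sets of R^m and R^k *)

Section Smooth.
Variable R : realType.

Fixpoint Ck (m k r : nat) (U : set 'rV[R]_m) (f : 'rV[R]_m -> 'rV[R]_k) : Prop :=
  if r is r'.+1 then
    (forall x, U x -> differentiable f x) /\
    (forall i : 'I_m, Ck r' U (fun x => 'D_('e_i) f x))
  else forall x, U x -> {for x, continuous f}.

(* to be used with U open *)
Definition smooth_on (m k : nat) (U : set 'rV[R]_m) (f : 'rV[R]_m -> 'rV[R]_k) :=
  forall r, Ck r U f.

End Smooth.

(** * Manifolds *)

(* A chart is given by a total map; only its restriction to cdom is relevant. *)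
Record chart (R : realType) (T : Type) (m : nat) := Chart {
  cdom : set T;
  cmap :> T -> 'rV[R]_m }.

(* Bare data: a set with a family of charts. The conditions making it a smooth
   manifold are in [smooth_manifold]. *)
Record premanifold (R : realType) (m : nat) := Premanifold {
  mcar :> Type;
  matlas : set (chart R mcar m) }.

Arguments Chart {R T m} cdom cmap.
Arguments cdom {R T m} _ _.
Arguments cmap {R T m} _ _.
Arguments Premanifold {R m} mcar matlas.
Arguments matlas {R m} _ _.

HB.instance Definition _ (R : realType) (m : nat) (N : premanifold R m) :=
  gen_eqMixin (mcar N).
HB.instance Definition _ (R : realType) (m : nat) (N : premanifold R m) :=
  gen_choiceMixin (mcar N).

Section AtlasTopology.
Variables (R : realType) (m : nat) (N : premanifold R m).

(* For a smooth atlas this says that the image of U `&` cdom c under every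
   chart c is open. *)
Definition atlas_open (U : set N) :=
  forall c p, matlas N c -> U p -> cdom c p ->
  exists W : set 'rV[R]_m,
    [/\ open W, W (c p) & cdom c `&` c @^-1` W `<=` U].

Let atlas_openT : atlas_open setT.
Proof. by move=> c p _ _ _; exists setT; split => //; exact: openT. Qed.

Let atlas_openI : setI_closed atlas_open.
Proof.
move=> U V hU hV c p hc [Up Vp] cp.
have [W [oW Wp WU]] := hU c p hc Up cp.
have [W' [oW' W'p W'V]] := hV c p hc Vp cp.
exists (W `&` W'); split; [exact: openI | by [] |].
by move=> q [cq [Wq W'q]]; split; [apply: WU | apply: W'V].
Qed.

Let atlas_open_bigU (I : Type) (F : I -> set N) :
  (forall i, atlas_open (F i)) -> atlas_open (\bigcup_i F i).
Proof.
move=> hF c p hc [i _ Fip] cp.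
have [W [oW Wp WF]] := hF i c p hc Fip cp.
by exists W; split => // q /WF Fiq; exists i.
Qed.

HB.instance Definition _ :=
  isOpenTopological.Build (mcar N) atlas_openT atlas_openI atlas_open_bigU.

End AtlasTopology.

(* Expression of f in the chart c, i.e. f \o c^-1 on c @` cdom c, and 0
   elsewhere. *)
Definition cexpr (R : realType) (T : Type) (m : nat) (c : chart R T m)
    (V : zmodType) (f : T -> V) (y : 'rV[R]_m) : V :=
  if pselect (exists p, cdom c p /\ c p = y) is left h then f (projT1 (cid h))
  else 0.

Definition compatible (R : realType) (T : Type) (m : nat) (c d : chart R T m) :=
  open (c @` (cdom c `&` cdom d)) /\
  smooth_on (c @` (cdom c `&` cdom d)) (cexpr c d).

Definition coordinate_chart (R : realType) (T : Type) (m : nat) (c : chart R T m) :=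
  open (c @` cdom c) /\ {in cdom c &, injective c}.

Definition smooth_atlas (R : realType) (m : nat) (N : premanifold R m) :=
  [/\ forall c, matlas N c -> coordinate_chart c,
      forall p : N, exists2 c, matlas N c & cdom c p &
      forall c d, matlas N c -> matlas N d -> compatible c d].

Definition maximal_atlas (R : realType) (m : nat) (N : premanifold R m) :=
  forall c, coordinate_chart c ->
    (forall d, matlas N d -> compatible c d /\ compatible d c) -> matlas N c.

Definition smooth_manifold (R : realType) (m : nat) (N : premanifold R m) :=
  [/\ smooth_atlas N, hausdorff_space N & @second_countable N].

Section SmoothMaps.
Variables (R : realType) (m k : nat) (A : premanifold R m) (B : premanifold R k).

Definition smooth_in (U : set A) (f : A -> B) :=
  (forall p, U p -> {for p, continuous f}) /\
  (forall c d, matlas A c -> matlas B d ->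
    smooth_on (c @` (U `&` cdom c `&` f @^-1` cdom d)) (cexpr c (d \o f))).

Definition smooth_map (f : A -> B) := smooth_in setT f.

End SmoothMaps.

Definition diffeo_on (R : realType) (m k : nat)
    (A : premanifold R m) (B : premanifold R k) (U : set A) (V : set B)
    (f : A -> B) :=
  [/\ open U, open V, smooth_in U f & exists g : B -> A,
    [/\ smooth_in V g, f @` U `<=` V, g @` V `<=` U,
        {in U, cancel f g} & {in V, cancel g f}]].

(* the real line *)
Definition lineM (R : realType) : premanifold R 1 :=
  Premanifold R [set Chart setT (fun t => t%:M)].

Definition chart_prod (R : realType) (S T : Type) (m k : nat)
    (c : chart R S m) (d : chart R T k) : chart R (S * T) (m + k) :=
  Chart (cdom c `*` cdom d) (fun p => row_mx (c p.1) (d p.2)).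

Definition prodM (R : realType) (m k : nat)
    (A : premanifold R m) (B : premanifold R k) : premanifold R (m + k) :=
  Premanifold (A * B)%type
    [set e | exists c d, [/\ matlas A c, matlas B d & e = chart_prod c d]].

Definition chart_sub (R : realType) (T : Type) (m : nat) (U : set T)
    (c : chart R T m) : chart R (set_type U) m :=
  Chart [set p | cdom c (val p)] (fun p => c (val p)).

(* the open submanifold U of N (U open) *)
Definition openM (R : realType) (m : nat) (N : premanifold R m) (U : set N) :
    premanifold R m :=
  Premanifold (set_type U) [set chart_sub U c | c in matlas N].

(** * Tangent vectors *)

(* A tangent vector at p is the family of its components v c in the charts c of
   the atlas around p; the components in the other charts are set to 0. *)
Section Tangent.
Variables (R : realType) (m : nat) (N : premanifold R m) (p : N).

Definition chart_at (c : chart R N m) := matlas N c /\ cdom c p.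

Definition tangent_family : {pred chart R N m -> 'rV[R]_m} := fun v =>
  `[< (forall c d, chart_at c -> chart_at d -> v d = v c *m 'J (cexpr c d) (c p)) /\
      (forall c, ~ chart_at c -> v c = 0) >].

Record tangent := Tangent {
  tcomp :> chart R N m -> 'rV[R]_m;
  _ : tcomp \in tangent_family }.

HB.instance Definition _ := [isSub for tcomp].
HB.instance Definition _ := gen_eqMixin tangent.
HB.instance Definition _ := gen_choiceMixin tangent.

Fact tangent_family_submod : submod_closed tangent_family.
Proof.
split.
  apply/asboolP; split => // c d _ _.
  by rewrite mul0mx.
move=> a u v /asboolP[hu hu0] /asboolP[hv hv0]; apply/asboolP; split.
  move=> c d hc hd.
  by rewrite /GRing.add /GRing.scale /= (hu c d) // (hv c d) // mulmxDl -scalemxAl.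
move=> c hc.
by rewrite /GRing.add /GRing.scale /= hu0 // hv0 // addr0 scaler0.
Qed.

HB.instance Definition _ :=
  GRing.isSubmodClosed.Build R (chart R N m -> 'rV[R]_m) tangent_family
    tangent_family_submod.
HB.instance Definition _ := [SubChoice_isSubLmodule of tangent by <:].

(* the tangent vector with components w in the chart c at p *)
Definition tvec (c : chart R N m) (w : 'rV[R]_m) : tangent :=
  xget 0 [set v : tangent | v c = w].

Fact cexprE (c : chart R N m) (V : zmodType) (f : N -> V) q :
  coordinate_chart c -> cdom c q -> cexpr c f (c q) = f q.
Proof.
move=> [_ inj] cq; rewrite /cexpr; case: pselect => [h|[]]; last by exists q.
case: cid => q' [cq' e] /=; congr f.
by apply: inj => //; exact/mem_set.
Qed.

Let cexpr_diff c d : smooth_atlas N -> chart_at c -> chart_at d ->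
  differentiable (cexpr c d) (c p).
Proof.
move=> [_ _ comp] [hc cp] [hd dp]; have [_ /(_ 1%N)[+ _]] := comp c d hc hd.
by apply; exists p.
Qed.

Let cexpr_cocycle (c d e : chart R N m) (w : 'rV[R]_m) :
  smooth_atlas N -> chart_at c -> chart_at d -> chart_at e ->
  w *m 'J (cexpr c e) (c p) =
  w *m 'J (cexpr c d) (c p) *m 'J (cexpr d e) (d p).
Proof.
move=> hN hc hd he; have [cc _ comp] := hN.
have ccp : cexpr c d (c p) = d p.
  by apply: cexprE; [apply: cc; case: hc | case: hc].
have de : differentiable (cexpr d e) (cexpr c d (c p)).
  by rewrite ccp; exact: cexpr_diff.
have dcd : differentiable (cexpr c d) (c p) by exact: cexpr_diff.
have dce : differentiable (cexpr c e) (c p) by exact: cexpr_diff.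
have dcde : differentiable (cexpr d e \o cexpr c d) (c p).
  exact: differentiable_comp.
have dde : differentiable (cexpr d e) (d p) by exact: cexpr_diff.
transitivity ('D_w (cexpr c e) (c p)); first exact/esym/deriveEjacobian.
transitivity ('D_('D_w (cexpr c d) (c p)) (cexpr d e) (d p)); last first.
  transitivity ('D_w (cexpr c d) (c p) *m 'J (cexpr d e) (d p)).
    exact: deriveEjacobian.
  by congr (_ *m _); exact: deriveEjacobian.
transitivity ('D_w (cexpr d e \o cexpr c d) (c p)); last first.
  by rewrite (deriveE _ dcde) (diff_comp dcd de) /= (deriveE _ dcd) -ccp (deriveE _ de).
apply: near_eq_derive.
have [oU _] := comp c d hc.1 hd.1.
have : nbhs (c p) (c @` (cdom c `&` cdom d)).
  by apply: open_nbhs_nbhs; split => //; exists p => //; split; [case: hc|case: hd].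
apply: filterS => _ [q [cq dq] <-] /=.
by rewrite !cexprE //; apply: cc; [case: hd | case: hc | case: hc].
Qed.

(* For a smooth atlas, every w is the family of components in c of a tangent
   vector. *)
Fact tvecE (c : chart R N m) (w : 'rV[R]_m) :
  smooth_atlas N -> chart_at c -> tvec c w c = w.
Proof.
move=> hN hc; rewrite /tvec.
pose v d := if `[< chart_at d >] then w *m 'J (cexpr c d) (c p) else 0.
have hv : v \in tangent_family.
  apply/asboolP; split=> [d e hd he|d hd]; last by rewrite /v asboolF.
  by rewrite /v (asboolT hd) (asboolT he); exact: cexpr_cocycle.
apply: (@xgetI _ 0 [set v : tangent | v c = w] (Tangent hv)).
have dcc : differentiable (cexpr c c) (c p) by exact: cexpr_diff.
rewrite /= /v (asboolT hc).
transitivity ('D_w (cexpr c c) (c p)); first exact/esym/deriveEjacobian.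
transitivity ('D_w (@id 'rV[R]_m) (c p)); last by rewrite derive_id.
apply: near_eq_derive.
have [cc _ _] := hN.
have [oU _] := cc c hc.1.
have : nbhs (c p) (c @` cdom c).
  by apply: open_nbhs_nbhs; split => //; exists p => //; case: hc.
by apply: filterS => _ [q cq <-]; rewrite cexprE //; apply: cc; case: hc.
Qed.


Definition d_ (c : chart R N m) (i : 'I_m) : tangent := tvec c 'e_i.

End Tangent.

(* w is the image of v under the differential of f at p *)
Definition is_pushforward (R : realType) (m k : nat)
    (A : premanifold R m) (B : premanifold R k) (f : A -> B) (p : A)
    (v : tangent p) (w : tangent (f p)) :=
  forall c d, chart_at p c -> chart_at (f p) d ->
    w d = v c *m 'J (cexpr c (d \o f)) (c p).
Arguments is_pushforward {R m k A B} f {p} v w.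

Definition immersion (R : realType) (m k : nat)
    (A : premanifold R m) (B : premanifold R k) (f : A -> B) :=
  smooth_map f /\
  forall (p : A) (v : tangent p), is_pushforward f v 0 -> v = 0.

(** * The bundle of linear frames *)

Section Frames.
Variables (R : realType) (m : nat) (N : premanifold R m).

Definition is_basis (V : lmodType R) (e : 'I_m -> V) :=
  (forall v, exists a : 'I_m -> R, v = \sum_i a i *: e i) /\
  (forall a : 'I_m -> R, \sum_i a i *: e i = 0 -> forall i, a i = 0).

Record frame := Frame {
  fpt : N;
  fvec :> 'I_m -> tangent fpt;
  fvec_basis : is_basis fvec }.

Definition frame_chart (c : chart R N m) : chart R frame (m + m * m) :=
  Chart [set u | cdom c (fpt u)]
    (fun u => row_mx (c (fpt u)) (mxvec (\matrix_(a, k) (fvec u a c) 0 k))).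

Definition frameM : premanifold R (m + m * m) :=
  Premanifold frame [set frame_chart c | c in matlas N].

Definition frame_pt (u : frameM) : N := fpt (u : frame).

Fact basis_mul (V : lmodType R) (e : 'I_m -> V) (g : 'M[R]_m) :
  g \in unitmx -> is_basis e -> is_basis (fun j => \sum_i g i j *: e i).
Proof.
move=> gU [e_gen e_free].
have sumE (b : 'I_m -> R) : \sum_j b j *: (\sum_i g i j *: e i) =
    \sum_i ((g *m (\col_j b j)) i 0) *: e i.
  under eq_bigr do rewrite scaler_sumr.
  rewrite exchange_big; apply: eq_bigr => i _.
  rewrite mxE scaler_suml; apply: eq_bigr => j _.
  by rewrite mxE scalerA mulrC.
split=> [v|b].
  have [a ->] := e_gen v.
  exists (fun j => (invmx g *m (\col_i a i)) j 0).
  rewrite sumE; apply: eq_bigr => i _; congr (_ *: _).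
  have -> : \col_j (invmx g *m (\col_i a i)) j 0 = invmx g *m (\col_i a i).
    by apply/matrixP => j k; rewrite mxE [k]ord1.
  by rewrite mulKVmx // mxE.
rewrite sumE => /e_free gb0 j.
have : g *m (\col_k b k) = 0.
  by apply/matrixP => i k; rewrite [k]ord1 gb0 mxE.
move/(congr1 (mulmx (invmx g))); rewrite mulKmx // mulmx0.
by move/matrixP/(_ j 0); rewrite !mxE.
Qed.

(* the right action u g = (\sum_i g i j *: u i)_j of Gl(m, R) *)
Definition frame_act (u : frameM) (g : 'M[R]_m) : frameM :=
  if @idP (g \in unitmx) is ReflectT gU then
    @Frame (fpt u) (fun j => \sum_i g i j *: u i) (basis_mul gU (fvec_basis u))
  else u.

(* The subset P of the frame bundle, with the manifold structure given by the
   charts PA, is a principal bundle with group G, and the inclusion is an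
   immersion: P is a reduction of the frame bundle to G. Here G is a Lie subgroup
   of Gl(m, R), with the manifold structure given by the charts GA. *)
Definition is_G_structure (G : set 'M[R]_m) (d : nat) (GA : set (chart R G d))
    (P : set frameM) (k : nat) (PA : set (chart R P k)) :=
  let PM := Premanifold P PA in
  let GM := Premanifold G GA in
  let pi : PM -> N := fun u => frame_pt (val u) in
  [/\ smooth_manifold PM /\ immersion (fun u : PM => val u : frameM),
      exists2 act : prodM PM GM -> PM, smooth_map act &
        forall (u : PM) (g : GM), val (act (u, g)) = frame_act (val u) (val g),
      forall (u : PM) (g : GM), frame_act (val u) (val g) = val u -> val g = 1%:M,
      [/\ smooth_map pi, forall x : N, exists u : PM, pi u = x &
          forall u v : PM, pi u = pi v <->
            exists g : GM, val v = frame_act (val u) (val g)] &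
      forall x : N, exists (U : set N) (phi : PM -> GM),
        [/\ U x,
            forall (u v : PM) (g : GM), U (pi u) ->
              val v = frame_act (val u) (val g) ->
              val (phi v) = val (phi u) *m val g &
            @diffeo_on R _ _ PM (prodM N GM) (pi @^-1` U) (U `*` setT)
              (fun u => (pi u, phi u))]].

(* theta is the coframe dual to the frame e of the tangent space at p *)
Definition dual_coframe (p : N) (theta : 'I_m -> tangent p -> R)
    (e : 'I_m -> tangent p) :=
  (forall a, scalar (theta a)) /\ (forall a b, theta a (e b) = (a == b)%:R).

End Frames.

(** * Jets of curves *)

Section Jets.
Variables (R : realType) (n : nat) (M : premanifold R n).

Record curve := Curve {
  curve_fun :> R -> M;
  _ : smooth_map (curve_fun : lineM R -> M) }.

HB.instance Definition _ := gen_eqMixin curve.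
HB.instance Definition _ := gen_choiceMixin curve.

(* components of the k-th derivative at t of the curve g in the chart c *)
Definition deriv_in (c : chart R M n) (k : nat) (t : R) (g : R -> M) : 'rV[R]_n :=
  \row_i derive1n k (fun s => c (g s) 0 i) t.

Definition same_jet (r : nat) : rel (R * curve) := fun p q =>
  `[< [/\ p.1 = q.1, p.2 p.1 = q.2 q.1 &
        forall c k, chart_at (p.2 p.1) c -> (k <= r)%N ->
          deriv_in c k p.1 p.2 = deriv_in c k q.1 q.2] >].

Fact same_jet_refl r : reflexive (same_jet r).
Proof. by move=> p; apply/asboolP. Qed.

Fact same_jet_sym r : symmetric (same_jet r).
Proof.
have imp p q : same_jet r p q -> same_jet r q p.
  move=> /asboolP[e1 e2 e3]; apply/asboolP; split => // c k hc kr.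
  by rewrite e3 // e2.
by move=> p q; apply/idP/idP; apply: imp.
Qed.

Fact same_jet_trans r : transitive (same_jet r).
Proof.
move=> q p s /asboolP[e1 e2 e3] /asboolP[e4 e5 e6]; apply/asboolP; split.
- by rewrite e1.
- by rewrite e2.
- by move=> c k hc kr; rewrite e3 // e6 // -e2.
Qed.

Canonical same_jet_equiv r : equiv_rel (R * curve) :=
  EquivRel (same_jet r) (@same_jet_refl r) (@same_jet_sym r) (@same_jet_trans r).

(* J^r(R, M) *)
Definition jet (r : nat) := {eq_quot (same_jet_equiv r)}.

Definition jet_time (r : nat) (J : jet r) : R := (repr J).1.
Definition jet_point (r : nat) (J : jet r) : M := (repr J).2 (repr J).1.
Definition jet_deriv (c : chart R M n) (k r : nat) (J : jet r) : 'rV[R]_n :=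
  deriv_in c k (repr J).1 (repr J).2.
Definition jet_proj (r s : nat) (J : jet r) : jet s := \pi_(jet s) (repr J).

(* the coordinates (t, x^i, xdot^i) and (t, x^i, xdot^i, xddot^i) induced by the
   coordinates (x^i) *)
Definition chart1 (c : chart R M n) : chart R (jet 1) (1 + (n + n)) :=
  Chart [set J | cdom c (jet_point J)]
    (fun J => row_mx (jet_time J)%:M (row_mx (c (jet_point J)) (jet_deriv c 1 J))).
Definition chart2 (c : chart R M n) : chart R (jet 2) (1 + (n + (n + n))) :=
  Chart [set J | cdom c (jet_point J)]
    (fun J => row_mx (jet_time J)%:M
      (row_mx (c (jet_point J)) (row_mx (jet_deriv c 1 J) (jet_deriv c 2 J)))).

Definition M0 : premanifold R (1 + n) := prodM (lineM R) M.
Definition M1 : premanifold R (1 + (n + n)) :=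
  Premanifold (jet 1) [set chart1 c | c in matlas M].
Definition M2 : premanifold R (1 + (n + (n + n))) :=
  Premanifold (jet 2) [set chart2 c | c in matlas M].

Definition p10 (J : M1) : M0 := (jet_time J, jet_point J).
Definition p21 (J : M2) : M1 := jet_proj 1 J.

(* J^1(R, U), identified with the open subset of the jets in J^1(R, M) whose
   target lies in U *)
Definition jets_in (U : set M) : set M1 := [set J | U (jet_point J)].

(** * Second order differential equations *)

Definition is_sode (sigma : M1 -> M2) :=
  smooth_map sigma /\ forall J, p21 (sigma J) = J.

Definition it : 'I_(1 + (n + n)) := lshift (n + n) ord0.
Definition ix (i : 'I_n) : 'I_(1 + (n + n)) := rshift 1 (lshift n i).
Definition iv (i : 'I_n) : 'I_(1 + (n + n)) := rshift 1 (rshift n i).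

Definition blocks (A : Type) (a0 : A) (a1 a2 : 'I_n -> A)
    (k : 'I_(1 + (n + n))) : A :=
  match fintype.split k with
  | inl _ => a0
  | inr l => match fintype.split l with inl i => a1 i | inr i => a2 i end
  end.

Section InCoordinates.
Variables (sigma : M1 -> M2) (c : chart R M n).

Definition d_t (J : M1) : tangent J := d_ J (chart1 c) it.
Definition d_x (J : M1) (i : 'I_n) : tangent J := d_ J (chart1 c) (ix i).
Definition d_xdot (J : M1) (i : 'I_n) : tangent J := d_ J (chart1 c) (iv i).

Definition xdot (i : 'I_n) (J : M1) : R := jet_deriv c 1 J 0 i.

Definition Fvec (J : M1) : 'rV[R]_n := jet_deriv c 2 (sigma J).
Definition F (i : 'I_n) (J : M1) : R := Fvec J 0 i.
(* dF i j J is the partial derivative of F^i with respect to xdot^j *)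
Definition dF (i j : 'I_n) (J : M1) : R :=
  'J (cexpr (chart1 c) Fvec) (chart1 c J) (iv j) i.

Definition Xsigma (J : M1) : tangent J :=
  d_t J + \sum_i xdot i J *: d_x J i + \sum_i F i J *: d_xdot J i.

Definition Xsigma_ (i : 'I_n) (J : M1) : tangent J :=
  d_x J i + 2^-1 *: \sum_j dF j i J *: d_xdot J j.

(* The components of a tangent vector in a chart are the values on it of the
   differentials of the coordinate functions of the chart. *)
Definition dt (J : M1) (v : tangent J) : R := v (chart1 c) 0 it.
Definition dx (i : 'I_n) (J : M1) (v : tangent J) : R := v (chart1 c) 0 (ix i).
Definition dxdot (i : 'I_n) (J : M1) (v : tangent J) : R := v (chart1 c) 0 (iv i).

Definition omega (i : 'I_n) (J : M1) (v : tangent J) : R :=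
  dx i v - xdot i J * dt v.
Definition varpi (i : 'I_n) (J : M1) (v : tangent J) : R :=
  dxdot i v - F i J * dt v - 2^-1 * \sum_j dF i j J * (dx j v - xdot j J * dt v).

(* epsilon (d/dx^i) = d/dxdot^i *)
Definition epsilon (J : M1) (w : tangent (jet_point J)) : tangent J :=
  \sum_i w c 0 i *: d_xdot J i.

Definition chart0 : chart R M0 (1 + n) := chart_prod (Chart setT (fun t => t%:M)) c.

(* the inclusion of T_x M in T_(t, x) (R x M) *)
Definition incl_TM (J : M1) (w : tangent (jet_point J)) : tangent (p10 J) :=
  \sum_i w c 0 i *: d_ (p10 J) chart0 (rshift 1 i).

(* Hsigma = dt (x) Xsigma + omega^i (x) Xsigma_i, where dt and omega^i are semibasic
   and hence act on the tangent spaces of M0 *)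
Definition Hsigma (J : M1) (v : tangent (p10 J)) : tangent J :=
  let dt0 := v chart0 0 (lshift n ord0) in
  let dx0 i := v chart0 0 (rshift 1 i) in
  dt0 *: Xsigma J + \sum_i (dx0 i - xdot i J * dt0) *: Xsigma_ i J.

Definition local_frame (J : M1) : 'I_(1 + (n + n)) -> tangent J :=
  blocks (Xsigma J) (fun i => Xsigma_ i J) (fun i => d_xdot J i).

Definition local_coframe (J : M1) : 'I_(1 + (n + n)) -> tangent J -> R :=
  blocks (@dt J) (fun i => @omega i J) (fun i => @varpi i J).

End InCoordinates.

Definition vertical (J : M1) (v : tangent J) :=
  is_pushforward p10 v 0.

(* X^sigma, epsilon and Hsigma do not depend on the chart c in which they are
   computed. *)
Definition adapted (sigma : M1 -> M2) (u : frameM M1) :=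
  forall c, chart_at (jet_point (fpt u)) c ->
  [/\ u it = Xsigma sigma c (fpt u),
      forall i, vertical (u (iv i)) &
      forall i, exists2 w : tangent (jet_point (fpt u)),
        u (iv i) = epsilon c w & u (ix i) = Hsigma sigma c (incl_TM c w)].

Definition adapted_frames (sigma : M1 -> M2) : set (frameM M1) :=
  [set u | adapted sigma u].

End Jets.

(** * The group G *)

Section Group.
Variables (R : realType) (n : nat).

Definition iota (L : 'M[R]_n) : 'M[R]_(1 + (n + n)) :=
  block_mx 1%:M 0 0 (block_mx L 0 0 L).

Definition G : set 'M[R]_(1 + (n + n)) := [set iota L | L in [set L | L \in unitmx]].

Fact iota_inj : injective iota.
Proof. by move=> L L' /eq_block_mx[_ _ _] /eq_block_mx[]. Qed.

Fact iotaM L L' : iota (L *m L') = iota L *m iota L'.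
Proof.
by rewrite /iota !mulmx_block !(mulmx0, mul0mx, mulmx1, mul1mx, addr0, add0r).
Qed.

Fact iota_unit L : L \in unitmx -> iota L \in unitmx.
Proof.
move=> LU; rewrite /iota !unitmxE !det_ublock det1 mul1r.
by rewrite unitrMl -unitmxE.
Qed.

(* iota transports the canonical global chart of Gl(n, R) to G *)
Definition G_chart : chart R G (n * n) :=
  Chart setT (fun g => mxvec (ulsubmx (drsubmx (val g)))).

End Group.

(* Main.v *)
Require Import Defs.
From HB Require Import structures.
From mathcomp Require Import all_boot all_order all_algebra generic_quotient.
From mathcomp Require Import ring lra.
From mathcomp Require Import all_classical all_reals all_analysis.

Set Implicit Arguments.
Unset Strict Implicit.
Unset Printing Implicit Defensive.

Import Order.TTheory GRing.Theory Num.Theory.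
Import numFieldNormedType.Exports.

Local Open Scope classical_set_scope.
Local Open Scope ring_scope.

(** Why the theorem is true.  In a chart (x^i) of M a frame is adapted exactly when
    it is the local frame (X^sigma, X^sigma_i, d/dxdot^i) multiplied by iota(L) for an
    invertible matrix L, where L is the matrix of the vertical part of the frame in
    the basis d/dxdot^i ([adapted_expand], [frame_by_adapted]).  Adapted frames thus
    have coordinates (t, x, xdot, L); these make the set P of adapted frames a
    manifold [Pmanifold] on which G acts by right multiplication on L.  In these
    coordinates the trivialization u |-> (pi u, iota L) and its inverse are the
    identity, the projection forgets L, and the canonical section is L = 1.

    The content is that being adapted does not depend on the chart: X^sigma, epsilon
    and H^sigma computed in two charts agree ([Xsigma_indep], [epsilon_indep],
    [Hsigma_indep]).  Let D denote the derivatives of the change of coordinates.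
    A 1-jet transforms by xdot' = xdot D, whose differential contains second
    derivatives of the change of coordinates.  For a second order equation
    F' = F D + D^2(xdot, xdot), and the last term is the one that this differential
    adds to the last components of X^sigma.  For X^sigma_i it adds
    D^2(d/dx^i, xdot), and half of the derivative of D^2(xdot, xdot) with respect to
    xdot^i is exactly that, provided that D^2 is symmetric ([dF_change]).  Symmetry
    is Schwarz's theorem [derive_comm], proved from the mean value theorem.

    Smoothness is organized around real-valued functions on open sets of R^m: the
    class of expressions built by sums, products, inverses and composition is closed
    under partial derivatives ([smooth_expr_derive]).  A map between manifolds is
    smooth as soon as, near each point, it has a smooth expression in one pair of
    charts ([smooth_in_local]); every smoothness statement about P, the frame bundle
    and the jets goes through this criterion.  That the coordinates (t, x, xdot) fill
    an open set requires a globally defined curve through each 1-jet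
    ([curve_exists]). *)

(** * Smooth real-valued functions *)

Section Calculus.
Variable R : realType.

(** Differentiability at a point depends only on the germ: the remainder of f serves
    for g. *)
Lemma near_eq_differentiable (V W : normedModType R) (f g : V -> W) (x : V) :
  (\near x, f x = g x) -> differentiable f x -> differentiable g x.
Proof.
move=> fg df; have [cdf ef] := (diff_locallyP _ _).1 df.
have fgx : f x = g x by exact: nbhs_singleton fg.
suff eg : g \o shift x = cst (g x) + 'd f x +o_ 0 id.
  by apply/diff_locallyP; rewrite (diff_unique cdf eg).
have fg0 : \forall h \near (0 : V), f (h + x) = g (h + x).
  by rewrite (near_shift x 0); apply: filterS fg => y /=; rewrite /= sub0r subrK.
apply/eqaddoP => e e0.
have /eqaddoP/(_ e e0) := ef.
apply: filter_app; near=> h.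
rewrite /= !fctE /= -fgx => H; rewrite -(_ : f (h + x) = g (h + x)) //.
by near: h.
Unshelve. all: by end_near. Qed.

Lemma differentiable_rVP m k (f : 'rV[R]_m -> 'rV[R]_k) x :
  differentiable f x <-> forall j, differentiable (fun y => f y 0 j) x.
Proof.
split=> [df j|df].
  exact: (@differentiable_comp _ _ _ _ f (fun N : 'rV[R]_k => N 0 j) x df
            (differentiable_coord _ _ _)).
have -> : f = \sum_j (fun y => f y 0 j *: ('e_j : 'rV[R]_k)).
  by apply/funext => y; rewrite fct_sumE [LHS]row_sum_delta.
by apply: differentiable_sum => j; apply: differentiableZl.
Qed.

Lemma derive_coord m k (f : 'rV[R]_m -> 'rV[R]_k) x v j :
  differentiable f x -> ('D_v f x) 0 j = 'D_v (fun y => f y 0 j) x.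
Proof. by move=> df; rewrite (derive_mx (diff_derivable df)) mxE. Qed.

Lemma derive_row_coord m (x v : 'rV[R]_m) j :
  'D_v (fun y : 'rV[R]_m => y 0 j) x = v 0 j.
Proof.
by rewrite -(@derive_coord m m id) ?derive_id //; apply/differentiable_rVP => i;
  exact: differentiable_coord.
Qed.

Lemma deriveE_partial m (f : 'rV[R]_m -> R) x v :
  differentiable f x -> 'D_v f x = \sum_j v 0 j * 'D_('e_j) f x.
Proof.
move=> df; rewrite deriveE // [in LHS](row_sum_delta v) linear_sum.
by apply: eq_bigr => j _; rewrite linearZ deriveE.
Qed.

Lemma derive_comp_rV m k (f : 'rV[R]_m -> 'rV[R]_k) (g : 'rV[R]_k -> R) x v :
  differentiable f x -> differentiable g (f x) ->
  'D_v (fun y => g (f y)) x =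
    \sum_j 'D_v (fun y => f y 0 j) x * 'D_('e_j) g (f x).
Proof.
move=> df dg; have dgf : differentiable (g \o f) x by exact: differentiable_comp.
rewrite (deriveE _ dgf) (diff_comp df dg) /= -(deriveE _ df) -(deriveE _ dg).
rewrite deriveE_partial //. apply: eq_bigr => j _.
by rewrite derive_coord.
Qed.

Lemma jacobianE m k (f : 'rV[R]_m -> 'rV[R]_k) x i j :
  differentiable f x -> 'J f x i j = 'D_('e_i) (fun y => f y 0 j) x.
Proof.
move=> df; rewrite -derive_coord // deriveEjacobian //.
by rewrite -rowE [RHS]mxE.
Qed.


Lemma deriveM_diff m (f g : 'rV[R]_m -> R) x v :
  differentiable f x -> differentiable g x ->
  'D_v (fun y => f y * g y) x = 'D_v f x * g x + f x * 'D_v g x.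
Proof.
move=> df dg; rewrite [RHS]addrC [X in _ + X]mulrC.
exact: deriveM (diff_derivable (v := v) df) (diff_derivable (v := v) dg).
Qed.

Lemma deriveD_diff m (f g : 'rV[R]_m -> R) x v :
  differentiable f x -> differentiable g x ->
  'D_v (fun y => f y + g y) x = 'D_v f x + 'D_v g x.
Proof.
by move=> df dg; exact: deriveD (diff_derivable (v := v) df) (diff_derivable (v := v) dg).
Qed.

Lemma derive_sum_diff m k (f : 'I_k -> 'rV[R]_m -> R) x v :
  (forall i, differentiable (f i) x) ->
  'D_v (fun y => \sum_i f i y) x = \sum_i 'D_v (f i) x.
Proof.
move=> df; rewrite -derive_sum; last by move=> i; exact: diff_derivable.
by congr ('D_v _ x); apply/funext => y; rewrite fct_sumE.
Qed.

Lemma differentiable_sum_fun m k (f : 'I_k -> 'rV[R]_m -> R) x :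
  (forall i, differentiable (f i) x) -> differentiable (fun y => \sum_i f i y) x.
Proof.
move=> df; rewrite (_ : (fun y => _) = \sum_i f i); first exact: differentiable_sum.
by apply/funext => y; rewrite fct_sumE.
Qed.

Lemma derive_sumM m k (f g : 'I_k -> 'rV[R]_m -> R) x v :
  (forall i, differentiable (f i) x) -> (forall i, differentiable (g i) x) ->
  'D_v (fun y => \sum_i f i y * g i y) x =
    \sum_i ('D_v (f i) x * g i x + f i x * 'D_v (g i) x).
Proof.
move=> df dg; rewrite derive_sum_diff.
  by apply: eq_bigr => i _; exact: deriveM_diff.
by move=> i; exact: (differentiableM (df i) (dg i)).
Qed.

Fixpoint Ckr m r (U : set 'rV[R]_m) (f : 'rV[R]_m -> R) : Prop :=
  if r is r'.+1 then
    (forall x, U x -> differentiable f x) /\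
    (forall i : 'I_m, Ckr r' U (fun x => 'D_('e_i) f x))
  else forall x, U x -> {for x, continuous f}.

Definition smooth_fun m (U : set 'rV[R]_m) (f : 'rV[R]_m -> R) :=
  forall r, Ckr r U f.

Lemma near_open m (U : set 'rV[R]_m) (P : 'rV[R]_m -> Prop) x :
  open U -> U x -> (forall y, U y -> P y) -> \forall y \near x, P y.
Proof.
move=> oU Ux UP; have /filterS : nbhs x U by exact: open_nbhs_nbhs.
exact.
Qed.

Lemma eq_Ckr m r (U : set 'rV[R]_m) (f g : 'rV[R]_m -> R) :
  open U -> (forall x, U x -> f x = g x) -> Ckr r U f -> Ckr r U g.
Proof.
have nfg (f1 g1 : 'rV[R]_m -> R) x : open U -> (forall x, U x -> f1 x = g1 x) ->
    U x -> \forall y \near x, f1 y = g1 y.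
  by move=> oU fg Ux; exact: (near_open (P := fun y => f1 y = g1 y)) fg.
move=> oU; elim: r f g => [|r IH] f g fg /=.
  move=> cf x Ux; rewrite /prop_for /continuous_at -fg //.
  by apply: cvg_trans (cf x Ux); exact: near_eq_cvg (nfg f g x oU fg Ux).
move=> [df Df]; split=> [x Ux|i].
  exact: (near_eq_differentiable (nfg f g x oU fg Ux) (df x Ux)).
by apply: IH (Df i) => x Ux; exact: (near_eq_derive _ (nfg f g x oU fg Ux)).
Qed.

(** Vector-valued smoothness reduces to the scalar one, for which sums, products and
    inverses make sense. *)
Lemma Ck_coord m k r (U : set 'rV[R]_m) (f : 'rV[R]_m -> 'rV[R]_k) :
  open U -> Ck r U f <-> forall j, Ckr r U (fun x => f x 0 j).
Proof.
move=> oU; elim: r f => [|r IH] f /=.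
  split=> [cf j x Ux|cf x Ux].
    exact: (@continuous_comp _ _ _ f (fun N : 'rV[R]_k => N 0 j) x (cf x Ux)
      (@coord_continuous _ _ _ _ _ _)).
  move=> A [P fxP PA].
  have : \forall y \near x, forall j, P 0 j (f y 0 j).
    exact: (filter_forall (f := fun j y => P 0 j (f y 0 j)) (nbhs_filter x)
      (fun j => cf j x Ux _ (fxP 0 j))).
  by apply: filterS => y Py; apply: PA => i j; rewrite [i]ord1.
have E (df : forall x, U x -> differentiable f x) i j x : U x ->
    ('D_'e_i f x) 0 j = 'D_('e_i) (fun y => f y 0 j) x.
  by move=> Ux; rewrite derive_coord //; exact: df.
split=> [[df Df] j|H].
  split=> [x /df /differentiable_rVP|i]; first exact.
  by have /IH/(_ j) := Df i; apply: eq_Ckr => // x; exact: E.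
have df x : U x -> differentiable f x.
  by move=> Ux; apply/differentiable_rVP => j; have [+ _] := H j; exact.
split=> // i; apply/IH => j; have [_ /(_ i)] := H j.
by apply: eq_Ckr => // x Ux; rewrite E.
Qed.

Lemma smooth_on_coord m k (U : set 'rV[R]_m) (f : 'rV[R]_m -> 'rV[R]_k) :
  open U -> smooth_on U f <-> forall j, smooth_fun U (fun x => f x 0 j).
Proof.
move=> oU; split=> [H j r|H r]; first exact/(Ck_coord _ _ oU).1.
by apply/Ck_coord => // j; exact: H.
Qed.

Lemma smooth_fun_diff m (U : set 'rV[R]_m) f x : smooth_fun U f -> U x ->
  differentiable f x.
Proof. by move=> /(_ 1%N)[+ _]; exact. Qed.

Lemma smooth_fun_derive m (U : set 'rV[R]_m) f i : smooth_fun U f ->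
  smooth_fun U (fun x => 'D_('e_i) f x).
Proof. by move=> H r; have [_] := H r.+1; exact. Qed.

Lemma eq_smooth_fun m (U : set 'rV[R]_m) (f g : 'rV[R]_m -> R) :
  open U -> (forall x, U x -> f x = g x) -> smooth_fun U f -> smooth_fun U g.
Proof. by move=> oU fg H r; apply: eq_Ckr fg (H r). Qed.

Lemma smooth_fun_cst m (U : set 'rV[R]_m) (a : R) : smooth_fun U (fun=> a).
Proof.
move=> r; elim: r a => [|r IH] a /=.
  by move=> x _; exact: cst_continuous.
split=> [x _|i]; first exact: differentiable_cst.
have -> // : (fun x : 'rV[R]_m => 'D_('e_i) (fun=> a) x) = fun=> 0.
by apply/funext => x; exact: derive_cst.
Qed.

Lemma smooth_fun_coord m (U : set 'rV[R]_m) j : smooth_fun U (fun y => y 0 j).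
Proof.
case=> [x _|r]; first exact: coord_continuous.
split=> [x _|i]; first exact: differentiable_coord.
have -> : (fun x : 'rV[R]_m => 'D_('e_i) (fun y : 'rV[R]_m => y 0 j) x) =
    fun=> ('e_i : 'rV[R]_m) 0 j.
  by apply/funext => x; rewrite derive_row_coord.
exact: smooth_fun_cst.
Qed.

(** The class of functions built from smooth ones by sums, products, inverses and
    composition is stable by partial derivatives; hence its members are smooth.  All
    closure properties of smooth functions follow from one induction on it. *)
Inductive smooth_expr m (U : set 'rV[R]_m) : ('rV[R]_m -> R) -> Prop :=
| SmoothBase f of smooth_fun U f : smooth_expr U f
| SmoothAdd f g of smooth_expr U f & smooth_expr U g :
    smooth_expr U (fun x => f x + g x)
| SmoothMul f g of smooth_expr U f & smooth_expr U g :
    smooth_expr U (fun x => f x * g x)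
| SmoothInv f of smooth_expr U f & (forall x, U x -> f x != 0) :
    smooth_expr U (fun x => (f x)^-1)
| SmoothComp k (V : set 'rV[R]_k) g (f : 'rV[R]_m -> 'rV[R]_k) of
    smooth_fun V g & (forall j, smooth_expr U (fun x => f x 0 j)) &
    (forall x, U x -> V (f x)) : smooth_expr U (fun x => g (f x)).

Lemma smooth_expr_sum m k (U : set 'rV[R]_m) (f : 'I_k -> 'rV[R]_m -> R) :
  (forall i, smooth_expr U (f i)) -> smooth_expr U (fun x => \sum_i f i x).
Proof.
elim: k f => [|k IH] f H.
  rewrite (_ : (fun x => _) = fun=> 0); last by apply/funext => x; rewrite big_ord0.
  exact/SmoothBase/smooth_fun_cst.
rewrite (_ : (fun x => _) = fun x => f ord0 x + \sum_(i < k) f (lift ord0 i) x).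
  by apply: SmoothAdd => //; exact: IH.
by apply/funext => x; rewrite big_ord_recl.
Qed.

Lemma smooth_expr_derive m (U : set 'rV[R]_m) f : smooth_expr U f ->
  (forall x, U x -> differentiable f x) /\
  forall i, exists2 g, smooth_expr U g & forall x, U x -> 'D_('e_i) f x = g x.
Proof.
elim=> {f}[f sf|f g sf [df Df] sg [dg Dg]|f g sf [df Df] sg [dg Dg]|f sf [df Df] f0
          |k V g f sg sf Hf fUV].
- split=> [x|i]; first exact: smooth_fun_diff.
  exists (fun x => 'D_('e_i) f x) => //.
  by apply: SmoothBase; exact: smooth_fun_derive.
- split=> [x Ux|i]; first exact: (differentiableD (df x Ux) (dg x Ux)).
  have [f' sf' ef] := Df i; have [g' sg' eg] := Dg i.
  exists (fun x => f' x + g' x); first exact: SmoothAdd.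
  by move=> x Ux; rewrite deriveD_diff ?ef ?eg //; [exact: df | exact: dg].
- split=> [x Ux|i]; first exact: (differentiableM (df x Ux) (dg x Ux)).
  have [f' sf' ef] := Df i; have [g' sg' eg] := Dg i.
  exists (fun x => f' x * g x + f x * g' x).
    by apply: SmoothAdd; apply: SmoothMul.
  by move=> x Ux; rewrite deriveM_diff ?ef ?eg //; [exact: df | exact: dg].
- split=> [x Ux|i]; first exact: (differentiableV (df x Ux) (f0 x Ux)).
  have [f' sf' ef] := Df i.
  exists (fun x => (-1) * ((f x)^-1 * (f x)^-1) * f' x).
    apply: SmoothMul => //; apply: SmoothMul; first exact/SmoothBase/smooth_fun_cst.
    by apply: SmoothMul; apply: SmoothInv.
  move=> x Ux.
  rewrite -ef // mulN1r -invfM -expr2.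
  exact: deriveV (f0 x Ux) (diff_derivable (v := 'e_i) (df x Ux)).
- have df x : U x -> differentiable f x.
    by move=> Ux; apply/differentiable_rVP => j; exact: (Hf j).1.
  have dg x : U x -> differentiable g (f x).
    by move=> Ux; apply: (smooth_fun_diff sg); exact: fUV.
  split=> [x Ux|i].
    exact: (@differentiable_comp _ _ _ _ f g x (df x Ux) (dg x Ux)).
  have /choice[f' H] : forall j, exists f', smooth_expr U f' /\
      forall x, U x -> 'D_('e_i) (fun x => f x 0 j) x = f' x.
    by move=> j; have [_ /(_ i)[f' ? ?]] := Hf j; exists f'.
  exists (fun x => \sum_j f' j x * 'D_('e_j) g (f x)).
    apply: smooth_expr_sum => j; apply: SmoothMul; first by case: (H j).
    apply: (@SmoothComp _ _ _ V (fun y => 'D_('e_j) g y)) => //.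
    exact: smooth_fun_derive.
  move=> x Ux; rewrite derive_comp_rV; [|exact: df|exact: dg].
  by apply: eq_bigr => j _; rewrite (H j).2.
Qed.

Lemma smooth_exprP m (U : set 'rV[R]_m) f : open U -> smooth_expr U f ->
  smooth_fun U f.
Proof.
move=> oU + r; elim: r f => [|r IH] f sf.
  move=> x Ux; apply: differentiable_continuous.
  by have [+ _] := smooth_expr_derive sf; exact.
have [df Df] := smooth_expr_derive sf.
split=> // i; have [g sg eg] := Df i.
by apply: (eq_Ckr oU _ (IH _ sg)) => x Ux; rewrite eg.
Qed.

Section Closure.
Variables (m : nat) (U : set 'rV[R]_m) (oU : open U).
Implicit Types f g : 'rV[R]_m -> R.

Lemma smooth_funD f g : smooth_fun U f -> smooth_fun U g ->
  smooth_fun U (fun x => f x + g x).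
Proof. by move=> sf sg; apply: smooth_exprP => //; apply: SmoothAdd; exact: SmoothBase. Qed.

Lemma smooth_funM f g : smooth_fun U f -> smooth_fun U g ->
  smooth_fun U (fun x => f x * g x).
Proof. by move=> sf sg; apply: smooth_exprP => //; apply: SmoothMul; exact: SmoothBase. Qed.

Lemma smooth_funV f : smooth_fun U f -> (forall x, U x -> f x != 0) ->
  smooth_fun U (fun x => (f x)^-1).
Proof. by move=> sf f0; apply: smooth_exprP => //; apply: SmoothInv => //; exact: SmoothBase. Qed.

Lemma smooth_fun_sum k (f : 'I_k -> 'rV[R]_m -> R) :
  (forall i, smooth_fun U (f i)) -> smooth_fun U (fun x => \sum_i f i x).
Proof. by move=> sf; apply: smooth_exprP => //; apply: smooth_expr_sum => i; exact: SmoothBase. Qed.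

Lemma smooth_fun_comp k (V : set 'rV[R]_k) (g : 'rV[R]_k -> R)
    (f : 'rV[R]_m -> 'rV[R]_k) :
  smooth_fun V g -> (forall j, smooth_fun U (fun x => f x 0 j)) ->
  (forall x, U x -> V (f x)) -> smooth_fun U (fun x => g (f x)).
Proof.
move=> sg sf fUV; apply: smooth_exprP => //; apply: SmoothComp sg _ fUV => j.
exact: SmoothBase.
Qed.

End Closure.

(** * Symmetry of second derivatives *)

Lemma MVT_line m (g : 'rV[R]_m -> R) (p w : 'rV[R]_m) (d : R) : 0 <= d ->
  (forall s, 0 <= s <= d -> differentiable g (s *: w + p)) ->
  exists2 s, 0 <= s <= d & g (d *: w + p) - g p = 'D_w g (s *: w + p) * d.
Proof.
move=> d0 dg.
pose l (s : R) := s *: w + p.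
have dl s : is_diff s l ( *:%R ^~ w).
  have := is_diffD (is_diff_scalel s w) (is_diff_cst p s).
  by rewrite addr0.
have dgl s : 0 <= s <= d -> is_derive s 1 (g \o l) ('D_w g (l s)).
  move=> sd; have dgs := dg s sd.
  have dgls : differentiable (g \o l) s by exact: differentiable_comp.
  apply: DeriveDef; first exact: diff_derivable.
  by rewrite !deriveE // diff_comp //= diff_val scale1r.
have [||s sd E] := @MVT_segment R (g \o l) (fun s => 'D_w g (l s)) 0 d d0.
- by move=> s; rewrite in_itv /= => /andP[/ltW s0 /ltW sd]; apply: dgl; rewrite s0.
- apply: derivable_within_continuous => s; rewrite in_itv /= => /dgl.
  by case.
exists s; first by rewrite in_itv in sd.
by move: E; rewrite /= /l scale0r add0r subr0.
Qed.

(** The mean value theorem along e_i, for y |-> f (d e_j + y) - f y, and then along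
    e_j, for the partial derivative of f. *)
Lemma second_difference m (U : set 'rV[R]_m) (f : 'rV[R]_m -> R) (i j : 'I_m) x d :
  smooth_fun U f -> 0 < d ->
  (forall s t, 0 <= s <= d -> 0 <= t <= d -> U (s *: 'e_i + t *: 'e_j + x)) ->
  exists s t, [/\ 0 <= s <= d, 0 <= t <= d &
    f (d *: 'e_i + d *: 'e_j + x) - f (d *: 'e_i + x) - f (d *: 'e_j + x) + f x =
    'D_('e_j) (fun y => 'D_('e_i) f y) (s *: 'e_i + t *: 'e_j + x) * d * d].
Proof.
move=> sf d0 HU; have dd : 0 <= d <= d by rewrite lexx ltW.
have d00 : 0 <= (0 : R) <= d by rewrite lexx ltW.
have df s t : 0 <= s <= d -> 0 <= t <= d ->
    differentiable f (s *: 'e_i + t *: 'e_j + x).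
  by move=> hs ht; apply: (smooth_fun_diff sf); exact: HU.
pose phi y := f (d *: 'e_j + y) - f y.
have shiftd (c : 'rV[R]_m) y : differentiable f (c + y) ->
    differentiable (fun z => f (c + z)) y.
  move=> dfc; apply: (@differentiable_comp _ _ _ _ (fun z => c + z) f) => //.
have shiftD (c : 'rV[R]_m) y w : 'D_w (fun z => f (c + z)) y = 'D_w f (c + y).
  by rewrite /derive /=; congr (lim _); apply/congr2 => //; apply/funext => h /=;
     rewrite addrCA.
have dphi1 s : 0 <= s <= d -> differentiable (fun z => f (d *: 'e_j + z)) (s *: 'e_i + x).
  by move=> sd; apply: shiftd; rewrite addrCA addrA; exact: df.
have dphi2 s : 0 <= s <= d -> differentiable f (s *: 'e_i + x).
  by move=> sd; have := df s 0 sd d00; rewrite scale0r addr0.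
have [|s sd E1] := @MVT_line _ phi x 'e_i d (ltW d0).
  by move=> s sd; exact: (differentiableB (dphi1 s sd) (dphi2 s sd)).
have [|t td E2] := @MVT_line _ (fun y => 'D_('e_i) f y) (s *: 'e_i + x) 'e_j d (ltW d0).
  move=> t td; apply: (smooth_fun_diff (smooth_fun_derive i sf)).
  by rewrite addrCA addrA; exact: HU.
exists s, t; split => //.
have -> : s *: 'e_i + t *: 'e_j + x = t *: 'e_j + (s *: 'e_i + x).
  by rewrite addrCA addrA.
rewrite -E2.
have -> : 'D_('e_i) f (d *: 'e_j + (s *: 'e_i + x)) - 'D_('e_i) f (s *: 'e_i + x) =
   'D_('e_i) phi (s *: 'e_i + x).
  rewrite -shiftD.
  exact/esym/(deriveB (diff_derivable (v := 'e_i) (dphi1 s sd))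
                      (diff_derivable (v := 'e_i) (dphi2 s sd))).
by rewrite -E1 /phi addrCA addrA opprB addrA addrAC.
Qed.

Lemma continuous_eq_near m (U : set 'rV[R]_m) (A B : 'rV[R]_m -> R) x :
  open U -> U x -> {for x, continuous A} -> {for x, continuous B} ->
  (forall r, 0 < r -> ball x r `<=` U ->
    exists y z, [/\ ball x r y, ball x r z & A y = B z]) ->
  A x = B x.
Proof.
move=> oU Ux cA cB H.
apply/eqP; rewrite -subr_eq0 -normr_le0; apply/ler_addgt0Pr => e e0; rewrite add0r.
have e20 : 0 < e / 2 by rewrite divr_gt0.
have nU : \forall y \near x, U y by exact: open_nbhs_nbhs.
have nA : \forall y \near x, `|A x - A y| <= e / 2.
  exact: ((cvgrPdist_le _ _).1 cA _ e20).
have nB : \forall y \near x, `|B x - B y| <= e / 2.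
  exact: ((cvgrPdist_le _ _).1 cB _ e20).
have [r /= r0 Hr] := (nbhs_ballP _ _).1 (filterI nU (filterI nA nB)).
have [|y [z [xy xz AB]]] := H r r0; first by move=> y /Hr[].
have [_ [Ay _]] := Hr y xy; have [_ [_ Bz]] := Hr z xz.
rewrite -(subrKA (A y)); apply: le_trans (ler_normD _ _) _.
by rewrite [leRHS]splitr lerD // AB distrC.
Qed.

(** The second difference is symmetric in i and j, so both mixed derivatives take a
    common value arbitrarily close to x. *)
Lemma derive_comm m (U : set 'rV[R]_m) (f : 'rV[R]_m -> R) (i j : 'I_m) x :
  open U -> smooth_fun U f -> U x ->
  'D_('e_j) (fun y => 'D_('e_i) f y) x = 'D_('e_i) (fun y => 'D_('e_j) f y) x.
Proof.
move=> oU sf Ux.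
apply: (continuous_eq_near (A := fun y => 'D_('e_j) (fun z => 'D_('e_i) f z) y)
  (B := fun y => 'D_('e_i) (fun z => 'D_('e_j) f z) y) oU Ux).
- by apply: (smooth_fun_derive j (smooth_fun_derive i sf) 0%N).
- by apply: (smooth_fun_derive i (smooth_fun_derive j sf) 0%N).
(* the sup norm of s e_a + t e_b is at most 2 d, which is less than r *)
move=> r r0 rU; pose d := r / 3.
have d0 : 0 < d by rewrite divr_gt0.
have Hbox (a b : 'I_m) s t : 0 <= s <= d -> 0 <= t <= d -> ball x r (s *: 'e_a + t *: 'e_b + x).
  move=> /andP[s0 sd] /andP[t0 td].
  rewrite -ball_normE /= opprD addrCA subrr addr0 normrN.
  apply: le_lt_trans (ler_normD _ _) _; rewrite !normrZ !ger0_norm //.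
  have ne (c : 'I_m) : `|'e_c : 'rV[R]_m| <= 1.
    rewrite [leLHS]/Num.Def.normr /= mx_normrE; apply: bigmax_le => // -[k l] _.
    by rewrite mxE; case: (_ && _); rewrite ?normr1 ?normr0.
  have h1 : s * `|'e_a : 'rV[R]_m| <= d.
    by rewrite -[leRHS]mulr1; apply: ler_pM.
  have h2 : t * `|'e_b : 'rV[R]_m| <= d.
    by rewrite -[leRHS]mulr1; apply: ler_pM.
  apply: le_lt_trans (lerD h1 h2) _.
  rewrite /d -mulrDl ltr_pdivrMr //; lra.
have [|s [t [hs ht E1]]] := @second_difference _ U f i j x d sf d0.
  by move=> s t hs ht; apply: rU; exact: Hbox.
have [|t' [s' [ht' hs' E2]]] := @second_difference _ U f j i x d sf d0.
  by move=> t' s' ht' hs'; apply: rU; exact: Hbox.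
exists (s *: 'e_i + t *: 'e_j + x), (t' *: 'e_j + s' *: 'e_i + x).
split; [exact: Hbox | exact: Hbox |].
have dn0 : d != 0 by rewrite gt_eqF.
apply: (mulIf dn0); apply: (mulIf dn0).
rewrite -[LHS]E1 -[RHS]E2 [d *: 'e_j + d *: 'e_i]addrC.
by congr (_ + _); exact: addrAC.
Qed.

End Calculus.

(** * Smooth maps of row vectors *)

Section SmoothVectors.
Variable R : realType.

Section Comp.
Variables (m : nat) (U : set 'rV[R]_m).
Hypothesis oU : open U.

Lemma eq_smooth_on k (f g : 'rV[R]_m -> 'rV[R]_k) :
  (forall x, U x -> f x = g x) -> smooth_on U f -> smooth_on U g.
Proof.
move=> fg /(smooth_on_coord _ oU) sf; apply/smooth_on_coord => // j.
by apply: eq_smooth_fun (sf j) => // x Ux; rewrite fg.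
Qed.

Lemma smooth_on_comp k l (V : set 'rV[R]_k) (g : 'rV[R]_k -> 'rV[R]_l)
    (f : 'rV[R]_m -> 'rV[R]_k) :
  open V -> smooth_on V g -> smooth_on U f -> (forall x, U x -> V (f x)) ->
  smooth_on U (fun x => g (f x)).
Proof.
move=> oV /(smooth_on_coord _ oV) sg /(smooth_on_coord _ oU) sf fUV.
by apply/smooth_on_coord => // j; exact: (smooth_fun_comp oU (sg j)).
Qed.

Lemma smooth_on_row_mx k l (f : 'rV[R]_m -> 'rV[R]_k) (g : 'rV[R]_m -> 'rV[R]_l) :
  smooth_on U f -> smooth_on U g -> smooth_on U (fun x => row_mx (f x) (g x)).
Proof.
move=> /(smooth_on_coord _ oU) sf /(smooth_on_coord _ oU) sg.
apply/smooth_on_coord => // j; rewrite -(splitK j); case: (fintype.split j) => i /=.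
- by apply: eq_smooth_fun (sf i) => // x _; rewrite row_mxEl.
- by apply: eq_smooth_fun (sg i) => // x _; rewrite row_mxEr.
Qed.

Lemma smooth_on_lsubmx k l (f : 'rV[R]_m -> 'rV[R]_(k + l)) :
  smooth_on U f -> smooth_on U (fun x => lsubmx (f x)).
Proof.
move=> /(smooth_on_coord _ oU) sf; apply/smooth_on_coord => // j.
by apply: eq_smooth_fun (sf (lshift _ j)) => // x _; rewrite mxE.
Qed.

Lemma smooth_on_rsubmx k l (f : 'rV[R]_m -> 'rV[R]_(k + l)) :
  smooth_on U f -> smooth_on U (fun x => rsubmx (f x)).
Proof.
move=> /(smooth_on_coord _ oU) sf; apply/smooth_on_coord => // j.
by apply: eq_smooth_fun (sf (rshift _ j)) => // x _; rewrite mxE.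
Qed.

Lemma smooth_on_id : smooth_on U id.
Proof. by apply/smooth_on_coord => // j; exact: smooth_fun_coord. Qed.

Lemma smooth_on_cst k (a : 'rV[R]_k) : smooth_on U (fun=> a).
Proof. by apply/smooth_on_coord => // j; exact: smooth_fun_cst. Qed.

Lemma smooth_on_mxvec k l (f : 'rV[R]_m -> 'M[R]_(k, l)) :
  (forall i j, smooth_fun U (fun x => f x i j)) -> smooth_on U (fun x => mxvec (f x)).
Proof.
move=> sf; apply/smooth_on_coord => // j; case/mxvec_indexP: j => i j.
by apply: eq_smooth_fun (sf i j) => // x _; rewrite mxvecE.
Qed.

Lemma smooth_fun_vec_mx k l (f : 'rV[R]_m -> 'rV[R]_(k * l)) i j :
  smooth_on U f -> smooth_fun U (fun x => vec_mx (f x) i j).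
Proof.
move=> /(smooth_on_coord _ oU)/(_ (mxvec_index i j)).
by apply: eq_smooth_fun => // x _; rewrite mxE.
Qed.

Lemma smooth_on_open_preim k (f : 'rV[R]_m -> 'rV[R]_k) V :
  smooth_on U f -> open V -> open (U `&` f @^-1` V).
Proof.
move=> sf oV; rewrite openE => x [Ux Vfx].
rewrite /interior; apply: filterI; first exact: open_nbhs_nbhs.
by apply: (sf 0%N x Ux); exact: open_nbhs_nbhs.
Qed.

End Comp.

Lemma local_smooth_on m k (U : set 'rV[R]_m) (f : 'rV[R]_m -> 'rV[R]_k) :
  (forall x, U x -> exists2 W, W x & smooth_on W f) -> smooth_on U f.
Proof.
move=> H r; elim: r f H => [|r IH] f H /=.
  by move=> x /H[W Wx sf]; exact: (sf 0%N).
split=> [x /H[W Wx sf]|i]; first by have [+ _] := sf 1%N; exact.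
apply: IH => x /H[W Wx sf]; exists W => // s.
by have [_] := sf s.+1; exact.
Qed.

Lemma sub_smooth_on m k (U V : set 'rV[R]_m) (f : 'rV[R]_m -> 'rV[R]_k) :
  U `<=` V -> smooth_on V f -> smooth_on U f.
Proof. by move=> UV sf; apply: local_smooth_on => x /UV Vx; exists V. Qed.

Lemma smooth_on_diff m k (U : set 'rV[R]_m) (f : 'rV[R]_m -> 'rV[R]_k) x :
  smooth_on U f -> U x -> differentiable f x.
Proof. by move=> sf; have [+ _] := sf 1%N; exact. Qed.

Lemma smooth_fun_det m (U : set 'rV[R]_m) k (f : 'rV[R]_m -> 'M[R]_k) :
  open U -> (forall i j, smooth_fun U (fun x => f x i j)) ->
  smooth_fun U (fun x => \det (f x)).
Proof.
move=> oU; elim: k f => [|k IH] f sf.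
  apply: (eq_smooth_fun oU _ (@smooth_fun_cst R m U 1)) => x _.
  by rewrite det_mx00.
apply: (eq_smooth_fun oU _ (f := fun x => \sum_j f x ord0 j * cofactor (f x) ord0 j)).
  by move=> x _; rewrite -expand_det_row.
apply: smooth_fun_sum => // j; apply: smooth_funM => //.
rewrite /cofactor; apply: smooth_funM => //; first exact: smooth_fun_cst.
apply: IH => i l; apply: eq_smooth_fun (sf (lift ord0 i) (lift j l)) => // x _.
by rewrite !mxE.
Qed.

(** Invertible matrices are the complement of the zeros of a polynomial. *)
Lemma open_unit_mxvec k : open [set y : 'rV[R]_(k * k) | vec_mx y \in unitmx].
Proof.
have sd : smooth_on setT (fun y : 'rV[R]_(k * k) => (\det (vec_mx y))%:M : 'rV[R]_1).
  apply/smooth_on_coord; first exact: openT.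
  move=> j; apply: (eq_smooth_fun openT _ (f := fun y => \det (vec_mx y))).
    by move=> x _; rewrite mxE [j]ord1 eqxx mulr1n.
  apply: smooth_fun_det => [|i l]; first exact: openT.
  by apply: smooth_fun_vec_mx; [exact: openT | apply: smooth_on_id; exact: openT].
have oV : open ((fun z : 'rV[R]_1 => z 0 0) @^-1` [set a : R | a != 0]).
  apply: open_comp; last exact: (@open_neq R).
  by move=> z _; exact: coord_continuous.
have := smooth_on_open_preim openT sd oV; rewrite setTI.
congr open; apply/seteqP.
by split=> y /=; rewrite unitmxE unitfE mxE eqxx mulr1n.
Qed.

End SmoothVectors.

(** * Smooth manifolds *)

Lemma atlas_openE (R : realType) (m : nat) (N : premanifold R m) (U : set N) :
  open U = atlas_open U.
Proof. by []. Qed.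

Section Topology.
Variables (R : realType) (m : nat) (N : premanifold R m).
Hypothesis hN : smooth_atlas N.
Implicit Types c d : chart R N m.

Let cc c : matlas N c -> coordinate_chart c.
Proof. by have [+ _ _] := hN; exact. Qed.

Lemma chart_inj c p q : matlas N c -> cdom c p -> cdom c q -> c p = c q -> p = q.
Proof. by move=> /cc[_ inj] cp cq; apply: inj; exact/mem_set. Qed.

Lemma chart_exists (p : N) : exists c, chart_at p c.
Proof. by have [_ /(_ p)[c hc cp] _] := hN; exists c. Qed.

Lemma atlasE c (V : zmodType) (f : N -> V) q : matlas N c -> cdom c q -> cexpr c f (c q) = f q.
Proof. by move=> /cc; exact: cexprE. Qed.

Lemma transition_open c d : matlas N c -> matlas N d -> open (c @` (cdom c `&` cdom d)).
Proof. by move=> hc hd; have [_ _ /(_ c d hc hd)[]] := hN. Qed.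

Lemma transition_smooth c d : matlas N c -> matlas N d ->
  smooth_on (c @` (cdom c `&` cdom d)) (cexpr c d).
Proof. by move=> hc hd; have [_ _ /(_ c d hc hd)[]] := hN. Qed.

(** In another chart d this set is the preimage of W by the change of coordinates,
    which is continuous. *)
Lemma chart_preim_open c W : matlas N c -> open W -> open (cdom c `&` c @^-1` W : set N).
Proof.
rewrite atlas_openE => hc oW d p hd [cp Wp] dp.
exists (d @` (cdom d `&` cdom c) `&` cexpr d c @^-1` W); split.
- apply: smooth_on_open_preim => //; [exact: transition_open | exact: transition_smooth].
- by split; [exists p | rewrite /= atlasE].
- move=> q [dq [[q' [dq' cq'] e]]] /=; have {cq' dq' e q'} cq : cdom c q.
    by rewrite -(chart_inj hd dq' dq e).
  by rewrite atlasE.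
Qed.

Lemma cdom_open c : matlas N c -> open (cdom c : set N).
Proof.
by move=> hc; have := chart_preim_open hc openT; rewrite preimage_setT setIT.
Qed.

Lemma chart_image_open c (U : set N) : matlas N c -> open U -> open (c @` (U `&` cdom c)).
Proof.
move=> hc; rewrite atlas_openE => oU; rewrite openE => y [p [Up cp] <-].
have [W [oW Wp WU]] := oU c p hc Up cp.
have oc : open (c @` cdom c) by case: (cc hc).
have nW : nbhs (c p) (W `&` c @` cdom c).
  by apply: open_nbhs_nbhs; split; [exact: openI | split => //; exists p].
by apply: filterS nW => z [Wz [q cq qz]]; exists q => //; split=> //; apply: WU; split=> //=;
   rewrite qz.
Qed.

End Topology.

Section SmoothCriterion.
Variables (R : realType) (m k : nat) (A : premanifold R m) (B : premanifold R k).
Hypotheses (hA : smooth_atlas A) (hB : smooth_atlas B).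

(** Any other expression of f is locally the composite of h with changes of
    coordinates in the source and in the target. *)
Lemma smooth_in_local (U : set A) (f : A -> B) : open U ->
  (forall p, U p -> exists c d W (h : 'rV[R]_m -> 'rV[R]_k),
    [/\ chart_at p c, chart_at (f p) d, open W /\ W (c p), smooth_on W h &
     forall q, cdom c q -> W (c q) -> cdom d (f q) /\ d (f q) = h (c q)]) ->
  smooth_in U f.
Proof.
move=> oU H; split.
  move=> p /H[c [d [W [h [[hc cp] [hd dp] [oW Wp] sh E]]]]] V.
  rewrite nbhsE => -[V' [oV' V'p] V'V]; rewrite nbhs_simpl /=.
  pose Z := W `&` h @^-1` (d @` (V' `&` cdom d)).
  have oZ : open Z by apply: smooth_on_open_preim => //; exact: chart_image_open.
  have := chart_preim_open hA hc oZ => oZ'.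
  have : nbhs p (cdom c `&` c @^-1` Z).
    apply: open_nbhs_nbhs; split => //; split => //; split => //=.
    by have [_ <-] := E p cp Wp; exists (f p).
  apply: filterS => q [cq [Wq [r [V'r dr] rh]]]; apply: V'V.
  have [dq e] := E q cq Wq.
  by rewrite /= (_ : f q = r) //; apply: (chart_inj hB hd) => //; rewrite e.
move=> c' d' hc' hd'; apply: local_smooth_on => _ [p [[Up c'p] d'p] <-].
have [c [d [W [h [[hc cp] [hd dp] [oW Wp] sh E]]]]] := H p Up.
pose Z := W `&` h @^-1` (d @` (cdom d `&` cdom d')).
have oZ : open Z by apply: smooth_on_open_preim => //; exact: transition_open.
pose W' := c' @` (cdom c' `&` cdom c) `&` cexpr c' c @^-1` Z.
have oW' : open W'.
  apply: smooth_on_open_preim => //; first exact: transition_open.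
  exact: transition_smooth.
exists W'.
  split; first by exists p.
  rewrite /= atlasE //; split => //=.
  by have [_ <-] := E p cp Wp; exists (f p).
have W'c : W' `<=` c' @` (cdom c' `&` cdom c) by move=> y [].
have s1 : smooth_on W' (cexpr c' c).
  by apply: sub_smooth_on W'c _; exact: transition_smooth.
have s2 : smooth_on W' (fun y => h (cexpr c' c y)).
  by apply: (smooth_on_comp oW' oW sh s1) => y [_ []].
have s3 : smooth_on W' (fun y => cexpr d d' (h (cexpr c' c y))).
  apply: (smooth_on_comp oW' _ _ s2 (V := d @` (cdom d `&` cdom d'))).
  - exact: transition_open.
  - exact: transition_smooth.
  - by move=> y [_ []].
apply: eq_smooth_on s3 => // y [[q [c'q cq] <-]] /=.
rewrite !atlasE // => -[Wq [r [dr d'r] er]].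
have [dq e] := E q cq Wq.
by rewrite -e atlasE.
Qed.

Lemma smooth_map_local (f : A -> B) :
  (forall p, exists c d W (h : 'rV[R]_m -> 'rV[R]_k),
    [/\ chart_at p c, chart_at (f p) d, open W /\ W (c p), smooth_on W h &
     forall q, cdom c q -> W (c q) -> cdom d (f q) /\ d (f q) = h (c q)]) ->
  smooth_map f.
Proof. by move=> H; apply: smooth_in_local => [|p _]; [exact: openT | exact: H]. Qed.

Lemma smooth_map_preim_open (f : A -> B) V : smooth_map f -> open V -> open (f @^-1` V).
Proof.
move=> [cf _] oV; apply: open_comp => // p _; exact: cf.
Qed.

Lemma smooth_map_rep (f : A -> B) c d : smooth_map f -> matlas A c -> matlas B d ->
  let W := c @` (f @^-1` cdom d `&` cdom c) in
  open W /\ smooth_on W (cexpr c (d \o f)).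
Proof.
move=> sf hc hd W; split.
  by apply: chart_image_open => //; apply: smooth_map_preim_open => //; exact: cdom_open.
have [_ /(_ c d hc hd)] := sf; apply: sub_smooth_on.
by move=> _ [p [dp cp] <-]; exists p.
Qed.

End SmoothCriterion.

Lemma cexprK (R : realType) (T : Type) m (c : chart R T m) (V : zmodType)
    (f : T -> V) q :
  coordinate_chart c -> cdom c q -> cexpr c f (c q) = f q.
Proof. by move=> ? ?; rewrite (@cexprE _ _ (Premanifold T setT)). Qed.

(** Changes of coordinates are given here by an explicit formula h, smooth on the
    image V of the overlap. *)
Lemma compatibleI (R : realType) (T : Type) m (c d : chart R T m)
    (V : set 'rV[R]_m) (h : 'rV[R]_m -> 'rV[R]_m) :
  coordinate_chart c -> open V -> c @` (cdom c `&` cdom d) = V -> smooth_on V h ->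
  (forall q, cdom c q -> cdom d q -> d q = h (c q)) -> compatible c d.
Proof.
move=> cc oV eV sh E; rewrite -eV in oV sh; split => //.
by apply: eq_smooth_on sh => // _ [q [cq dq] <-]; rewrite cexprK // E.
Qed.

(** * Tangent vectors and their components *)

Section TangentComponents.
Variables (R : realType) (m : nat) (N : premanifold R m) (p : N).
Implicit Types (c d : chart R N m) (v w : tangent p).

Lemma tcompD v w c : (v + w) c = v c + w c.
Proof. by []. Qed.

Lemma tcompZ a v c : (a *: v) c = a *: v c.
Proof. by []. Qed.

Lemma tcomp0 c : (0 : tangent p) c = 0.
Proof. by []. Qed.

Lemma tcomp_sum (I : Type) (r : seq I) (v : I -> tangent p) c :
  (\sum_(i <- r) v i) c = \sum_(i <- r) v i c.
Proof.
elim: r => [|i r IH]; first by rewrite !big_nil tcomp0.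
by rewrite !big_cons tcompD IH.
Qed.

Lemma tcomp_change v c d : chart_at p c -> chart_at p d ->
  v d = v c *m 'J (cexpr c d) (c p).
Proof. by case: v => f /= hf hc hd; have /asboolP[+ _] := hf; apply. Qed.

(** The components in one chart determine those in all the others. *)
Lemma tcomp_inj v w c : chart_at p c -> v c = w c -> v = w.
Proof.
move=> hc vw; apply: val_inj; apply/funext => d /=.
have [hd|hd] := pselect (chart_at p d); first by rewrite !(tcomp_change _ hc hd) vw.
case: v w {vw} => f hf [g hg] /=.
by have /asboolP[_ ->] := hf => //; have /asboolP[_ ->] := hg.
Qed.

Hypothesis hN : smooth_atlas N.

Lemma d_E c i : chart_at p c -> d_ p c i c = 'e_i.
Proof. by move=> hc; rewrite tvecE. Qed.

Definition comp_mx k c (e : 'I_k -> tangent p) : 'M[R]_(k, m) :=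
  \matrix_(a, b) (e a c) 0 b.

Lemma comp_mx_sum k c (e : 'I_k -> tangent p) (a : 'I_k -> R) :
  (\sum_i a i *: e i) c = (\row_i a i) *m comp_mx c e.
Proof.
apply/rowP => j; rewrite tcomp_sum summxE !mxE; apply: eq_bigr => i _.
by rewrite !mxE.
Qed.

Lemma is_basisP c (e : 'I_m -> tangent p) : chart_at p c ->
  is_basis e <-> comp_mx c e \in unitmx.
Proof.
move=> hc; split=> [[gen _]|eU].
  have /choice[A HA] : forall k, exists a : 'I_m -> R, d_ p c k = \sum_i a i *: e i.
    by move=> k; exact: gen.
  have /mulmx1_unit[] // : (\matrix_(i, j) A i j) *m comp_mx c e = 1%:M.
  apply/row_matrixP => k; rewrite row_mul row1 -(d_E k hc) HA comp_mx_sum.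
  by congr (_ *m _); apply/rowP => j; rewrite !mxE.
split=> [v|a].
  exists (fun i => (v c *m invmx (comp_mx c e)) 0 i); apply: (tcomp_inj hc).
  rewrite comp_mx_sum (_ : \row_i _ = v c *m invmx (comp_mx c e)) ?mulmxKV //.
  by apply/rowP => i; rewrite mxE.
move/(congr1 (fun v : tangent p => v c)); rewrite comp_mx_sum tcomp0.
move/(congr1 (mulmx^~ (invmx (comp_mx c e)))); rewrite mul0mx mulmxK //.
by move/rowP => + i => /(_ i); rewrite !mxE.
Qed.

End TangentComponents.

(** * Examples of smooth atlases *)

Section Atlases.
Variable R : realType.

Lemma smooth_fun_jacobian m k (V : set 'rV[R]_m) (f : 'rV[R]_m -> 'rV[R]_k) i j :
  open V -> smooth_on V f -> smooth_fun V (fun x => 'J f x i j).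
Proof.
move=> oV sf; apply: (eq_smooth_fun oV (f := fun x => 'D_('e_i) (fun y => f y 0 j) x)).
  by move=> x Vx; rewrite jacobianE //; exact: smooth_on_diff Vx.
by apply: smooth_fun_derive; exact: (smooth_on_coord f oV).1.
Qed.

Lemma smooth_atlas_line : smooth_atlas (lineM R).
Proof.
have im : (fun t : R => t%:M : 'rV[R]_1) @` setT = setT.
  by apply/seteqP; split => // y _; exists (y 0 0) => //; rewrite -mx11_scalar.
have cc : coordinate_chart (Chart setT (fun t : R => t%:M) : chart R R 1).
  split; first by rewrite /= im; exact: openT.
  move=> s t _ _ /= /matrixP/(_ 0 0).
  by rewrite !mxE !eqxx !mulr1n.
split.
- by move=> _ /= ->.
- by move=> p; exists (Chart setT (fun t => t%:M)).
- move=> _ _ /= -> ->; apply: (compatibleI (V := setT) (h := id)) => //.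
  + exact: openT.
  + by rewrite /= setTI im.
  + by apply: smooth_on_id; exact: openT.
Qed.

Lemma open_row_mx m k (S : set 'rV[R]_m) (T : set 'rV[R]_k) : open S -> open T ->
  open [set y : 'rV[R]_(m + k) | S (lsubmx y) /\ T (rsubmx y)].
Proof.
move=> oS oT; apply: openI.
- have := smooth_on_open_preim openT
    (smooth_on_lsubmx openT (@smooth_on_id R (m + k) _ openT)) oS.
  by rewrite setTI.
- have := smooth_on_open_preim openT
    (smooth_on_rsubmx openT (@smooth_on_id R (m + k) _ openT)) oT.
  by rewrite setTI.
Qed.

Lemma chart_prod_image (S T : Type) m k (c : chart R S m) (d : chart R T k) U V :
  chart_prod c d @` (U `*` V) =
  [set y | (c @` U) (lsubmx y) /\ (d @` V) (rsubmx y)].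
Proof.
apply/seteqP; split=> [_ [[p q] [/= Up Vq] <-]|y [[p Up ep] [q Vq eq]]].
  by rewrite row_mxKl row_mxKr; split; [exists p | exists q].
by exists (p, q) => //=; rewrite ep eq hsubmxK.
Qed.

Lemma smooth_on_split m k (V : set 'rV[R]_m) (W : set 'rV[R]_k)
    m' k' (f : 'rV[R]_m -> 'rV[R]_m') (g : 'rV[R]_k -> 'rV[R]_k') :
  open V -> open W -> smooth_on V f -> smooth_on W g ->
  smooth_on [set y : 'rV[R]_(m + k) | V (lsubmx y) /\ W (rsubmx y)]
    (fun y => row_mx (f (lsubmx y)) (g (rsubmx y))).
Proof.
move=> oV oW sf sg; have oU := open_row_mx oV oW.
have sid := @smooth_on_id R _ _ oU.
apply: smooth_on_row_mx => //.
- by apply: (smooth_on_comp oU oV sf (smooth_on_lsubmx oU sid)) => y [].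
- by apply: (smooth_on_comp oU oW sg (smooth_on_rsubmx oU sid)) => y [].
Qed.

Lemma smooth_atlas_prod m k (A : premanifold R m) (B : premanifold R k) :
  smooth_atlas A -> smooth_atlas B -> smooth_atlas (prodM A B).
Proof.
move=> hA hB.
have cc c d : matlas A c -> matlas B d -> coordinate_chart (chart_prod c d).
  move=> hc hd; split.
    rewrite chart_prod_image; apply: open_row_mx.
      by case: hA => /(_ c hc)[].
    by case: hB => /(_ d hd)[].
  move=> [p q] [p' q'] /set_mem[/= cp dq] /set_mem[/= cp' dq'] /eq_row_mx[ep eq].
  by rewrite (chart_inj hA hc cp cp' ep) (chart_inj hB hd dq dq' eq).
split.
- by move=> _ [c [d [hc hd ->]]]; exact: cc.
- move=> [p q]; have [c [hc cp]] := chart_exists hA p.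
  have [d [hd dq]] := chart_exists hB q.
  by exists (chart_prod c d) => //; exists c, d.
- move=> _ _ [c [d [hc hd ->]]] [c' [d' [hc' hd' ->]]].
  have o1 := transition_open hA hc hc'; have o2 := transition_open hB hd hd'.
  apply: (compatibleI (V := [set y | (c @` (cdom c `&` cdom c')) (lsubmx y) /\
        (d @` (cdom d `&` cdom d')) (rsubmx y)])
      (h := fun y => row_mx (cexpr c c' (lsubmx y)) (cexpr d d' (rsubmx y)))).
  + exact: cc.
  + exact: open_row_mx.
  + by rewrite -chart_prod_image /= setXI.
  + by apply: smooth_on_split => //; exact: transition_smooth.
  + move=> [p q] [/= cp dq] [/= cp' dq'].
    by rewrite row_mxKl row_mxKr (atlasE hA) // (atlasE hB).
Qed.

Lemma smooth_atlas_open m (N : premanifold R m) (U : set N) :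
  smooth_atlas N -> open U -> smooth_atlas (openM U).
Proof.
move=> hN oU.
have im (c : chart R N m) (S : set N) : chart_sub U c @` [set p | S (val p)] = c @` (U `&` S).
  apply/seteqP; split=> [_ [p Sp <-]|_ [p [Up Sp] <-]].
    by exists (val p) => //; split => //; exact: set_valP.
  by exists (exist _ p (mem_set Up)).
have cc (c : chart R N m) : matlas N c -> coordinate_chart (chart_sub U c).
  move=> hc; split.
    by rewrite (im c (cdom c)); exact: chart_image_open.
  move=> p q /set_mem /= cp /set_mem /= cq e.
  by apply: val_inj; exact: (chart_inj hN hc cp cq e).
split.
- by move=> _ [c hc <-]; exact: cc.
- move=> p; have [c [hc cp]] := chart_exists hN (val p).
  by exists (chart_sub U c) => //; exists c.
- move=> _ _ [c hc <-] [d hd <-].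
  have oS : open (c @` (U `&` cdom d `&` cdom c)).
    by apply: chart_image_open => //; apply: openI => //; exact: cdom_open.
  apply: (compatibleI (V := c @` (U `&` cdom d `&` cdom c)) (h := cexpr c d)) => //.
  + exact: cc.
  + rewrite -setIA [cdom d `&` _]setIC -im //.
  + apply: sub_smooth_on (transition_smooth hN hc hd).
    by move=> _ [p [[_ dp] cp] <-]; exists p.
  + by move=> p /= cp dp; rewrite (atlasE hN).
Qed.

End Atlases.

(** * Local expressions of differentials *)

Section Differentials.
Variable R : realType.

Lemma mul_jacobian m k (f g : 'rV[R]_m -> 'rV[R]_k) x u :
  (\near x, f x = g x) -> differentiable g x -> u *m 'J f x = 'D_u g x.
Proof.
move=> fg dg; have gf : \near x, g x = f x by apply: filterS fg.
have df := near_eq_differentiable gf dg.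
by rewrite -deriveEjacobian // (near_eq_derive _ fg).
Qed.

Lemma near_cexpr m (N : premanifold R m) (p : N) (c : chart R N m) k
    (f : N -> 'rV[R]_k) (U : set N) (W : set 'rV[R]_m) h :
  smooth_atlas N -> chart_at p c -> open U -> U p -> open W -> W (c p) ->
  (forall q, cdom c q -> U q -> W (c q) -> f q = h (c q)) ->
  \forall y \near c p, cexpr c f y = h y.
Proof.
move=> hN [hc cp] oU Up oW Wp E.
have oV : open (c @` (U `&` cdom c)) by exact: chart_image_open.
apply: (near_open (U := c @` (U `&` cdom c) `&` W)).
- exact: openI.
- by split => //; exists p.
- by move=> _ [[q [Uq cq] <-] Wq]; rewrite (atlasE hN) // E.
Qed.

Lemma tcomp_change_rep m (N : premanifold R m) (p : N) (v : tangent p)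
    (c d : chart R N m) (W : set 'rV[R]_m) (h : 'rV[R]_m -> 'rV[R]_m) :
  smooth_atlas N -> chart_at p c -> chart_at p d -> open W -> W (c p) ->
  smooth_on W h ->
  (forall q, cdom c q -> cdom d q -> W (c q) -> d q = h (c q)) ->
  v d = 'D_(v c) h (c p).
Proof.
move=> hN hc hd oW Wp sh E; rewrite (tcomp_change v hc hd).
apply: mul_jacobian; last exact: smooth_on_diff sh Wp.
by apply: (near_cexpr hN hc (cdom_open hN hd.1) hd.2 oW Wp) => q *; exact: E.
Qed.

Lemma pushforward_rep m k (A : premanifold R m) (B : premanifold R k) (f : A -> B)
    (p : A) (v : tangent p) (w : tangent (f p)) c d
    (W : set 'rV[R]_m) (h : 'rV[R]_m -> 'rV[R]_k) :
  smooth_atlas A -> is_pushforward f v w -> chart_at p c -> chart_at (f p) d ->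
  open W -> W (c p) -> smooth_on W h ->
  (forall q, cdom c q -> W (c q) -> d (f q) = h (c q)) ->
  w d = 'D_(v c) h (c p).
Proof.
move=> hA fvw hc hd oW Wp sh E; rewrite (fvw c d hc hd).
apply: mul_jacobian; last exact: smooth_on_diff sh Wp.
by apply: (near_cexpr hA hc openT I oW Wp) => q *; exact: E.
Qed.

(** A local left inverse l of the expression h of f gives D l o D h = id, so that the
    differential of f is injective. *)
Lemma immersion_local m k (A : premanifold R m) (B : premanifold R k) (f : A -> B) :
  smooth_atlas A -> smooth_map f ->
  (forall p, exists c d W (h : 'rV[R]_m -> 'rV[R]_k) (l : 'rV[R]_k -> 'rV[R]_m),
    [/\ chart_at p c /\ chart_at (f p) d, open W /\ W (c p),
      smooth_on W h, differentiable l (h (c p)) &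
      (forall q, cdom c q -> W (c q) -> d (f q) = h (c q)) /\
      (forall y, W y -> l (h y) = y)]) ->
  immersion f.
Proof.
move=> hA sf H; split=> // p v fv0.
have [c [d [W [h [l [[hc hd] [oW Wp] sh dl [E lh]]]]]]] := H p.
have dh : differentiable h (c p) by exact: smooth_on_diff sh Wp.
have := pushforward_rep hA fv0 hc hd oW Wp sh E; rewrite tcomp0 => /esym Dh0.
apply: (tcomp_inj hc); rewrite tcomp0.
have <- : 'D_(v c) (l \o h) (c p) = v c.
  rewrite -[RHS](derive_id (c p) (v c)); apply: near_eq_derive.
  exact: (near_open oW Wp).
rewrite deriveE; last exact: differentiable_comp.
by rewrite diff_comp //= -(deriveE _ dh) Dh0 linear0.
Qed.

End Differentials.

(** * The bundle of frames as a manifold *)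

Section FrameBundle.
Variables (R : realType) (m : nat) (N : premanifold R m).
Hypothesis hN : smooth_atlas N.

Definition frame_mx (c : chart R N m) (u : frame N) : 'M[R]_m := comp_mx c u.

Lemma frame_chartE c (u : frame N) :
  frame_chart c u = row_mx (c (fpt u)) (mxvec (frame_mx c u)).
Proof. by []. Qed.

Lemma frame_mx_unit c (u : frame N) : chart_at (fpt u) c -> frame_mx c u \in unitmx.
Proof. by move=> hc; apply/(is_basisP hN _ hc); exact: fvec_basis. Qed.

Lemma frame_eq c (u v : frame N) : fpt u = fpt v -> chart_at (fpt u) c ->
  frame_mx c u = frame_mx c v -> u = v.
Proof.
case: u v => p e be [q f bf] /= epq; subst q => hc; rewrite /frame_mx /= => ef.
have {}ef : e = f.
  apply/funext => i; apply: (tcomp_inj hc); apply/rowP => j.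
  by move/matrixP/(_ i j): ef; rewrite !mxE.
by subst f; congr Frame; exact: Prop_irrelevance.
Qed.

Lemma frame_exists c p (A : 'M[R]_m) : chart_at p c -> A \in unitmx ->
  exists u : frame N, fpt u = p /\ frame_mx c u = A.
Proof.
move=> hc AU.
have cA : comp_mx c (fun a => tvec p c (row a A)) = A.
  by apply/matrixP => i j; rewrite mxE tvecE // mxE.
have be : is_basis (fun a => tvec p c (row a A)).
  by apply/(is_basisP hN _ hc); rewrite cA.
by exists (Frame be).
Qed.

Lemma frame_chart_image c (S : set N) : matlas N c ->
  frame_chart c @` [set u | (S `&` cdom c) (fpt u)] =
  [set y | (c @` (S `&` cdom c)) (lsubmx y) /\ vec_mx (rsubmx y) \in unitmx].
Proof.
move=> hc; apply/seteqP; split=> [_ [u [Su cu] <-]|y [[p [Sp cp] ep] yU]].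
  rewrite frame_chartE; split; first by rewrite row_mxKl; exists (fpt u).
  by rewrite row_mxKr mxvecK frame_mx_unit //; case: Su.
have [u [up uA]] := @frame_exists c p _ (conj hc cp) yU.
exists u; first by rewrite /= up.
by rewrite frame_chartE up uA vec_mxK ep hsubmxK.
Qed.

Lemma open_frame_image (V : set 'rV[R]_m) : open V ->
  open [set y : 'rV[R]_(m + m * m) | V (lsubmx y) /\ vec_mx (rsubmx y) \in unitmx].
Proof. by move=> oV; apply: open_row_mx oV (@open_unit_mxvec R m). Qed.

(** The matrix of components of a frame is multiplied on the right by the Jacobian of
    the change of coordinates. *)
Lemma smooth_atlas_frame : smooth_atlas (frameM N).
Proof.
have cc c : matlas N c -> coordinate_chart (frame_chart c).
  move=> hc; split.
    have := frame_chart_image setT hc; rewrite setTI => ->.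
    by apply: open_frame_image; have [/(_ c hc)[]] := hN.
  move=> u v /set_mem cu /set_mem cv; rewrite !frame_chartE => /eq_row_mx[e1 e2].
  have e3 : fpt u = fpt v := chart_inj hN hc cu cv e1.
  exact: (frame_eq e3 (conj hc cu) (can_inj mxvecK e2)).
split.
- by move=> _ [c hc <-]; exact: cc.
- move=> u; have [c [hc cu]] := chart_exists hN (fpt u).
  by exists (frame_chart c) => //; exists c.
- move=> _ _ [c hc <-] [d hd <-].
  pose V := c @` (cdom d `&` cdom c).
  have oV : open V by apply: chart_image_open => //; exact: cdom_open.
  have sV : smooth_on V (cexpr c d).
    apply: sub_smooth_on (transition_smooth hN hc hd).
    by move=> _ [p [dp cp] <-]; exists p.
  have oW := open_frame_image oV.
  have sid := smooth_on_id oW.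
  apply: (compatibleI (V := [set y | V (lsubmx y) /\ vec_mx (rsubmx y) \in unitmx])
     (h := fun y => row_mx (cexpr c d (lsubmx y))
             (mxvec (vec_mx (rsubmx y) *m 'J (cexpr c d) (lsubmx y))))) => //.
  + exact: cc.
  + by rewrite -frame_chart_image // setIC.
  + apply: smooth_on_row_mx => //.
      by apply: (smooth_on_comp oW oV sV (smooth_on_lsubmx oW sid)) => y [].
    apply: smooth_on_mxvec => // i j.
    apply: (eq_smooth_fun oW (f := fun y => \sum_k vec_mx (rsubmx y) i k *
        'J (cexpr c d) (lsubmx y) k j)); first by move=> y _; rewrite mxE.
    apply: smooth_fun_sum => // k; apply: smooth_funM => //.
      by apply: smooth_fun_vec_mx => //; exact: smooth_on_rsubmx.
    have sJ := smooth_fun_jacobian k j oV sV.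
    apply: (smooth_fun_comp oW sJ _) => [l|y [//]].
    exact: (smooth_on_coord _ oW).1 (smooth_on_lsubmx oW sid) l.
  + move=> u cu du; rewrite !frame_chartE /= row_mxKl row_mxKr mxvecK (atlasE hN) //.
    congr (row_mx _ (mxvec _)); apply/row_matrixP => i; rewrite row_mul.
    have hc' : chart_at (fpt u) c by []; have hd' : chart_at (fpt u) d by [].
    have := tcomp_change (u i) hc' hd'.
    have E e : row i (frame_mx e u) = u i e by apply/rowP => j; rewrite !mxE.
    by rewrite !E.
Qed.

End FrameBundle.

(** * Separation and countability *)

Section SeparationCountability.
Variable R : realType.

(** Points with different images are separated in T, and the others in a common
    chart.  For adapted frames f is the projection to M. *)
Lemma hausdorff_charts m (A : premanifold R m) (T : topologicalType) (f : A -> T) :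
  smooth_atlas A -> hausdorff_space T -> continuous f ->
  (forall p q, f p = f q -> exists2 c, chart_at p c & chart_at q c) ->
  hausdorff_space A.
Proof.
move=> hA; rewrite !open_hausdorff => hT cf H p q /eqP pq.
have [fpq|/eqP fpq] := pselect (f p = f q); last first.
  have [[U V] /= [/set_mem Ufp /set_mem Vfq] [oU oV /eqP UV]] := hT _ _ fpq.
  exists (f @^-1` U, f @^-1` V) => /=; first by split; apply/mem_set.
  split; [by apply: open_comp => // *; exact: cf|by apply: open_comp => // *; exact: cf|].
  by rewrite -preimage_setI UV preimage_set0.
have [c [hc cp] [_ cq]] := H p q fpq.
have cpq : c p != c q by apply/eqP => /(chart_inj hA hc cp cq).
have := @norm_hausdorff R 'rV[R]_m; rewrite open_hausdorff => /(_ _ _ cpq).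
move=> [[U V] /= [/set_mem Ucp /set_mem Vcq] [oU oV /eqP UV]].
exists (cdom c `&` c @^-1` U, cdom c `&` c @^-1` V) => /=.
  by split; apply/mem_set.
split; [exact: chart_preim_open|exact: chart_preim_open|].
by rewrite setIACA -preimage_setI UV preimage_set0 setI0.
Qed.

(** Balls with rational centre and radius. *)
Lemma second_countable_rV m : @second_countable 'rV[R]_m.
Proof.
pose b (z : 'rV[rat]_m * rat) : set 'rV[R]_m :=
  ball (map_mx (ratr : rat -> R) z.1) (ratr z.2).
exists (b @` [set z | 0 < z.2]).
  by apply: sub_countable (card_image_le _ _) _; exact: countableP.
split.
  by move=> _ [z /= z0 <-]; apply: ball_open; rewrite ltr0q.
move=> x V /nbhs_ballP[e /= e0 eV].
have e2 : 0 < e / 2 by rewrite divr_gt0.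
have [r] := rat_in_itvoo e2; rewrite in_itv /= => /andP[r0 re].
have r0' : 0 < r by rewrite ltr0q in r0.
have /choice[q Hq] : forall j, exists q : rat, `|x 0 j - ratr q| < ratr r.
  move=> j; have xr : x 0 j - ratr r < x 0 j + ratr r by rewrite ltrBlDr -addrA ltrDl addr_gt0.
  have [q] := rat_in_itvoo xr; rewrite in_itv /= => /andP[q1 q2].
  by exists q; rewrite ltr_distlC; apply/andP; split; lra.
pose Q : 'rV[rat]_m := \row_j q j.
have bx : ball x (ratr r) (map_mx (ratr : rat -> R) Q).
  by split=> // i j; rewrite [i]ord1 !mxE; exact: Hq.
exists (b (Q, r)).
  by split; [exists (Q, r) | exact: ball_sym].
move=> y Qy; apply: eV; have := ball_triangle bx Qy.
by apply: le_ball; rewrite [leRHS]splitr lerD // ltW.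
Qed.

(** Pull back a countable basis of R^m by each chart of C. *)
Lemma second_countable_charts m (A : premanifold R m) (C : set (chart R A m)) :
  smooth_atlas A -> countable C -> C `<=` matlas A ->
  (forall p, exists2 c, C c & cdom c p) -> @second_countable A.
Proof.
move=> hA cC CA Ccov; have [B cB [oB nB]] := second_countable_rV m.
pose b (z : chart R A m * set 'rV[R]_m) : set A := cdom z.1 `&` z.1 @^-1` z.2.
exists (b @` (C `*` B)).
  by apply: sub_countable (card_image_le _ _) _; exact: countableX.
split.
  by move=> _ [[c W] /= [/CA hc /oB oW] <-]; exact: chart_preim_open.
move=> p V; rewrite nbhsE => -[U [oU Up] UV].
have [c Cc cp] := Ccov p; have hc := CA _ Cc.
have oW := chart_image_open hA hc oU.
have [|W [BW Wp] WU] := nB (c p) (c @` (U `&` cdom c)).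
  by apply: open_nbhs_nbhs; split => //; exists p.
exists (b (c, W)); first by split => //; exists (c, W).
move=> q [/= cq /WU [q' [Uq' cq'] e]]; apply: UV.
by rewrite -(chart_inj hA hc cq' cq e).
Qed.

(** Lindelof's argument: choose a chart around each member of a countable basis that
    is contained in some chart domain. *)
Lemma countable_atlas m (A : premanifold R m) : smooth_atlas A ->
  @second_countable A -> exists C : set (chart R A m),
    [/\ countable C, C `<=` matlas A & forall p, exists2 c, C c & cdom c p].
Proof.
move=> hA [B cB [oB nB]].
pose ok (V : set A) := exists2 c, matlas A c & V `<=` cdom c.
have /choice[f Hf] : forall V, exists c, ok V -> matlas A c /\ V `<=` cdom c.
  move=> V; have [[c hc Vc]|nV] := pselect (ok V); first by exists c.
  by exists (Chart set0 (fun=> 0)).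
exists (f @` (B `&` ok)); split.
- apply: sub_countable (card_image_le _ _) _.
  by apply: sub_countable cB; apply: subset_card_le; exact: subIsetl.
- by move=> _ [V [BV okV] <-]; have [] := Hf V okV.
- move=> p; have [c [hc cp]] := chart_exists hA p.
  have [|V [BV Vp] Vc] := nB p (cdom c).
    by apply: open_nbhs_nbhs; split => //; exact: cdom_open.
  have okV : ok V by exists c.
  exists (f V); first by exists V.
  by have [_ ] := Hf V okV; exact.
Qed.

End SeparationCountability.

(** * Curves and their derivatives in charts *)

Section Curves.
Variables (R : realType) (n : nat) (M : premanifold R n).
Hypothesis hM : smooth_atlas M.
Implicit Types (c d : chart R M n) (g : curve M).

(** Smoothness of a curve is a statement on the space of 1 x 1 matrices, but its jets
    are defined by derivatives of functions of a real variable. *)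
Lemma derive1_line (f : 'rV[R]_1 -> R) t :
  derive1 (fun s => f s%:M) t = 'D_('e_0) f t%:M.
Proof.
rewrite /derive1 /derive; congr (lim _); apply/congr2 => //; apply/funext => h /=.
congr (_ *: (f _ - _)); apply/rowP => j; rewrite !mxE [j]ord1 eqxx.
by rewrite !mulr1n mulr1.
Qed.

Definition curve_expr c g (z : 'rV[R]_1) : 'rV[R]_n := c (g (z 0 0)).

Lemma curve_expr_smooth c g : matlas M c ->
  let W := [set z : 'rV[R]_1 | cdom c (g (z 0 0))] in
  open W /\ smooth_on W (curve_expr c g).
Proof.
case: g => g sg hc W.
have hl : matlas (lineM R) (Chart setT (fun t => t%:M)) by [].
have [oV sV] := smooth_map_rep (smooth_atlas_line R) hM sg hl hc.
have eW : (fun t : R => t%:M : 'rV[R]_1) @` (g @^-1` cdom c `&` setT) = W.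
  apply/seteqP; split=> [_ [t [/= gt _] <-]|z Wz]; first by rewrite /W /= mxE eqxx mulr1n.
  by exists (z 0 0) => //; rewrite -mx11_scalar.
rewrite /= eW in oV sV; split=> //.
apply: eq_smooth_on sV => // z Wz.
have -> : z = (z 0 0)%:M by exact: mx11_scalar.
have /= -> := atlasE (smooth_atlas_line R) (c \o g : lineM R -> 'rV[R]_n) hl (q := z 0 0) I.
by rewrite /curve_expr /= mxE eqxx mulr1n.
Qed.

Lemma deriv_in0 c t g : deriv_in c 0 t g = c (g t).
Proof. by apply/rowP => i; rewrite mxE. Qed.

Lemma deriv_in1 c t g i :
  deriv_in c 1 t g 0 i = 'D_('e_0) (fun z => curve_expr c g z 0 i) t%:M.
Proof.
rewrite mxE -derive1_line /derive1n /=; congr (derive1 _ t).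
by apply/funext => s; rewrite /curve_expr mxE eqxx mulr1n.
Qed.

Lemma deriv_in2 c t g i :
  deriv_in c 2 t g 0 i =
    'D_('e_0) (fun z => 'D_('e_0) (fun z => curve_expr c g z 0 i) z) t%:M.
Proof.
rewrite mxE -derive1_line /derive1n /=; congr (derive1 _ t).
apply/funext => s; rewrite -derive1_line; congr (derive1 _ s).
by apply/funext => r; rewrite /curve_expr mxE eqxx mulr1n.
Qed.

Variables (c d : chart R M n).
Hypotheses (hc : matlas M c) (hd : matlas M d).

Let V := c @` (cdom c `&` cdom d).

(** In [dtr i k] and [ddtr j i k] the last index is the component of the change of
    coordinates and the others are directions of differentiation. *)
Definition tr k (x : 'rV[R]_n) : R := cexpr c d x 0 k.
Definition dtr i k (x : 'rV[R]_n) : R := 'D_('e_i) (tr k) x.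
Definition ddtr j i k (x : 'rV[R]_n) : R := 'D_('e_j) (dtr i k) x.

Lemma tr_smooth k : smooth_fun V (tr k).
Proof.
have oV := transition_open hM hc hd.
exact: (smooth_on_coord _ oV).1 (transition_smooth hM hc hd) k.
Qed.

Lemma dtr_smooth i k : smooth_fun V (dtr i k).
Proof. by apply: smooth_fun_derive; exact: tr_smooth. Qed.

Lemma ddtr_smooth j i k : smooth_fun V (ddtr j i k).
Proof. by apply: smooth_fun_derive; exact: dtr_smooth. Qed.

Lemma ddtr_sym i j k x : V x -> ddtr i j k x = ddtr j i k x.
Proof. by move=> Vx; exact: derive_comm (transition_open hM hc hd) (tr_smooth k) Vx. Qed.

Section Curve.
Variable g : curve M.
Let W := [set z : 'rV[R]_1 | cdom c (g (z 0 0)) /\ cdom d (g (z 0 0))].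

Let oW : open W.
Proof. by apply: openI; apply: (curve_expr_smooth _ _).1. Qed.

Let sc i : smooth_fun W (fun z => curve_expr c g z 0 i).
Proof.
apply: (smooth_on_coord _ oW).1; apply: sub_smooth_on (curve_expr_smooth g hc).2.
by move=> z [].
Qed.

Let WV z : W z -> V (curve_expr c g z).
Proof. by move=> [cz dz]; exists (g (z 0 0)). Qed.

Let diffc z : W z -> differentiable (curve_expr c g) z.
Proof. by move=> Wz; apply/differentiable_rVP => i; exact: smooth_fun_diff (sc i) Wz. Qed.

Let derive1_change z k : W z ->
  'D_('e_0) (fun z => curve_expr d g z 0 k) z =
  \sum_i 'D_('e_0) (fun z => curve_expr c g z 0 i) z * dtr i k (curve_expr c g z).
Proof.
move=> Wz; transitivity ('D_('e_0) (fun z => tr k (curve_expr c g z)) z).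
  apply: near_eq_derive; apply: (near_open oW Wz) => y [cy dy].
  by rewrite /tr /curve_expr (atlasE hM).
apply: derive_comp_rV; first exact: diffc.
exact: smooth_fun_diff (tr_smooth k) (WV Wz).
Qed.

Lemma deriv_in1_change t k : cdom c (g t) -> cdom d (g t) ->
  deriv_in d 1 t g 0 k = \sum_i deriv_in c 1 t g 0 i * dtr i k (c (g t)).
Proof.
move=> ct dt; have tE : (t%:M : 'rV[R]_1) 0 0 = t by rewrite mxE eqxx mulr1n.
have Wt : W t%:M by rewrite /W /= tE.
rewrite deriv_in1 derive1_change //; apply: eq_bigr => i _.
by rewrite -deriv_in1 /curve_expr tE.
Qed.

(** The transformation law of the velocity holds at all times near t, and may be
    differentiated. *)
Lemma deriv_in2_change t k : cdom c (g t) -> cdom d (g t) ->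
  deriv_in d 2 t g 0 k = \sum_i (deriv_in c 2 t g 0 i * dtr i k (c (g t)) +
    deriv_in c 1 t g 0 i *
      \sum_j deriv_in c 1 t g 0 j * ddtr j i k (c (g t))).
Proof.
move=> ct dt; have tE : (t%:M : 'rV[R]_1) 0 0 = t by rewrite mxE eqxx mulr1n.
have Wt : W t%:M by rewrite /W /= tE.
rewrite [LHS]deriv_in2.
rewrite (near_eq_derive _ (near_open oW Wt (fun z Wz => derive1_change k Wz))).
have dd i : differentiable (dtr i k) (curve_expr c g t%:M).
  exact: smooth_fun_diff (dtr_smooth i k) (WV Wt).
rewrite derive_sumM.
- apply: eq_bigr => i _; rewrite -deriv_in2 -deriv_in1 /curve_expr tE.
  congr (_ + _ * _); rewrite derive_comp_rV; [|exact: diffc|exact: dd].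
  by apply: eq_bigr => j _; rewrite -deriv_in1 /curve_expr tE.
- move=> i; exact: smooth_fun_diff (smooth_fun_derive _ (sc i)) Wt.
- move=> i; apply: (@differentiable_comp _ _ _ _ (curve_expr c g) (dtr i k)) => //.
  exact: diffc.
Qed.

End Curve.

End Curves.

(** * Curves with a given initial velocity *)

Section CurveExistence.
Variables (R : realType) (n : nat) (M : premanifold R n).
Hypothesis hM : smooth_atlas M.

(** This reparametrization has derivative 1 at 0 but is bounded by 1 / 2k: it keeps a
    straight line of the chart inside the chart domain for all times. *)
Let phi (k s : R) := s * (1 + k * k * (s * s))^-1.

Let phi_den k s : 0 < 1 + k * k * (s * s) :> R.
Proof. by rewrite ltr_pwDl // mulr_ge0 // -expr2 sqr_ge0. Qed.

Let phi_bound k s : 0 < k -> `|phi k s| <= (2 * k)^-1.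
Proof.
move=> k0; rewrite normrM (gtr0_norm (x := _^-1)) ?invr_gt0 ?phi_den //.
rewrite ler_pdivrMr ?phi_den // mulrC ler_pdivlMr ?mulr_gt0 //.
have -> : s * s = `|s| * `|s| by rewrite -normrM -expr2 ger0_norm // sqr_ge0.
have : 0 <= (k * `|s| - 1) ^+ 2 by exact: sqr_ge0.
nra.
Qed.

(** Jets are jets of curves defined on all of R, so the line c p + (s - t) v must be
    kept inside a ball contained in the image of c. *)
Lemma curve_exists (c : chart R M n) p t (v : 'rV[R]_n) : chart_at p c ->
  exists g : curve M, g t = p /\ deriv_in c 1 t g = v.
Proof.
move=> [hc cp].
have /open_nbhs_nbhs/nbhs_ballP[e /= e0 eV] : open_nbhs (c p) (c @` cdom c).
  by split; [have [/(_ c hc)[]] := hM | exists p].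
(* chosen so that |v| / 2k < e *)
pose k := (`|v| + 1) / e.
have v1 : 0 < `|v| + 1 by rewrite ltr_wpDl.
have k0 : 0 < k by rewrite divr_gt0.
pose x s := c p + phi k (s - t) *: v.
have xE s : exists q, cdom c q /\ c q = x s.
  have [|q cq e'] := eV (x s); last by exists q.
  rewrite -ball_normE /= /x opprD addrA subrr add0r normrN normrZ.
  apply: (@le_lt_trans _ _ ((2 * k)^-1 * `|v|)).
    by apply: ler_wpM2r => //; exact: phi_bound.
  have ek : e * k = `|v| + 1 by rewrite /k mulrC divfK // gt_eqF.
  have ee : e = (2 * k)^-1 * (2 * (`|v| + 1)) by rewrite -ek; field; rewrite gt_eqF.
  have k20 : 0 < (2 * k)^-1 by rewrite invr_gt0; exact: mulr_gt0.
  by rewrite [ltRHS]ee (ltr_pM2l k20); have := normr_ge0 v; lra.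
have [f Hf] := choice xE.
have w_smooth : smooth_fun setT
    (fun z : 'rV[R]_1 => (1 + k * k * ((z 0 0 - t) * (z 0 0 - t)))^-1).
  have szt : smooth_fun setT (fun z : 'rV[R]_1 => z 0 0 - t).
    apply: smooth_funD; [exact: openT | exact: smooth_fun_coord | exact: smooth_fun_cst].
  have cst a := @smooth_fun_cst R 1 setT a.
  apply: smooth_funV; first exact: openT; last by move=> z _; rewrite gt_eqF.
  apply: smooth_funD (cst _) _; first exact: openT.
  apply: smooth_funM (cst _) _; first exact: openT.
  by apply: smooth_funM => //; exact: openT.
have zt_smooth : smooth_fun setT (fun z : 'rV[R]_1 => z 0 0 - t).
  apply: smooth_funD; [exact: openT | exact: smooth_fun_coord | exact: smooth_fun_cst].
have sf : smooth_map (f : lineM R -> M).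
  apply: smooth_map_local => //; first exact: smooth_atlas_line.
  move=> s; exists (Chart setT (fun t => t%:M)), c, setT, (fun z => x (z 0 0)); split.
  - by [].
  - by split => //; have [] := Hf s.
  - by split => //; exact: openT.
  - apply/smooth_on_coord; first exact: openT.
    move=> j; apply: (eq_smooth_fun openT (f := fun z => c p 0 j + (z 0 0 - t) *
       (1 + k * k * ((z 0 0 - t) * (z 0 0 - t)))^-1 * v 0 j)).
      by move=> z _; rewrite !mxE.
    apply: smooth_funD; [exact: openT | exact: smooth_fun_cst |].
    apply: smooth_funM; [exact: openT | | exact: smooth_fun_cst].
    by apply: smooth_funM => //; exact: openT.
  - by move=> q _ _ /=; have [cq ->] := Hf q; split=> //; rewrite mxE eqxx mulr1n.
exists (Curve sf); split.
  rewrite /=; apply: (chart_inj hM hc _ cp); first by have [] := Hf t.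
  by have [_ ->] := Hf t; rewrite /x subrr /phi mul0r scale0r addr0.
apply/rowP => i; rewrite [LHS]deriv_in1.
have -> : (fun z => curve_expr c (Curve sf) z 0 i) = fun z => (c p 0 i : R) +
   ((z 0 0 - t) * ((1 + k * k * ((z 0 0 - t) * (z 0 0 - t)))^-1 * v 0 i)).
  apply/funext => z; rewrite /curve_expr /=; have [_ ->] := Hf (z 0 0).
  by rewrite !mxE mulrA.
have dz : differentiable (fun z : 'rV[R]_1 => z 0 0 - t) t%:M.
  exact: smooth_fun_diff zt_smooth I.
have dw : differentiable (fun z : 'rV[R]_1 =>
    (1 + k * k * ((z 0 0 - t) * (z 0 0 - t)))^-1 * v 0 i) t%:M.
  apply: (smooth_fun_diff (U := setT)) => //.
  by apply: smooth_funM => //; [exact: openT | exact: smooth_fun_cst].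
have tE : (t%:M : 'rV[R]_1) 0 0 = t by rewrite mxE eqxx mulr1n.
rewrite deriveD_diff; [|exact: differentiable_cst|exact: (differentiableM dz dw)].
rewrite derive_cst add0r deriveM_diff // tE subrr !mul0r !mulr0 !addr0 invr1 mul1r.
rewrite deriveD_diff; [|exact: differentiable_coord|exact: differentiable_cst].
by rewrite derive_cst addr0 derive_row_coord mxE eqxx mul1r.
Qed.

End CurveExistence.

(** * The manifold of 1-jets *)

Section Jets.
Local Open Scope quotient_scope.
Variables (R : realType) (n : nat) (M : premanifold R n).
Hypothesis hM : smooth_atlas M.
Implicit Types (c d : chart R M n) (t : R) (g : curve M).

Lemma jet_eqP r x y : same_jet r x y <-> \pi_(jet M r) x = \pi_(jet M r) y.
Proof.
split=> [|e]; last by apply/EquivQuot.eqmodP; exact: e.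
by move/EquivQuot.eqmodP; exact.
Qed.

Lemma jet_pi r t g : let J := \pi_(jet M r) (t, g) in
  [/\ jet_time J = t, jet_point J = g t &
    forall c k, chart_at (g t) c -> (k <= r)%N -> jet_deriv c k J = deriv_in c k t g].
Proof.
move=> J; have : same_jet r (repr J) (t, g).
  by apply/jet_eqP; exact: reprK.
by move=> /asboolP[e1 e2 e3]; split=> // c k hc kr; apply: e3 => //; rewrite e2.
Qed.

Lemma jet_deriv1_change r (J : jet M r) c d k : matlas M c -> matlas M d ->
  cdom c (jet_point J) -> cdom d (jet_point J) ->
  jet_deriv d 1 J 0 k =
    \sum_i jet_deriv c 1 J 0 i * dtr c d i k (c (jet_point J)).
Proof. by move=> hc hd cJ dJ; exact: (deriv_in1_change hM). Qed.

Lemma jet_deriv2_change r (J : jet M r) c d k : matlas M c -> matlas M d ->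
  cdom c (jet_point J) -> cdom d (jet_point J) ->
  jet_deriv d 2 J 0 k =
    \sum_i (jet_deriv c 2 J 0 i * dtr c d i k (c (jet_point J)) +
      jet_deriv c 1 J 0 i *
        \sum_j jet_deriv c 1 J 0 j * ddtr c d j i k (c (jet_point J))).
Proof. by move=> hc hd cJ dJ; exact: (deriv_in2_change hM). Qed.

(** Equality of derivatives in one chart propagates to the others by the
    transformation law of velocities. *)
Lemma jet1_eq (J J' : jet M 1) c : chart_at (jet_point J) c ->
  jet_time J = jet_time J' -> jet_point J = jet_point J' ->
  jet_deriv c 1 J = jet_deriv c 1 J' -> J = J'.
Proof.
move=> [hc cJ] et ep ev; rewrite -[J]reprK -[J']reprK.
apply/jet_eqP/asboolP; split => //.
move=> d [|[|k]] [hd dJ] kr; last by exfalso; move: kr.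
  by rewrite !deriv_in0; congr (d _).
apply/rowP => k; rewrite -/(jet_deriv d 1 J) -/(jet_deriv d 1 J').
rewrite (jet_deriv1_change k hc hd cJ dJ) ep in ev *.
by rewrite (@jet_deriv1_change _ J' c d) -?ep // ev.
Qed.

Lemma jet1_exists c t p (v : 'rV[R]_n) : chart_at p c ->
  exists J : jet M 1, [/\ jet_time J = t, jet_point J = p & jet_deriv c 1 J = v].
Proof.
move=> hc; have [g [gt gv]] := curve_exists hM t v hc.
have [e1 e2 e3] := jet_pi 1 t g.
by exists (\pi_(jet M 1) (t, g)); rewrite e1 e2 e3 // gt.
Qed.

Definition pos_of (y : 'rV[R]_(1 + (n + n))) : 'rV[R]_n := lsubmx (rsubmx y).
Definition vel_of (y : 'rV[R]_(1 + (n + n))) : 'rV[R]_n := rsubmx (rsubmx y).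

Lemma pos_ofE y i : pos_of y 0 i = y 0 (ix i).
Proof. by rewrite !mxE. Qed.

Lemma vel_ofE y i : vel_of y 0 i = y 0 (iv i).
Proof. by rewrite !mxE. Qed.

Lemma chart1_time c (J : M1 M) : chart1 c J 0 (it n) = jet_time J.
Proof. by rewrite /= row_mxEl mxE eqxx mulr1n. Qed.

Lemma chart1_pos c (J : M1 M) : pos_of (chart1 c J) = c (jet_point J).
Proof. by rewrite /pos_of /= row_mxKr row_mxKl. Qed.

Lemma chart1_vel c (J : M1 M) : vel_of (chart1 c J) = jet_deriv c 1 J.
Proof. by rewrite /vel_of /= row_mxKr row_mxKr. Qed.

Lemma coord_ind (P : 'I_(1 + (n + n)) -> Prop) :
  P (it n) -> (forall i, P (ix i)) -> (forall i, P (iv i)) -> forall k, P k.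
Proof.
move=> Pt Px Pv k; rewrite -(splitK k); case: (fintype.split k) => [j|j] /=.
  by rewrite [j]ord1.
by rewrite -(splitK j); case: (fintype.split j) => i /=; [exact: Px | exact: Pv].
Qed.


Lemma chart1_image c (S : set M) : matlas M c ->
  chart1 c @` [set J | (S `&` cdom c) (jet_point J)] =
  [set y | (c @` (S `&` cdom c)) (pos_of y)].
Proof.
move=> hc; apply/seteqP; split=> [_ [J SJ <-]|y [p [Sp cp] ep]].
  by rewrite /mkset chart1_pos; exists (jet_point J).
have [J [et eJ ev]] := jet1_exists (y 0 (it n)) (vel_of y) (conj hc cp).
exists J; first by rewrite /= eJ.
apply/rowP; apply: coord_ind => [|i|i].
- by rewrite chart1_time et.
- by rewrite -pos_ofE chart1_pos eJ ep pos_ofE.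
- by rewrite -vel_ofE chart1_vel ev vel_ofE.
Qed.

Section Smooth.
Variables (m : nat) (U : set 'rV[R]_m) (oU : open U).
Variable f : 'rV[R]_m -> 'rV[R]_(1 + (n + n)).
Hypothesis sf : smooth_on U f.

Lemma smooth_on_pos : smooth_on U (fun y => pos_of (f y)).
Proof. by apply: smooth_on_lsubmx => //; exact: smooth_on_rsubmx. Qed.

Lemma smooth_on_vel : smooth_on U (fun y => vel_of (f y)).
Proof. by apply: smooth_on_rsubmx => //; exact: smooth_on_rsubmx. Qed.

End Smooth.

Lemma open_pos (V : set 'rV[R]_n) : open V ->
  open [set y : 'rV[R]_(1 + (n + n)) | V (pos_of y)].
Proof.
move=> oV; have := smooth_on_open_preim openT
  (smooth_on_pos openT (smooth_on_id (m := 1 + (n + n)) (R := R) openT)) oV.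
by rewrite setTI.
Qed.

Definition chart1_change c d (y : 'rV[R]_(1 + (n + n))) : 'rV[R]_(1 + (n + n)) :=
  row_mx (lsubmx y) (row_mx (\row_k tr c d k (pos_of y))
    (\row_k \sum_i vel_of y 0 i * dtr c d i k (pos_of y))).

Lemma chart1_changeE c d (J : M1 M) : matlas M c -> matlas M d ->
  cdom c (jet_point J) -> cdom d (jet_point J) ->
  chart1 d J = chart1_change c d (chart1 c J).
Proof.
move=> hc hd cJ dJ; apply/rowP; apply: coord_ind => [|k|k].
- by rewrite chart1_time row_mxEl mxE -[lshift _ _]/(it n) chart1_time.
- rewrite -[LHS]pos_ofE -[RHS]pos_ofE chart1_pos /pos_of row_mxKr row_mxKl [RHS]mxE.
  by rewrite -/(pos_of _) chart1_pos /tr (atlasE hM).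
- rewrite -[LHS]vel_ofE -[RHS]vel_ofE chart1_vel {1}/vel_of row_mxKr row_mxKr [RHS]mxE.
  rewrite (jet_deriv1_change k hc hd) //.
  by apply: eq_bigr => i _; rewrite chart1_vel chart1_pos.
Qed.

Definition overlap1 c d : set 'rV[R]_(1 + (n + n)) :=
  [set y | (c @` (cdom c `&` cdom d)) (pos_of y)].

Lemma open_overlap1 c d : matlas M c -> matlas M d -> open (overlap1 c d).
Proof. by move=> hc hd; apply: open_pos; exact: transition_open. Qed.

Section Change.
Variables (c d : chart R M n).
Hypotheses (hc : matlas M c) (hd : matlas M d).
Let oU := open_overlap1 hc hd.
Let spos : smooth_on (overlap1 c d) pos_of := smooth_on_pos oU (smooth_on_id oU).
Let svel : smooth_on (overlap1 c d) vel_of := smooth_on_vel oU (smooth_on_id oU).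
Let sposi := (smooth_on_coord _ oU).1 spos.

Lemma tr_pos_smooth k : smooth_fun (overlap1 c d) (fun y => tr c d k (pos_of y)).
Proof. by apply: (smooth_fun_comp oU (tr_smooth hM hc hd k)) => [i|y //]; exact: sposi. Qed.

Lemma dtr_pos_smooth i k : smooth_fun (overlap1 c d) (fun y => dtr c d i k (pos_of y)).
Proof. by apply: (smooth_fun_comp oU (dtr_smooth hM hc hd i k)) => [j|y //]; exact: sposi. Qed.

Lemma ddtr_pos_smooth j i k :
  smooth_fun (overlap1 c d) (fun y => ddtr c d j i k (pos_of y)).
Proof. by apply: (smooth_fun_comp oU (ddtr_smooth hM hc hd j i k)) => [l|y //]; exact: sposi. Qed.

Lemma vel_smooth i : smooth_fun (overlap1 c d) (fun y => vel_of y 0 i).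
Proof. exact: (smooth_on_coord _ oU).1 svel i. Qed.

Lemma chart1_change_smooth : smooth_on (overlap1 c d) (chart1_change c d).
Proof.
apply: smooth_on_row_mx => //.
  by apply: smooth_on_lsubmx => //; exact: smooth_on_id.
apply: smooth_on_row_mx => //; apply/smooth_on_coord => // k.
  by apply: (eq_smooth_fun oU _ (tr_pos_smooth k)) => y _; rewrite mxE.
apply: (eq_smooth_fun oU (f := fun y => \sum_i vel_of y 0 i * dtr c d i k (pos_of y))).
  by move=> y _; rewrite mxE.
apply: smooth_fun_sum => // i; apply: smooth_funM => //; first exact: vel_smooth.
exact: dtr_pos_smooth.
Qed.

End Change.

Lemma coordinate_chart1 c : matlas M c -> coordinate_chart (chart1 c).
Proof.
move=> hc; split.
  have -> : cdom (chart1 c) = [set J | (setT `&` cdom c) (jet_point J)] by rewrite setTI.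
  by rewrite chart1_image // setTI; apply: open_pos; have [/(_ c hc)[]] := hM.
move=> J J' /set_mem cJ /set_mem cJ' e.
apply: (@jet1_eq J J' c (conj hc cJ)).
- by rewrite -(chart1_time c) e chart1_time.
- by apply: (chart_inj hM hc) => //; rewrite -chart1_pos e chart1_pos.
- by rewrite -chart1_vel e chart1_vel.
Qed.

Lemma smooth_atlas_M1 : smooth_atlas (M1 M).
Proof.
split.
- by move=> _ [c hc <-]; exact: coordinate_chart1.
- move=> J; have [c [hc cJ]] := chart_exists hM (jet_point J).
  by exists (chart1 c) => //; exists c.
- move=> _ _ [c hc <-] [d hd <-].
  apply: (compatibleI (V := overlap1 c d) (h := chart1_change c d)).
  + exact: coordinate_chart1.
  + exact: open_overlap1.
  + by rewrite setIC /overlap1 [in RHS]setIC -chart1_image.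
  + exact: chart1_change_smooth.
  + by move=> J cJ dJ; rewrite -chart1_changeE.
Qed.

Lemma smooth_atlas_M0 : smooth_atlas (M0 M).
Proof. by apply: smooth_atlas_prod => //; exact: smooth_atlas_line. Qed.

Lemma chart1_at c (J : M1 M) : chart_at (jet_point J) c -> chart_at J (chart1 c).
Proof. by move=> [hc cJ]; split => //; exists c. Qed.

Lemma jet_point_smooth : smooth_map (@jet_point R n M 1 : M1 M -> M).
Proof.
apply: smooth_map_local => //; first exact: smooth_atlas_M1.
move=> J; have [c hc] := chart_exists hM (jet_point J).
exists (chart1 c), c, setT, pos_of; split => //.
- exact: chart1_at.
- by split => //; exact: openT.
- by apply: smooth_on_pos; [exact: openT | apply: smooth_on_id; exact: openT].
- by move=> q cq _; rewrite chart1_pos.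
Qed.

End Jets.

(** * Change of coordinates on the 1-jets *)

Section Tangent1Jets.
Variables (R : realType) (n : nat) (M : premanifold R n).
Hypothesis hM : smooth_atlas M.
Implicit Types (c d : chart R M n) (J : M1 M).

Lemma sum_coord (V : nmodType) (f : 'I_(1 + (n + n)) -> V) :
  \sum_m f m = f (it n) + \sum_i f (ix i) + \sum_i f (iv i).
Proof. by rewrite big_split_ord big_ord1 big_split_ord /= addrA. Qed.

Lemma blocks_t (A : Type) (a0 : A) (a1 a2 : 'I_n -> A) : blocks a0 a1 a2 (it n) = a0.
Proof. by rewrite /blocks -[it n]/(unsplit (inl _)) unsplitK. Qed.

Lemma blocks_x (A : Type) (a0 : A) (a1 a2 : 'I_n -> A) i : blocks a0 a1 a2 (ix i) = a1 i.
Proof.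
rewrite /blocks -[ix i]/(unsplit (inr (lshift n i))) unsplitK.
by rewrite -[lshift n i]/(unsplit (inl _)) unsplitK.
Qed.

Lemma blocks_v (A : Type) (a0 : A) (a1 a2 : 'I_n -> A) i : blocks a0 a1 a2 (iv i) = a2 i.
Proof.
rewrite /blocks -[iv i]/(unsplit (inr (rshift n i))) unsplitK.
by rewrite -[rshift n i]/(unsplit (inr _)) unsplitK.
Qed.

Definition blocksE := (blocks_t, blocks_x, blocks_v).

Lemma derive_pos (f : 'rV[R]_n -> R) (y w : 'rV[R]_(1 + (n + n))) :
  differentiable f (pos_of y) ->
  'D_w (fun y => f (pos_of y)) y = \sum_j w 0 (ix j) * 'D_('e_j) f (pos_of y).
Proof.
move=> df; have dp : differentiable (@pos_of R n) y.
  apply: (smooth_on_diff (U := setT)) => //; apply: smooth_on_pos; first exact: openT.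
  by apply: smooth_on_id; exact: openT.
rewrite derive_comp_rV //; apply: eq_bigr => j _; congr (_ * _).
rewrite (_ : (fun y => _) = fun y : 'rV[R]_(1 + (n + n)) => y 0 (ix j)).
  by rewrite derive_row_coord.
by apply/funext => z; rewrite pos_ofE.
Qed.

Lemma derive_vel (y w : 'rV[R]_(1 + (n + n))) i :
  'D_w (fun y => vel_of y 0 i) y = w 0 (iv i).
Proof.
rewrite (_ : (fun y => _) = fun y : 'rV[R]_(1 + (n + n)) => y 0 (iv i)).
  by rewrite derive_row_coord.
by apply/funext => z; rewrite vel_ofE.
Qed.

Section Change.
Variables (c d : chart R M n) (y : 'rV[R]_(1 + (n + n))).

Lemma chart1_change_t : (chart1_change c d y) 0 (it n) = y 0 (it n).
Proof. by rewrite row_mxEl mxE. Qed.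

Lemma chart1_change_x k : (chart1_change c d y) 0 (ix k) = tr c d k (pos_of y).
Proof. by rewrite row_mxEr row_mxEl mxE. Qed.

Lemma chart1_change_v k : (chart1_change c d y) 0 (iv k) =
  \sum_i vel_of y 0 i * dtr c d i k (pos_of y).
Proof. by rewrite row_mxEr row_mxEr mxE. Qed.

End Change.

Section DeriveChange.
Variables (c d : chart R M n).
Hypotheses (hc : matlas M c) (hd : matlas M d).
Variables (y w : 'rV[R]_(1 + (n + n))).
Hypothesis Uy : overlap1 c d y.

Lemma derive_change_t :
  'D_w (fun y => (chart1_change c d y) 0 (it n)) y = w 0 (it n).
Proof.
rewrite (_ : (fun y => _) = fun y : 'rV[R]_(1 + (n + n)) => y 0 (it n)).
  by rewrite derive_row_coord.
by apply/funext => z; rewrite chart1_change_t.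
Qed.

Lemma derive_change_x k :
  'D_w (fun y => (chart1_change c d y) 0 (ix k)) y =
  \sum_i w 0 (ix i) * dtr c d i k (pos_of y).
Proof.
rewrite (_ : (fun y => _) = fun y => tr c d k (pos_of y)).
  by rewrite derive_pos //; exact: smooth_fun_diff (tr_smooth hM hc hd k) Uy.
by apply/funext => z; rewrite chart1_change_x.
Qed.

Lemma derive_change_v k :
  'D_w (fun y => (chart1_change c d y) 0 (iv k)) y =
  \sum_i (w 0 (iv i) * dtr c d i k (pos_of y) +
    vel_of y 0 i * \sum_j w 0 (ix j) * ddtr c d j i k (pos_of y)).
Proof.
rewrite (_ : (fun y => _) = fun y => \sum_i vel_of y 0 i * dtr c d i k (pos_of y)); last first.
  by apply/funext => z; rewrite chart1_change_v.
rewrite derive_sumM.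
- apply: eq_bigr => i _; rewrite derive_vel derive_pos //.
  exact: smooth_fun_diff (dtr_smooth hM hc hd i k) Uy.
- by move=> i; exact: smooth_fun_diff (vel_smooth hM hc hd i) Uy.
- by move=> i; exact: smooth_fun_diff (dtr_pos_smooth hM hc hd i k) Uy.
Qed.

End DeriveChange.

Section TangentChange.
Variables (c d : chart R M n) (J : M1 M) (v : tangent J).
Hypotheses (hc : chart_at (jet_point J) c) (hd : chart_at (jet_point J) d).

Lemma overlap1_chart : overlap1 c d (chart1 c J).
Proof.
case: hc hd => _ cJ [_ dJ]; rewrite /overlap1 /mkset chart1_pos.
by exists (jet_point J).
Qed.

Let changeE m : v (chart1 d) 0 m =
  'D_(v (chart1 c)) (fun y => (chart1_change c d y) 0 m) (chart1 c J).
Proof.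
rewrite -derive_coord; last first.
  exact: smooth_on_diff (chart1_change_smooth hM hc.1 hd.1) overlap1_chart.
rewrite (tcomp_change_rep v (smooth_atlas_M1 hM) (chart1_at hc) (chart1_at hd)
   (open_overlap1 hM hc.1 hd.1) overlap1_chart (chart1_change_smooth hM hc.1 hd.1)) //.
by move=> q cq dq _; apply: chart1_changeE => //; [case: hc | case: hd].
Qed.

Lemma tcomp_change_t : v (chart1 d) 0 (it n) = v (chart1 c) 0 (it n).
Proof. by rewrite [LHS]changeE derive_change_t. Qed.

Lemma tcomp_change_x k : v (chart1 d) 0 (ix k) =
  \sum_i v (chart1 c) 0 (ix i) * dtr c d i k (c (jet_point J)).
Proof.
rewrite [LHS]changeE (derive_change_x hc.1 hd.1 _ overlap1_chart).
by apply: eq_bigr => i _; rewrite chart1_pos.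
Qed.

(** The second derivatives of the change of coordinates appear here because the
    velocity is multiplied by a Jacobian which depends on x. *)
Lemma tcomp_change_v k : v (chart1 d) 0 (iv k) =
  \sum_i (v (chart1 c) 0 (iv i) * dtr c d i k (c (jet_point J)) +
    jet_deriv c 1 J 0 i *
      \sum_j v (chart1 c) 0 (ix j) * ddtr c d j i k (c (jet_point J))).
Proof.
rewrite [LHS]changeE (derive_change_v hc.1 hd.1 _ overlap1_chart).
by apply: eq_bigr => i _; rewrite chart1_pos chart1_vel.
Qed.

End TangentChange.

Lemma tcomp_change_M c d (x : M) (w : tangent x) k : chart_at x c -> chart_at x d ->
  w d 0 k = \sum_i w c 0 i * dtr c d i k (c x).
Proof.
move=> hc hd.
have oV := transition_open hM hc.1 hd.1; have sV := transition_smooth hM hc.1 hd.1.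
have Vx : (c @` (cdom c `&` cdom d)) (c x) by exists x => //; split; [case: hc|case: hd].
have dV := smooth_on_diff sV Vx.
rewrite (tcomp_change_rep w hM hc hd oV Vx sV); last first.
  by move=> q cq dq _; rewrite (atlasE hM) //; case: hc.
rewrite derive_coord // deriveE_partial //.
by move/differentiable_rVP: dV; exact.
Qed.

(** ** Vertical vectors *)

(** In coordinates p10 does not involve xdot; the two components that it retains
    vanish in every chart as soon as they do in one. *)
Lemma verticalI c J (v : tangent J) : chart_at (jet_point J) c ->
  v (chart1 c) 0 (it n) = 0 -> (forall i, v (chart1 c) 0 (ix i) = 0) -> vertical v.
Proof.
move=> hc vt vx _ _ [[c1 hc1 <-] c1J] [[l [d1 [-> hd1 ->]]] [_ d1J]].
have hc1' : chart_at (jet_point J) c1 by [].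
have hd1' : chart_at (jet_point J) d1 by [].
rewrite tcomp0; apply/esym.
have v1t : v (chart1 c1) 0 (it n) = 0 by rewrite (tcomp_change_t v hc hc1').
have v1x i : v (chart1 c1) 0 (ix i) = 0.
  by rewrite (tcomp_change_x v hc hc1') big1 // => j _; rewrite vx mul0r.
pose h (y : 'rV[R]_(1 + (n + n))) : 'rV[R]_(1 + n) :=
  row_mx (lsubmx y) (\row_k tr c1 d1 k (pos_of y)).
have oU := open_overlap1 hM hc1 hd1.
have Uy := overlap1_chart hc1' hd1'.
have sh : smooth_on (overlap1 c1 d1) h.
  apply: smooth_on_row_mx => //; first by apply: smooth_on_lsubmx => //; exact: smooth_on_id.
  apply/smooth_on_coord => // k.
  by apply: (eq_smooth_fun oU _ (tr_pos_smooth hM hc1 hd1 k)) => y _; rewrite mxE.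
have dh := smooth_on_diff sh Uy.
rewrite (mul_jacobian _ (g := h)) //; last first.
  apply: (near_open oU Uy) => y [x [c1x d1x] yx].
  have [J' [J't J'p J'v]] := jet1_exists hM (y 0 (it n)) (vel_of y) (conj hc1 c1x).
  have <- : chart1 c1 J' = y.
    apply/rowP; apply: coord_ind => [|i|i].
    - by rewrite chart1_time J't.
    - by rewrite -pos_ofE chart1_pos J'p yx pos_ofE.
    - by rewrite -vel_ofE chart1_vel J'v vel_ofE.
  have c1J' : cdom c1 (jet_point J') by rewrite J'p.
  rewrite (@atlasE _ _ (M1 M) (smooth_atlas_M1 hM) (chart1 c1)) //; last by exists c1.
  rewrite /h /= row_mxKl; congr row_mx; apply/rowP => k.
  by rewrite mxE /tr (chart1_pos c1 J') (atlasE hM).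
apply/rowP => m; rewrite derive_coord // [RHS]mxE -(splitK m).
case: (fintype.split m) => k /=.
  rewrite [k]ord1 (_ : (fun y => _) = fun y : 'rV[R]_(1 + (n + n)) => y 0 (it n)).
    by rewrite derive_row_coord.
  by apply/funext => y; rewrite /h row_mxEl mxE.
rewrite (_ : (fun y => _) = fun y => tr c1 d1 k (pos_of y)); last first.
  by apply/funext => y; rewrite /h row_mxEr mxE.
rewrite derive_pos; last exact: smooth_fun_diff (tr_smooth hM hc1 hd1 k) Uy.
by apply: big1 => j _; rewrite v1x mul0r.
Qed.

(** ** Components of the coordinate vector fields *)

Section CoordinateFields.
Variables (c : chart R M n) (J : M1 M).
Hypothesis hc : chart_at (jet_point J) c.
Let e := (eq_lshift, eq_rshift, eq_lrshift, eq_rlshift, eqxx).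

Let dE m m' : (d_ J (chart1 c) m) (chart1 c) 0 m' = (m' == m)%:R.
Proof. by rewrite (d_E (smooth_atlas_M1 hM) _ (chart1_at hc)) mxE eqxx. Qed.

Lemma d_tE m : d_t c J (chart1 c) 0 m = blocks 1 (fun=> 0) (fun=> 0) m.
Proof. by elim/coord_ind: m => [|i|i]; rewrite blocksE dE !e. Qed.

Let sumE (I : finType) (a : I -> R) (f : I -> tangent J) m :
  (\sum_i a i *: f i) (chart1 c) 0 m = \sum_i a i * f i (chart1 c) 0 m.
Proof. by rewrite tcomp_sum summxE; apply: eq_bigr => i _; rewrite tcompZ mxE. Qed.

Let sum_delta (a : 'I_n -> R) k : \sum_i a i * (k == i)%:R = a k.
Proof.
rewrite (bigD1 k) //= eqxx mulr1 big1 ?addr0 // => i ik.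
by rewrite eq_sym (negbTE ik) mulr0.
Qed.

Lemma sum_d_xE a m :
  (\sum_i a i *: d_x c J i) (chart1 c) 0 m = blocks 0 a (fun=> 0) m.
Proof.
elim/coord_ind: m => [|k|k]; rewrite blocksE sumE.
- by apply: big1 => i _; rewrite dE !e mulr0.
- by rewrite -[RHS]sum_delta; apply: eq_bigr => i _; rewrite dE !e.
- by apply: big1 => i _; rewrite dE !e mulr0.
Qed.

Lemma sum_d_xdotE a m :
  (\sum_i a i *: d_xdot c J i) (chart1 c) 0 m = blocks 0 (fun=> 0) a m.
Proof.
elim/coord_ind: m => [|k|k]; rewrite blocksE sumE.
- by apply: big1 => i _; rewrite dE !e mulr0.
- by apply: big1 => i _; rewrite dE !e mulr0.
- by rewrite -[RHS]sum_delta; apply: eq_bigr => i _; rewrite dE !e.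
Qed.

End CoordinateFields.

End Tangent1Jets.

(** * Second order equations in coordinates *)

(* Comparing coordinates in two different charts must not unfold the quotient that
   defines jets. *)
Local Opaque deriv_in jet_point jet_time jet_deriv.

Section Sode.
Variables (R : realType) (n : nat) (M : premanifold R n).
Hypothesis hM : smooth_atlas M.
Variable sigma : M1 M -> M2 M.
Hypothesis hsigma : is_sode sigma.
Implicit Types (c d : chart R M n) (J : M1 M).

(** Since sigma is a section of p21, jets J and sigma J have the same 1-jet. *)
Lemma sigma_proj J : [/\ jet_time (sigma J : jet M 2) = jet_time J,
  jet_point (sigma J : jet M 2) = jet_point J &
  forall c, chart_at (jet_point J) c ->
    jet_deriv c 1 (sigma J : jet M 2) = jet_deriv c 1 J].
Proof.
have [_ /(_ J)] := hsigma; rewrite /p21 /jet_proj.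
set K := sigma J => eJ; have [] := jet_pi 1 (repr K).1 (repr K).2.
rewrite -surjective_pairing eJ => e1 e2 e3; split => // c hc.
by rewrite e3 // -e2.
Qed.

Definition domain1 c : set 'rV[R]_(1 + (n + n)) := [set y | (c @` cdom c) (pos_of y)].

Lemma open_domain1 c : matlas M c -> open (domain1 c).
Proof. by move=> hc; apply: open_pos; have [/(_ c hc)[]] := hM. Qed.

Lemma domain1_image c : matlas M c -> chart1 c @` cdom (chart1 c) = domain1 c.
Proof.
move=> hc; rewrite /domain1 -[cdom c in RHS]setTI -chart1_image //.
by congr (_ @` _); apply/seteqP; split=> J //= [].
Qed.

Lemma domain1_chart c J : chart_at (jet_point J) c -> domain1 c (chart1 c J).
Proof. by move=> [hc cJ]; rewrite -domain1_image //; exists J. Qed.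

Definition Fexpr c i (y : 'rV[R]_(1 + (n + n))) : R :=
  cexpr (chart1 c) (Fvec sigma c) y 0 i.

Lemma FexprE c i J : chart_at (jet_point J) c -> Fexpr c i (chart1 c J) = F sigma c i J.
Proof.
move=> [hc cJ].
by rewrite /Fexpr (cexprK _ (coordinate_chart1 hM hc)).
Qed.

Lemma Fvec_smooth c : matlas M c -> smooth_on (domain1 c) (cexpr (chart1 c) (Fvec sigma c)).
Proof.
move=> hc; have oD := open_domain1 hc; have [[_ ss] _] := hsigma.
have hc1 : matlas (M1 M) (chart1 c) by exists c.
have hc2 : matlas (M2 M) (chart2 c) by exists c.
have {ss} ss := ss _ _ hc1 hc2.
have sD : smooth_on (domain1 c) (cexpr (chart1 c) (chart2 c \o sigma)).
  apply: sub_smooth_on ss; rewrite -domain1_image // => _ [J cJ <-].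
  exists J => //; split=> //; rewrite /preimage /=.
  by have [_ -> _] := sigma_proj J.
have /(smooth_on_rsubmx oD)/(smooth_on_rsubmx oD)/(smooth_on_rsubmx oD) := sD.
apply: eq_smooth_on => // y; rewrite -domain1_image // => -[J cJ <-].
rewrite !(cexprK _ (coordinate_chart1 hM hc)) //=.
by rewrite !row_mxKr.
Qed.

Lemma Fexpr_smooth c i : matlas M c -> smooth_fun (domain1 c) (Fexpr c i).
Proof.
by move=> hc; exact: (smooth_on_coord _ (open_domain1 hc)).1 (Fvec_smooth hc) i.
Qed.

Lemma dF_E c i j J : chart_at (jet_point J) c ->
  dF sigma c i j J = 'D_('e_(iv j)) (Fexpr c i) (chart1 c J).
Proof.
move=> hc; rewrite /dF jacobianE //.
exact: smooth_on_diff (Fvec_smooth hc.1) (domain1_chart hc).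
Qed.

(** F is the second derivative carried by the 2-jet sigma J. *)
Lemma F_change c d J k : chart_at (jet_point J) c -> chart_at (jet_point J) d ->
  F sigma d k J = \sum_i (F sigma c i J * dtr c d i k (c (jet_point J)) +
    xdot c i J * \sum_j xdot c j J * ddtr c d j i k (c (jet_point J))).
Proof.
move=> hc hd; rewrite /F /Fvec /xdot; have [_ ep ev] := sigma_proj J.
have [hc1 cJ] := hc; have [hd1 dJ] := hd.
have cS : cdom c (jet_point (sigma J : jet M 2)) by rewrite ep.
have dS : cdom d (jet_point (sigma J : jet M 2)) by rewrite ep.
by apply: etrans (jet_deriv2_change hM k hc1 hd1 cS dS) _; rewrite ep (ev c hc).
Qed.

(** Differentiate the transformation law of F with respect to xdot^i.  The quadratic
    term D^2(xdot, xdot) contributes D^2(e_i, xdot) + D^2(xdot, e_i), which is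
    2 D^2(e_i, xdot) by symmetry; this is why X^sigma_i involves 1/2 dF. *)
Lemma dF_change c d J i k : chart_at (jet_point J) c -> chart_at (jet_point J) d ->
  \sum_l dtr c d i l (c (jet_point J)) * dF sigma d k l J =
  \sum_j dF sigma c j i J * dtr c d j k (c (jet_point J)) +
    2 * \sum_j xdot c j J * ddtr c d i j k (c (jet_point J)).
Proof.
move=> hc hd; have [hc1 cJ] := hc; have [hd1 dJ] := hd.
set y := chart1 c J; have Uy : overlap1 c d y by exact: overlap1_chart.
have oU := open_overlap1 hM hc1 hd1.
have yE : pos_of y = c (jet_point J) by rewrite chart1_pos.
have Vy : (c @` (cdom c `&` cdom d)) (pos_of y) by [].
have UD z : overlap1 c d z -> domain1 c z by move=> [x [cx dx] zx]; exists x.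
pose Q z := \sum_a (Fexpr c a z * dtr c d a k (pos_of z) +
   vel_of z 0 a * \sum_b vel_of z 0 b * ddtr c d b a k (pos_of z)).
have E z : overlap1 c d z -> Fexpr d k (chart1_change c d z) = Q z.
  move=> Uz; have := UD z Uz; rewrite -domain1_image // => -[J' /= cJ' zJ'].
  have dJ' : cdom d (jet_point J').
    case: Uz => x [cx dx]; rewrite -zJ' (chart1_pos c J').
    by move/(chart_inj hM hc1 cx cJ') => <-.
  have cJ1 : chart_at (jet_point J') c by [].
  have dJ1 : chart_at (jet_point J') d by [].
  rewrite /Q -zJ' -(chart1_changeE hM hc1 hd1 cJ' dJ') (FexprE k dJ1) (F_change k cJ1 dJ1).
  apply: eq_bigr => a _. rewrite (FexprE a cJ1). rewrite chart1_pos. rewrite chart1_vel. exact: erefl.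
have dF' a : differentiable (Fexpr c a) y.
  exact: smooth_fun_diff (Fexpr_smooth a hc1) (UD _ Uy).
have dd a : differentiable (fun z => dtr c d a k (pos_of z)) y.
  exact: smooth_fun_diff (dtr_pos_smooth hM hc1 hd1 a k) Uy.
have dv a : differentiable (fun z : 'rV[R]_(1 + (n + n)) => vel_of z 0 a) y.
  exact: smooth_fun_diff (vel_smooth hM hc1 hd1 a) Uy.
have ddd a b : differentiable (fun z => ddtr c d b a k (pos_of z)) y.
  exact: smooth_fun_diff (ddtr_pos_smooth hM hc1 hd1 b a k) Uy.
have dvd a b : differentiable (fun z => vel_of z 0 b * ddtr c d b a k (pos_of z)) y.
  exact: (differentiableM (dv b) (ddd a b)).
have dsum a : differentiable (fun z => \sum_b vel_of z 0 b * ddtr c d b a k (pos_of z)) y.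
  by apply: differentiable_sum_fun => b; exact: dvd.
have ex (j : 'I_n) : ('e_(iv i) : 'rV[R]_(1 + (n + n))) 0 (ix j) = 0.
  by rewrite mxE eqxx /= eq_rshift eq_lrshift.
have ev (j : 'I_n) : ('e_(iv i) : 'rV[R]_(1 + (n + n))) 0 (iv j) = (j == i)%:R.
  by rewrite mxE eqxx /= eq_rshift eq_rshift.
have et : ('e_(iv i) : 'rV[R]_(1 + (n + n))) 0 (it n) = 0.
  by rewrite mxE eqxx andTb /it /iv eq_lrshift.
have delta (a : 'I_n -> R) : \sum_j (j == i)%:R * a j = a i.
  by rewrite (bigD1 i) //= eqxx mul1r big1 ?addr0 // => j /negbTE ->; rewrite mul0r.
have two (a : R) : 2 * a = a + a by rewrite mulr_natl mulr2n.
have dpos (f : 'rV[R]_n -> R) : differentiable f (pos_of y) ->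
    'D_('e_(iv i)) (fun z => f (pos_of z)) y = 0.
  by move=> df; rewrite derive_pos //; apply: big1 => j _; rewrite ex mul0r.
have DQ : 'D_('e_(iv i)) Q y = \sum_j dF sigma c j i J * dtr c d j k (pos_of y) +
    2 * \sum_j xdot c j J * ddtr c d i j k (pos_of y).
  rewrite derive_sum_diff; last first.
    move=> a; exact: (differentiableD (differentiableM (dF' a) (dd a))
                                       (differentiableM (dv a) (dsum a))).
  have Da a : 'D_('e_(iv i)) (fun z => Fexpr c a z * dtr c d a k (pos_of z) +
     vel_of z 0 a * \sum_b vel_of z 0 b * ddtr c d b a k (pos_of z)) y =
     dF sigma c a i J * dtr c d a k (pos_of y) +
     ((a == i)%:R * \sum_b xdot c b J * ddtr c d b a k (pos_of y) +
      xdot c a J * ddtr c d i a k (pos_of y)).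
    rewrite deriveD_diff; [|exact: (differentiableM (dF' a) (dd a))
                           |exact: (differentiableM (dv a) (dsum a))].
    rewrite !deriveM_diff // dpos; last exact: smooth_fun_diff (dtr_smooth hM hc1 hd1 a k) Vy.
    rewrite mulr0 addr0 derive_vel ev -dF_E // /xdot.
    have -> : vel_of y = jet_deriv c 1 J by exact: chart1_vel.
    congr (_ + (_ + _ * _)); rewrite derive_sumM //.
    rewrite -[RHS](delta (fun b => ddtr c d b a k (pos_of y))).
    apply: eq_bigr => b _; rewrite derive_vel ev dpos ?mulr0 ?addr0 //.
    exact: smooth_fun_diff (ddtr_smooth hM hc1 hd1 b a k) Vy.
  under eq_bigr do rewrite Da; rewrite !big_split /= delta; congr (_ + _).
  have S2 : \sum_b xdot c b J * ddtr c d b i k (pos_of y) =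
      \sum_b xdot c b J * ddtr c d i b k (pos_of y).
    apply: eq_bigr => b _; apply: (congr1 ( *%R (xdot c b J))).
    exact: (ddtr_sym hM hc1 hd1 b i k Vy).
  exact: (etrans (congr2 +%R S2 (erefl _)) (esym (two _))).
rewrite -yE -DQ -(near_eq_derive _ (near_open oU Uy E)); apply/esym.
rewrite (@derive_comp_rV _ _ _ (chart1_change c d) (Fexpr d k)); last first.
- have -> : chart1_change c d y = chart1 d J by rewrite -chart1_changeE.
  exact: smooth_fun_diff (Fexpr_smooth k hd1) (domain1_chart hd).
- exact: smooth_on_diff (chart1_change_smooth hM hc1 hd1) Uy.
rewrite sum_coord derive_change_t // et mul0r add0r big1 ?add0r; last first.
  move=> j _.
  have -> : 'D_('e_(iv i)) (fun z => chart1_change c d z 0 (ix j)) y = 0.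
    rewrite (derive_change_x hM hc1 hd1 _ Uy); apply: big1 => l _.
    by rewrite ex mul0r.
  exact: mul0r.
apply: eq_bigr => l _.
have -> : 'D_('e_(iv i)) (fun z => chart1_change c d z 0 (iv l)) y =
    dtr c d i l (pos_of y).
  rewrite (derive_change_v hM hc1 hd1 _ Uy).
  rewrite -[RHS](delta (fun a => dtr c d a l (pos_of y))).
  apply: eq_bigr => a _; rewrite ev big1 ?mulr0 ?addr0 // => b _.
  by rewrite ex mul0r.
by rewrite -(chart1_changeE hM hc1 hd1 cJ dJ) -(dF_E _ _ hd).
Qed.

(** ** Invariance under changes of coordinates *)

Section Components.
Variables (c : chart R M n) (J : M1 M).
Hypothesis hc : chart_at (jet_point J) c.

Lemma Xsigma_comp m : Xsigma sigma c J (chart1 c) 0 m =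
  blocks 1 (xdot c ^~ J) (F sigma c ^~ J) m.
Proof.
rewrite /Xsigma !tcompD mxE [X in X + _]mxE d_tE // sum_d_xE // sum_d_xdotE //.
by elim/coord_ind: m => [|i|i]; rewrite !blocksE ?addr0 ?add0r.
Qed.

Lemma sum_Xsigma_comp (a : 'I_n -> R) m :
  (\sum_i a i *: Xsigma_ sigma c i J) (chart1 c) 0 m =
  blocks 0 a (fun k => 2^-1 * \sum_i a i * dF sigma c k i J) m.
Proof.
have -> : \sum_i a i *: Xsigma_ sigma c i J = \sum_i a i *: d_x c J i +
    \sum_k (2^-1 * \sum_i a i * dF sigma c k i J) *: d_xdot c J k.
  rewrite /Xsigma_; under eq_bigr do rewrite scalerDr.
  rewrite big_split /=; congr (_ + _).
  under eq_bigr do rewrite scaler_sumr scaler_sumr.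
  rewrite exchange_big; apply: eq_bigr => k _.
  rewrite mulr_sumr scaler_suml; apply: eq_bigr => i _.
  by rewrite !scalerA mulrCA mulrA.
rewrite tcompD mxE sum_d_xE // sum_d_xdotE //.
by elim/coord_ind: m => [|i|i]; rewrite !blocksE ?addr0 ?add0r.
Qed.

Lemma epsilon_comp (w : tangent (jet_point J)) m :
  epsilon c w (chart1 c) 0 m = blocks 0 (fun=> 0) (w c 0) m.
Proof. by rewrite /epsilon sum_d_xdotE. Qed.

(** The inclusion of TM has no dt component, so only the omega^i (x) X_i part of
    H^sigma remains. *)
Lemma Hsigma_incl (w : tangent (jet_point J)) :
  Hsigma sigma c (incl_TM c w) = \sum_i w c 0 i *: Xsigma_ sigma c i J.
Proof.
have hM0 := smooth_atlas_M0 hM.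
have h0 : chart_at (p10 J) (chart0 c).
  case: hc => hc1 cJ; split; last by split.
  by exists (Chart setT (fun t => t%:M)), c.
have E m : (incl_TM c w) (chart0 c) 0 m = \sum_i w c 0 i * (m == rshift 1 i)%:R.
  rewrite tcomp_sum summxE; apply: eq_bigr => i _.
  by rewrite tcompZ mxE (d_E hM0 _ h0) mxE eqxx.
rewrite /Hsigma !E big1; last by move=> i _; rewrite eq_lrshift mulr0.
rewrite scale0r add0r; apply: eq_bigr => i _; congr (_ *: _).
rewrite mulr0 subr0 E (bigD1 i) //= eqxx mulr1 big1 ?addr0 // => j ji.
by rewrite eq_rshift eq_sym (negbTE ji) mulr0.
Qed.

End Components.

Section Invariance.
Variables (c d : chart R M n) (J : M1 M).
Hypotheses (hc : chart_at (jet_point J) c) (hd : chart_at (jet_point J) d).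

Lemma Xsigma_indep : Xsigma sigma c J = Xsigma sigma d J.
Proof.
have Xx i : Xsigma sigma c J (chart1 c) 0 (ix i) = xdot c i J.
  by rewrite (Xsigma_comp hc) blocksE.
have Xv i : Xsigma sigma c J (chart1 c) 0 (iv i) = F sigma c i J.
  by rewrite (Xsigma_comp hc) blocksE.
apply: (tcomp_inj (chart1_at hd)); apply/rowP => m; apply: etrans (esym (Xsigma_comp hd m)).
elim/coord_ind: m => [|k|k]; rewrite blocksE.
- apply: etrans (tcomp_change_t hM _ hc hd) _.
  by apply: etrans (Xsigma_comp hc _) _; rewrite blocksE.
- apply: etrans (tcomp_change_x hM _ hc hd k) _.
  have [hc1 cJ] := hc; have [hd1 dJ] := hd.
  apply: etrans (esym (jet_deriv1_change hM k hc1 hd1 cJ dJ)).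
  by apply: eq_bigr => i _; exact: (congr2 *%R (Xx i) (erefl _)).
- apply: etrans (tcomp_change_v hM _ hc hd k) _.
  apply: etrans (esym (F_change k hc hd)).
  apply: eq_bigr => i _; apply: (congr2 +%R (congr2 *%R (Xv i) (erefl _))).
  apply: (congr2 *%R (erefl _)); apply: eq_bigr => j _.
  exact: (congr2 *%R (Xx j) (erefl _)).
Qed.

Lemma epsilon_indep (w : tangent (jet_point J)) : epsilon c w = epsilon d w.
Proof.
have ex i : epsilon c w (chart1 c) 0 (ix i) = 0 by rewrite (epsilon_comp hc) blocksE.
have ev i : epsilon c w (chart1 c) 0 (iv i) = w c 0 i by rewrite (epsilon_comp hc) blocksE.
apply: (tcomp_inj (chart1_at hd)); apply/rowP => m; apply: etrans (esym (epsilon_comp hd w m)).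
elim/coord_ind: m => [|k|k]; rewrite blocksE.
- apply: etrans (tcomp_change_t hM _ hc hd) _.
  by apply: etrans (epsilon_comp hc w _) _; rewrite blocksE.
- apply: etrans (tcomp_change_x hM _ hc hd k) _; apply: big1 => i _.
  exact: (etrans (congr2 *%R (ex i) (erefl _)) (mul0r _)).
- apply: etrans (tcomp_change_v hM _ hc hd k) _.
  apply: etrans (esym (tcomp_change_M hM w k hc hd)).
  apply: eq_bigr => i _; rewrite -[RHS]addr0.
  apply: (congr2 +%R (congr2 *%R (ev i) (erefl _))).
  apply: etrans (mulr0 (jet_deriv c 1 J 0 i)); apply: (congr2 *%R (erefl _)).
  by apply: big1 => j _; exact: (etrans (congr2 *%R (ex j) (erefl _)) (mul0r _)).
Qed.

(** The change of components adds D^2(w, xdot), and so does half of [dF_change] when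
    contracted with w. *)
Lemma Hsigma_indep (w : tangent (jet_point J)) :
  Hsigma sigma c (incl_TM c w) = Hsigma sigma d (incl_TM d w).
Proof.
apply: (etrans (Hsigma_incl hc w)); apply: etrans (esym (Hsigma_incl hd w)).
set x := c (jet_point J).
pose Z c := \sum_i w c 0 i *: Xsigma_ sigma c i J.
change (Z c = Z d).
have Zc m : Z c (chart1 c) 0 m = blocks 0 (w c 0)
    (fun k => 2^-1 * \sum_i w c 0 i * dF sigma c k i J) m.
  exact: (sum_Xsigma_comp hc).
have Zd m : Z d (chart1 d) 0 m = blocks 0 (w d 0)
    (fun k => 2^-1 * \sum_i w d 0 i * dF sigma d k i J) m.
  exact: (sum_Xsigma_comp hd).
have Zx i : Z c (chart1 c) 0 (ix i) = w c 0 i by rewrite Zc blocksE.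
have Zv i : Z c (chart1 c) 0 (iv i) = 2^-1 * \sum_l w c 0 l * dF sigma c i l J.
  by rewrite Zc blocksE.
have wE k := tcomp_change_M hM w k hc hd.
have dFc j k := dF_change j k hc hd.
clearbody Z.
apply: (tcomp_inj (chart1_at hd)); apply/rowP => m; apply: etrans (esym (Zd m)).
clear Zd.
elim/coord_ind: m => [|k|k]; rewrite blocksE.
- apply: etrans (tcomp_change_t hM _ hc hd) _.
  by rewrite Zc blocksE.
- apply: etrans (tcomp_change_x hM _ hc hd k) _; apply: etrans (esym (wE k)).
  by apply: eq_bigr => i _; exact: (congr2 *%R (Zx i) (erefl _)).
apply: etrans (tcomp_change_v hM _ hc hd k) _.
pose wc i := w c 0 i; pose v i := jet_deriv c 1 J 0 i.
pose A i l := dF sigma c i l J; pose B l := dF sigma d k l J.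
pose D i l := dtr c d i l x; pose DD j i := ddtr c d j i k x.
transitivity (\sum_i ((2^-1 * \sum_l wc l * A i l) * D i k +
                      v i * \sum_j wc j * DD j i)).
  apply: eq_bigr => i _; apply: (congr2 +%R (congr2 *%R (Zv i) (erefl _))).
  apply: (congr2 *%R (erefl _)); apply: eq_bigr => j _.
  exact: (congr2 *%R (Zx j) (erefl _)).
transitivity (2^-1 * \sum_l (\sum_i wc i * D i l) * B l); last first.
  apply: (congr2 *%R (erefl _)); apply: eq_bigr => l _.
  exact: (congr2 *%R (esym (wE l)) (erefl _)).
have {dFc} E j : \sum_l D j l * B l =
    \sum_l A l j * D l k + 2 * \sum_l v l * DD j l.
  exact: dFc.
(* the rest is an identity between finite sums, for arbitrary coefficients *)
move: E; move: A B D DD v wc => A B D DD v wc {wE Zx Zv Zc Z} E.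
rewrite big_split /=; under [in RHS]eq_bigr do rewrite mulr_suml.
rewrite exchange_big /=.
have -> : \sum_j \sum_i wc j * D j i * B i =
    \sum_j wc j * (\sum_l A l j * D l k + 2 * \sum_l v l * DD j l).
  apply: eq_bigr => j _; rewrite -E mulr_sumr.
  by apply: eq_bigr => i _; rewrite mulrA.
under [in RHS]eq_bigr do rewrite mulrDr.
rewrite big_split /= mulrDr; congr (_ + _).
- under eq_bigr do rewrite -mulrA mulr_suml.
  rewrite -mulr_sumr exchange_big /=; congr (_ * _); apply: eq_bigr => j _.
  by rewrite mulr_sumr; apply: eq_bigr => l _; rewrite mulrA.
- under eq_bigr do rewrite mulr_sumr.
  rewrite exchange_big mulr_sumr; apply: eq_bigr => j _.
  rewrite [RHS]mulrCA mulKf ?pnatr_eq0 // mulr_sumr; apply: eq_bigr => l _.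
  by rewrite mulrCA.
Qed.

End Invariance.

End Sode.

(** * The local frame and its dual coframe *)

Local Notation iota := Defs.iota.

Section BlockSums.
Variables (R : realType) (n : nat).

Lemma sum_iota_t (V : lmodType R) (e : 'I_(1 + (n + n)) -> V) (L : 'M[R]_n) :
  \sum_l (iota L) l (it n) *: e l = e (it n).
Proof.
rewrite sum_coord block_mxEul mxE eqxx scale1r big1 ?addr0 => [|i _].
  rewrite big1 ?addr0 // => i _.
  by rewrite block_mxEdl mxE scale0r.
by rewrite block_mxEdl mxE scale0r.
Qed.

Lemma sum_iota_x (V : lmodType R) (e : 'I_(1 + (n + n)) -> V) (L : 'M[R]_n) j :
  \sum_l (iota L) l (ix j) *: e l = \sum_i L i j *: e (ix i).
Proof.
rewrite sum_coord block_mxEur mxE scale0r add0r [X in _ + X]big1 ?addr0 => [|i _].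
  by apply: eq_bigr => i _; rewrite block_mxEdr block_mxEul.
by rewrite block_mxEdr block_mxEdl mxE scale0r.
Qed.

Lemma sum_iota_v (V : lmodType R) (e : 'I_(1 + (n + n)) -> V) (L : 'M[R]_n) j :
  \sum_l (iota L) l (iv j) *: e l = \sum_i L i j *: e (iv i).
Proof.
rewrite sum_coord block_mxEur mxE scale0r add0r [X in X + _]big1 ?add0r => [|i _].
  by apply: eq_bigr => i _; rewrite block_mxEdr block_mxEdr.
by rewrite block_mxEdr block_mxEur mxE scale0r.
Qed.

Lemma iota_unitE (L : 'M[R]_n) : (iota L \in unitmx) = (L \in unitmx).
Proof.
by rewrite /iota !unitmxE !det_ublock det1 mul1r unitrM andbb.
Qed.

Lemma iota1 : iota (1%:M : 'M[R]_n) = 1%:M.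
Proof. by rewrite /iota -!scalar_mx_block. Qed.

End BlockSums.

Section LocalFrame.
Variables (R : realType) (n : nat) (M : premanifold R n).
Hypothesis hM : smooth_atlas M.
Variable sigma : M1 M -> M2 M.
Hypothesis hsigma : is_sode sigma.
Variables (c : chart R M n) (J : M1 M).
Hypothesis hc : chart_at (jet_point J) c.

Let lf := local_frame sigma c J.

Lemma sum_local_frame (a : 'I_(1 + (n + n)) -> R) :
  \sum_m a m *: lf m = a (it n) *: Xsigma sigma c J +
    \sum_i a (ix i) *: Xsigma_ sigma c i J + \sum_i a (iv i) *: d_xdot c J i.
Proof.
rewrite sum_coord /lf /local_frame blocks_t; congr (_ + _ + _).
  by apply: eq_bigr => i _; rewrite blocks_x.
by apply: eq_bigr => i _; rewrite blocks_v.
Qed.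

Lemma local_frame_comp (a : 'I_(1 + (n + n)) -> R) m :
  (\sum_m a m *: lf m) (chart1 c) 0 m =
  blocks (a (it n)) (fun k => a (it n) * xdot c k J + a (ix k))
    (fun k => a (it n) * F sigma c k J +
       2^-1 * (\sum_i a (ix i) * dF sigma c k i J) + a (iv k)) m.
Proof.
rewrite sum_local_frame !tcompD mxE [X in X + _]mxE tcompZ [X in X + _ + _]mxE.
rewrite (Xsigma_comp hM sigma hc) (sum_Xsigma_comp hM sigma hc) (sum_d_xdotE hM hc).
by elim/coord_ind: m => [|i|i]; rewrite !blocksE ?mulr1 ?addr0.
Qed.

Let linear_comp a (u v : tangent J) m :
  (a *: u + v) (chart1 c) 0 m = a * u (chart1 c) 0 m + v (chart1 c) 0 m.
Proof. by rewrite tcompD tcompZ !mxE. Qed.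

Let omega_linear (a x1 x2 d1 d2 v : R) :
  (a * x1 + x2) - v * (a * d1 + d2) = a * (x1 - v * d1) + (x2 - v * d2).
Proof. by ring. Qed.

Let varpi_linear (a x1 x2 d1 d2 f s1 s2 : R) :
  (a * x1 + x2) - f * (a * d1 + d2) - 2^-1 * (a * s1 + s2) =
  a * (x1 - f * d1 - 2^-1 * s1) + (x2 - f * d2 - 2^-1 * s2).
Proof. by ring. Qed.

Lemma local_coframe_scalar m : scalar (@local_coframe R n M sigma c J m).
Proof.
have lt a (u v : tangent J) : dt c (a *: u + v) = a * dt c u + dt c v.
  exact: linear_comp.
have lx i a (u v : tangent J) : dx c i (a *: u + v) = a * dx c i u + dx c i v.
  exact: linear_comp.
have lv i a (u v : tangent J) :
    dxdot c i (a *: u + v) = a * dxdot c i u + dxdot c i v.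
  exact: linear_comp.
elim/coord_ind: m => [|i|i]; rewrite /local_coframe blocksE => a u v.
- exact: lt.
- by rewrite /omega lt lx; exact: omega_linear.
- rewrite /varpi lt lv.
  have -> : \sum_j dF sigma c i j J * (dx c j (a *: u + v) -
       xdot c j J * (a * dt c u + dt c v)) =
     a * (\sum_j dF sigma c i j J * (dx c j u - xdot c j J * dt c u)) +
     \sum_j dF sigma c i j J * (dx c j v - xdot c j J * dt c v).
    rewrite mulr_sumr -big_split; apply: eq_bigr => j _.
    by rewrite lx omega_linear mulrDr mulrCA.
  exact: varpi_linear.
Qed.

Lemma local_coframe_sum (a : 'I_(1 + (n + n)) -> R) m :
  local_coframe sigma c m (\sum_m a m *: lf m) = a m.
Proof.
set v := \sum_m _.
have vt : dt c v = a (it n) by rewrite /dt local_frame_comp blocksE.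
have vx i : dx c i v - xdot c i J * dt c v = a (ix i).
  by rewrite vt /dx local_frame_comp blocksE mulrC addrC addKr.
elim/coord_ind: m => [|i|i]; rewrite /local_coframe blocksE //.
- exact: vx.
- rewrite /varpi vt /dxdot local_frame_comp blocksE.
  have -> : \sum_j dF sigma c i j J * (dx c j v - xdot c j J * a (it n)) =
     \sum_j a (ix j) * dF sigma c i j J.
    by apply: eq_bigr => j _; rewrite -vt vx mulrC.
  have alg (f t s x : R) : t * f + s + x - f * t - s = x by ring.
  exact: alg.
Qed.

Lemma local_frame_coframe (v : tangent J) :
  v = \sum_m local_coframe sigma c m v *: lf m.
Proof.
apply: (tcomp_inj (chart1_at hc)); apply/rowP => m; apply: etrans (esym (local_frame_comp _ _)).
elim/coord_ind: m => [|i|i]; rewrite !blocksE.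
- by rewrite /local_coframe blocksE.
- rewrite /local_coframe !blocksE /omega.
  have alg (t x f : R) : x = t * f + (x - f * t) by ring.
  exact: alg.
- rewrite /local_coframe !blocksE /varpi.
  have -> : \sum_k blocks (@dt R n M c J) (fun i0 => @omega R n M c i0 J)
      (fun i0 => @varpi R n M sigma c i0 J) (ix k) v * dF sigma c i k J =
     \sum_j dF sigma c i j J * (dx c j v - xdot c j J * dt c v).
    by apply: eq_bigr => j _; rewrite blocksE mulrC.
  have alg (f t s x : R) : x = t * f + s + (x - f * t - s) by ring.
  exact: alg.
Qed.

Lemma local_frame_basis : is_basis lf.
Proof.
split=> [v|a a0 m].
  by exists (fun m => local_coframe sigma c m v); exact: local_frame_coframe.
rewrite -(local_coframe_sum a) a0.
have := local_coframe_scalar m (-1) 0 0.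
by rewrite scaler0 addr0 mulN1r addNr.
Qed.

Lemma local_coframe_dual : dual_coframe (@local_coframe R n M sigma c J) lf.
Proof.
split=> [m|m l]; first exact: local_coframe_scalar.
have {1}-> : lf l = \sum_k (k == l)%:R *: lf k.
  rewrite (bigD1 l) //= eqxx scale1r big1 ?addr0 // => k /negbTE ->.
  by rewrite scale0r.
by rewrite (local_coframe_sum (fun k => (k == l)%:R)).
Qed.

End LocalFrame.

(** * Adapted frames *)

Section Adapted.
Variables (R : realType) (n : nat) (M : premanifold R n).
Hypothesis hM : smooth_atlas M.
Variable sigma : M1 M -> M2 M.
Hypothesis hsigma : is_sode sigma.
Implicit Types (c d : chart R M n) (J : M1 M) (u v : frame (M1 M)).

Definition vmx c u : 'M[R]_n := \matrix_(i, j) (u (iv j)) (chart1 c) 0 (iv i).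

(** Frames are multiplied on the right, so the columns of iota L give the vectors of u.
    The frame u is adapted exactly when this holds for some L. *)
Definition frame_by c u (L : 'M[R]_n) :=
  forall m, u m = \sum_l (iota L) l m *: local_frame sigma c (fpt u) l.

(** The matrix L is read off the vertical vectors; it also governs the vectors X_i,
    which are the images of the vertical ones by H^sigma o epsilon^-1. *)
Lemma adapted_expand c u : adapted sigma u -> chart_at (jet_point (fpt u)) c ->
  frame_by c u (vmx c u).
Proof.
move=> /(_ c) + hc => /(_ hc)[e1 _ e3] m.
have e3' j : u (iv j) = \sum_i (vmx c u) i j *: d_xdot c (fpt u) i /\
    u (ix j) = \sum_i (vmx c u) i j *: Xsigma_ sigma c i (fpt u).
  have [w ev ex] := e3 j.
  have wE i : vmx c u i j = w c 0 i.
    by rewrite mxE ev (epsilon_comp hM hc) blocksE.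
  split.
    by rewrite ev; apply: eq_bigr => i _; rewrite wE.
  apply: etrans ex _; apply: etrans (Hsigma_incl hM sigma hc w) _.
  by apply: eq_bigr => i _; rewrite wE.
elim/coord_ind: m => [|j|j].
- by rewrite sum_iota_t e1 /local_frame blocksE.
- rewrite sum_iota_x (e3' j).2; apply: eq_bigr => i _.
  by rewrite /local_frame blocksE.
- rewrite sum_iota_v (e3' j).1; apply: eq_bigr => i _.
  by rewrite /local_frame blocksE.
Qed.

Lemma frame_by_v c u L j : frame_by c u L ->
  u (iv j) = \sum_i L i j *: d_xdot c (fpt u) i.
Proof.
move=> ->; rewrite sum_iota_v; apply: eq_bigr => i _.
by rewrite /local_frame blocksE.
Qed.

Lemma frame_by_vmx c u L : frame_by c u L -> chart_at (jet_point (fpt u)) c -> vmx c u = L.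
Proof.
move=> uL hc; apply/matrixP => i j; rewrite mxE (frame_by_v j uL).
by rewrite (sum_d_xdotE hM hc) blocksE.
Qed.

(** The condition to be checked in all charts d reduces to the chart c, because
    X^sigma, epsilon and H^sigma do not depend on the chart. *)
Lemma frame_by_adapted c u L : frame_by c u L -> chart_at (jet_point (fpt u)) c ->
  adapted sigma u.
Proof.
move=> uL hc d hd; split.
- by rewrite uL sum_iota_t /local_frame blocksE; exact: Xsigma_indep.
- move=> j; apply: (verticalI hM hc); rewrite (frame_by_v j uL).
    by rewrite (sum_d_xdotE hM hc) blocksE.
  by move=> i; rewrite (sum_d_xdotE hM hc) blocksE.
- move=> j; pose w := tvec (jet_point (fpt u)) c (\row_i L i j).
  have wE i : w c 0 i = L i j by rewrite /w tvecE // mxE.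
  exists w.
    rewrite (frame_by_v j uL) -(epsilon_indep hM hc hd w).
    by apply: eq_bigr => i _; rewrite wE.
  apply: etrans (Hsigma_indep hM hsigma hc hd w).
  apply: etrans (esym (Hsigma_incl hM sigma hc w)).
  rewrite uL sum_iota_x; apply: eq_bigr => i _.
  by rewrite wE /local_frame blocksE.
Qed.

Definition lfmx c J : 'M[R]_(1 + (n + n)) :=
  comp_mx (chart1 c : chart R (M1 M) _) (local_frame sigma c J).

Lemma frame_by_mx c u L : frame_by c u L ->
  frame_mx (chart1 c : chart R (M1 M) _) u = (iota L)^T *m lfmx c (fpt u).
Proof.
move=> uL; apply/row_matrixP => m; rewrite row_mul.
have -> : row m (frame_mx (chart1 c : chart R (M1 M) _) u) = u m (chart1 c) by apply/rowP => l; rewrite !mxE.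
rewrite uL comp_mx_sum; congr (_ *m _).
by apply/rowP => l; rewrite !mxE.
Qed.

Lemma frame_by_unit c u L : frame_by c u L -> chart_at (jet_point (fpt u)) c ->
  L \in unitmx.
Proof.
move=> uL hc; have := frame_mx_unit (smooth_atlas_M1 hM) (chart1_at hc).
by rewrite (frame_by_mx uL) unitmx_mul unitmx_tr iota_unitE => /andP[].
Qed.

Lemma frame_by_exists c J L : chart_at (jet_point J) c -> L \in unitmx ->
  exists u, fpt u = J /\ frame_by c u L.
Proof.
move=> hc LU; pose e m := \sum_l (iota L) l m *: local_frame sigma c J l.
have be : is_basis e.
  by apply: basis_mul; [rewrite iota_unitE | exact: local_frame_basis].
by exists (Frame be).
Qed.

Lemma frame_by_eq c u v L : frame_by c u L -> frame_by c v L -> fpt u = fpt v ->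
  chart_at (jet_point (fpt u)) c -> u = v.
Proof.
move=> uL vL euv hc; apply: (frame_eq euv (chart1_at hc)).
by rewrite (frame_by_mx uL) (frame_by_mx vL) euv.
Qed.

Lemma frame_act_pt u g : fpt (frame_act u g) = fpt u.
Proof. by rewrite /frame_act; case: {-}_ / idP. Qed.

Lemma frame_by_act c u L K : frame_by c u L -> K \in unitmx ->
  frame_by c (frame_act u (iota K)) (L *m K).
Proof.
rewrite -iota_unitE /frame_act => uL; case: {-}_ / idP => // gU _ m /=.
rewrite iotaM.
transitivity (\sum_i \sum_l ((iota L) l i * (iota K) i m) *: local_frame sigma c (fpt u) l).
  apply: eq_bigr => i _; rewrite uL scaler_sumr; apply: eq_bigr => l _.
  by rewrite scalerA mulrC.
rewrite exchange_big; apply: eq_bigr => l _.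
by rewrite mxE scaler_suml.
Qed.

Lemma vmx_change c d u : adapted sigma u -> chart_at (jet_point (fpt u)) c ->
  chart_at (jet_point (fpt u)) d ->
  vmx d u = \matrix_(k, j) \sum_i vmx c u i j * dtr c d i k (c (jet_point (fpt u))).
Proof.
move=> hu hc hd; apply/matrixP => k j.
apply: etrans (mxE _ _ _ _) _; apply: etrans (esym (mxE _ _ _ _)).
apply: etrans (tcomp_change_v hM _ hc hd k) _; apply: eq_bigr => i _.
have -> : vmx c u i j = u (iv j) (chart1 c) 0 (iv i) by rewrite mxE.
rewrite -[RHS]addr0; apply: (congr2 +%R (erefl _)).
apply: etrans (mulr0 (jet_deriv c 1 (fpt u) 0 i)); apply: (congr2 *%R (erefl _)).
apply: big1 => l _.
have E : u (iv j) (chart1 c) 0 (ix l) = 0.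
  by rewrite (frame_by_v j (adapted_expand hu hc)) (sum_d_xdotE hM hc) blocksE.
exact: (etrans (congr2 *%R E (erefl _)) (mul0r _)).
Qed.

End Adapted.

(** * The group G as a manifold *)

Section GroupManifold.
Variables (R : realType) (n : nat).

Definition Gmanifold : premanifold R (n * n) := Premanifold (@G R n) [set @G_chart R n].

Definition gmx (g : @G R n) : 'M[R]_n := ulsubmx (drsubmx (val g)).

Lemma gmxP (g : @G R n) : val g = iota (gmx g) /\ gmx g \in unitmx.
Proof.
rewrite /gmx; have [L LU <-] := set_valP g.
by rewrite block_mxKdr block_mxKul.
Qed.

Lemma gmx_inj : injective gmx.
Proof. by move=> g h e; apply: val_inj; rewrite (gmxP g).1 (gmxP h).1 e. Qed.

Lemma gmx_exists (L : 'M[R]_n) : L \in unitmx -> exists g : @G R n, gmx g = L.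
Proof.
move=> LU; have hL : @G R n (iota L) by exists L.
by exists (exist (fun g => g \in @G R n) _ (mem_set hL)); rewrite /gmx /= block_mxKdr block_mxKul.
Qed.

Lemma G_chartE (g : @G R n) : @G_chart R n g = mxvec (gmx g).
Proof. by []. Qed.

Lemma smooth_atlas_G : smooth_atlas Gmanifold.
Proof.
have im : @G_chart R n @` setT = [set y | vec_mx y \in unitmx].
  apply/seteqP; split=> [_ [g _ <-]|y yU].
    by rewrite /mkset G_chartE mxvecK; case: (gmxP g).
  by have [g gy] := gmx_exists yU; exists g => //; rewrite G_chartE gy vec_mxK.
have oV := @open_unit_mxvec R n.
have cc : coordinate_chart (@G_chart R n).
  split; first by rewrite im.
  by move=> g h _ _; rewrite !G_chartE => /(can_inj mxvecK)/gmx_inj.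
split.
- by move=> _ ->.
- by move=> g; exists (@G_chart R n).
- move=> _ _ -> ->; apply: (compatibleI cc oV (h := id)) => //.
    by rewrite setTI im.
  exact: smooth_on_id.
Qed.

End GroupManifold.

(** * The manifold of adapted frames *)

Section AdaptedFrames.
Variables (R : realType) (n : nat) (M : premanifold R n).
Hypothesis hM : smooth_atlas M.
Variable sigma : M1 M -> M2 M.
Hypothesis hsigma : is_sode sigma.
Implicit Types (c d : chart R M n) (J : M1 M).

Local Notation P := (adapted_frames sigma).

Definition pframe (u : P) : frame (M1 M) := val u.
Definition pbase (u : P) : M := jet_point (fpt (pframe u)).
Definition pmx c (u : P) : 'M[R]_n := vmx c (pframe u).

Lemma pframe_adapted (u : P) : adapted sigma (pframe u).
Proof. exact: (set_valP u). Qed.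
Arguments pframe_adapted u : clear implicits.

Lemma pframe_by c (u : P) : chart_at (pbase u) c -> frame_by sigma c (pframe u) (pmx c u).
Proof. by move=> hc; exact: (adapted_expand hM (pframe_adapted u) hc). Qed.

Lemma pmx_unit c (u : P) : chart_at (pbase u) c -> pmx c u \in unitmx.
Proof. by move=> hc; exact: (frame_by_unit hM (pframe_by hc) hc). Qed.

Lemma padapted_exists c J L : chart_at (jet_point J) c -> L \in unitmx ->
  exists u : P, fpt (pframe u) = J /\ pmx c u = L.
Proof.
move=> hc LU; have [u [uJ uL]] := frame_by_exists hM sigma hc LU.
have hc' : chart_at (jet_point (fpt u)) c by rewrite uJ.
have hu : P u by exact: (frame_by_adapted hM hsigma uL hc').
exists (exist (fun u => u \in P) u (mem_set hu)); split; first exact: uJ.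
exact: (frame_by_vmx hM uL hc').
Qed.

Lemma padapted_eq c (u v : P) : fpt (pframe u) = fpt (pframe v) ->
  chart_at (pbase u) c -> pmx c u = pmx c v -> u = v.
Proof.
move=> euv hc e; apply: val_inj.
have hc' : chart_at (pbase v) c by rewrite /pbase -euv.
have vL := pframe_by hc'; rewrite -e in vL.
exact: (frame_by_eq (pframe_by hc) vL euv hc).
Qed.

(** The coordinates (t, x, xdot, L) of the adapted frame with matrix L at the jet of
    coordinates (t, x, xdot). *)
Definition pchart c : chart R P (1 + (n + n) + n * n) :=
  Chart [set u | cdom c (pbase u)]
    (fun u => row_mx (chart1 c (fpt (pframe u))) (mxvec (pmx c u))).

Definition Pmanifold : premanifold R (1 + (n + n) + n * n) :=
  Premanifold P [set pchart c | c in matlas M].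

Lemma pchartE c (u : P) :
  pchart c u = row_mx (chart1 c (fpt (pframe u))) (mxvec (pmx c u)).
Proof. by []. Qed.

Lemma pchart_l c (u : P) : lsubmx (pchart c u) = chart1 c (fpt (pframe u)).
Proof. by rewrite pchartE row_mxKl. Qed.

Lemma pchart_r c (u : P) : vec_mx (rsubmx (pchart c u)) = pmx c u.
Proof. by rewrite pchartE row_mxKr mxvecK. Qed.

Lemma pchart_image c (S : set M) : matlas M c ->
  pchart c @` [set u | (S `&` cdom c) (pbase u)] =
  [set y | [set z | (c @` (S `&` cdom c)) (pos_of z)] (lsubmx y) /\
           [set z | vec_mx z \in unitmx] (rsubmx y)].
Proof.
move=> hc; apply/seteqP; split=> [_ [u Su <-]|y [y1 y2]].
  rewrite pchartE; split.
    by rewrite row_mxKl /mkset chart1_pos; exists (pbase u).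
  by rewrite row_mxKr /mkset mxvecK pmx_unit //; case: Su.
move: y1; rewrite -(chart1_image hM S hc) => -[J [SJ cJ] eJ].
have [u [uJ uL]] := padapted_exists (conj hc cJ) y2.
exists u; first by rewrite /mkset /pbase uJ.
by rewrite pchartE uJ uL eJ vec_mxK hsubmxK.
Qed.

Lemma open_pchart_image (V : set 'rV[R]_n) : open V ->
  open [set y : 'rV[R]_(1 + (n + n) + n * n) | [set z | V (pos_of z)] (lsubmx y) /\
           [set z | vec_mx z \in unitmx] (rsubmx y)].
Proof. by move=> oV; apply: open_row_mx; [exact: open_pos | exact: open_unit_mxvec]. Qed.

Lemma pchart_coordinate c : matlas M c -> coordinate_chart (pchart c).
Proof.
move=> hc; split.
  have := pchart_image setT hc; rewrite setTI => ->.
  by apply: open_pchart_image; have [/(_ c hc)[]] := hM.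
move=> u v /set_mem cu /set_mem cv; rewrite !pchartE => /eq_row_mx[e1 e2].
have e3 : fpt (pframe u) = fpt (pframe v).
  apply: (chart_inj (smooth_atlas_M1 hM) _ _ _ e1); by [exists c | exact: cu | exact: cv].
exact: (padapted_eq e3 (conj hc cu) (can_inj mxvecK e2)).
Qed.

(** L transforms by the Jacobian of the change of coordinates of M: the second
    derivatives that act on general frames of the jet space do not enter. *)
Lemma smooth_atlas_P : smooth_atlas Pmanifold.
Proof.
split.
- by move=> _ [c hc <-]; exact: pchart_coordinate.
- move=> u; have [c [hc cu]] := chart_exists hM (pbase u).
  by exists (pchart c) => //; exists c.
- move=> _ _ [c hc <-] [d hd <-].
  pose V := c @` (cdom d `&` cdom c).
  have oV : open V by apply: chart_image_open => //; exact: cdom_open.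
  have oW := open_pchart_image oV.
  have sid := smooth_on_id oW.
  have Uo : (overlap1 c d) = [set z | V (pos_of z)] by rewrite /overlap1 setIC.
  have oU := open_overlap1 hM hc hd.
  have sl := smooth_on_lsubmx oW sid.
  apply: (compatibleI (V := [set y | [set z | V (pos_of z)] (lsubmx y) /\
        [set z | vec_mx z \in unitmx] (rsubmx y)])
     (h := fun y => row_mx (chart1_change c d (lsubmx y))
        (mxvec (\matrix_(k, j) \sum_i vec_mx (rsubmx y) i j *
           dtr c d i k (pos_of (lsubmx y)))))) => //.
  + exact: pchart_coordinate.
  + by rewrite -pchart_image // setIC.
  + apply: smooth_on_row_mx => //.
      apply: (smooth_on_comp oW oU (chart1_change_smooth hM hc hd) sl) => y [y1 _].
      by rewrite Uo.
    apply: smooth_on_mxvec => // k j.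
    apply: (eq_smooth_fun oW (f := fun y => \sum_i vec_mx (rsubmx y) i j *
        dtr c d i k (pos_of (lsubmx y)))); first by move=> y _; rewrite mxE.
    apply: smooth_fun_sum => // i; apply: smooth_funM => //.
      by apply: smooth_fun_vec_mx => //; exact: smooth_on_rsubmx.
    apply: (smooth_fun_comp oW (dtr_pos_smooth hM hc hd i k)) => [l|y [y1 _]].
      exact: (smooth_on_coord _ oW).1 sl l.
    by rewrite Uo.
  + move=> u cu du; apply: etrans (pchartE d u) _; rewrite pchart_l pchart_r.
    apply: congr2; first exact: chart1_changeE.
    rewrite chart1_pos; apply: congr1.
    exact: (vmx_change hM (pframe_adapted u) (conj hc cu) (conj hd du)).
Qed.

Lemma pchart_at c (u : P) : chart_at (pbase u) c -> @chart_at R _ Pmanifold u (pchart c).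
Proof. by move=> [hc cu]; split => //; exists c. Qed.

Lemma pbase_smooth : smooth_map (pbase : Pmanifold -> M).
Proof.
apply: smooth_map_local => //; first exact: smooth_atlas_P.
move=> u; have [c hc] := chart_exists hM (pbase u).
exists (pchart c), c, setT, (fun y => pos_of (lsubmx y)); split => //.
- exact: pchart_at.
- by split => //; exact: openT.
- apply: smooth_on_pos; first exact: openT.
  by apply: smooth_on_lsubmx; [|apply: smooth_on_id]; exact: openT.
- by move=> v cv _; split => //; rewrite pchartE row_mxKl chart1_pos.
Qed.

Lemma smooth_manifold_P : hausdorff_space M -> @second_countable M ->
  smooth_manifold Pmanifold.
Proof.
move=> hH hS; split; first exact: smooth_atlas_P.
- apply: (@hausdorff_charts R _ Pmanifold M pbase smooth_atlas_P hH).
    by move=> u; have [+ _] := pbase_smooth; exact.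
  move=> u v e; have [c hc] := chart_exists hM (pbase u).
  by exists (pchart c); apply: pchart_at => //; rewrite -e.
- have [C [cC CA Ccov]] := countable_atlas hM hS.
  apply: (@second_countable_charts R _ Pmanifold (pchart @` C) smooth_atlas_P).
  + by apply: sub_countable (card_image_le _ _) _.
  + by move=> _ [c /CA hc <-]; exists c.
  + by move=> u; have [c Cc cu] := Ccov (pbase u); exists (pchart c) => //; exists c.
Qed.

(** ** The inclusion in the frame bundle is an immersion *)

(** [local_frame_comp] read in coordinates (t, x, xdot).  Keeping the coefficients e
    arbitrary treats the three kinds of vectors of the local frame at once. *)
Definition lfrow c (e : 'I_(1 + (n + n)) -> R) (y : 'rV[R]_(1 + (n + n))) b : R :=
  blocks (e (it n)) (fun k => e (it n) * vel_of y 0 k + e (ix k))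
    (fun k => e (it n) * Fexpr sigma c k y +
       2^-1 * (\sum_i e (ix i) * 'D_('e_(iv i)) (Fexpr sigma c k) y) + e (iv k)) b.

Definition lfexpr c (y : 'rV[R]_(1 + (n + n))) : 'M[R]_(1 + (n + n)) :=
  \matrix_(a, b) lfrow c (fun l => (l == a)%:R) y b.

Lemma lfexprE c J : chart_at (jet_point J) c -> lfmx sigma c J = lfexpr c (chart1 c J).
Proof.
move=> hc; apply/matrixP => a b; rewrite mxE [RHS]mxE.
have -> : local_frame sigma c J a = \sum_l (l == a)%:R *: local_frame sigma c J l.
  rewrite (bigD1 a) //= eqxx scale1r big1 ?addr0 // => k /negbTE ->.
  by rewrite scale0r.
apply: etrans (local_frame_comp hM sigma hc _ _) _.
rewrite /lfrow; elim/coord_ind: b => [|k|k]; rewrite !blocksE //.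
  by rewrite /xdot -(chart1_vel c J).
apply: (congr2 +%R _ (erefl _)); apply: congr2.
  by rewrite FexprE.
apply: (congr2 *%R (erefl _)); apply: eq_bigr => i _.
by rewrite (dF_E hM hsigma _ _ hc).
Qed.

Lemma lfexpr_smooth c a b : matlas M c ->
  smooth_fun (domain1 c) (fun y => lfexpr c y a b).
Proof.
move=> hc; have oD := open_domain1 hM hc.
have cst (r : R) := @smooth_fun_cst R _ (domain1 c) r.
have sF := Fexpr_smooth hM hsigma _ hc.
pose e l : R := (l == a)%:R; pose g b y := lfrow c e y b.
apply: (eq_smooth_fun oD (f := g b)); first by move=> y _; rewrite mxE.
elim/coord_ind: b => [|k|k].
- by apply: (eq_smooth_fun oD _ (cst (e (it n)))) => y _; rewrite /g /lfrow blocksE.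
- apply: (eq_smooth_fun oD (f := fun y => e (it n) * vel_of y 0 k + e (ix k))).
    by move=> y _; rewrite /g /lfrow blocksE.
  apply: smooth_funD => //; apply: smooth_funM => //.
  exact: (smooth_on_coord _ oD).1 (smooth_on_vel oD (smooth_on_id oD)) k.
- apply: (eq_smooth_fun oD (f := fun y => e (it n) * Fexpr sigma c k y +
         2^-1 * (\sum_i e (ix i) * 'D_('e_(iv i)) (Fexpr sigma c k) y) + e (iv k))).
    by move=> y _; rewrite /g /lfrow blocksE.
  apply: smooth_funD => //; apply: smooth_funD => //; apply: smooth_funM => //.
  apply: smooth_fun_sum => // i; apply: smooth_funM => //.
  exact: smooth_fun_derive.
Qed.

Lemma lfexpr_v c y i j : lfexpr c y (iv i) (iv j) = (i == j)%:R.
Proof.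
rewrite mxE /lfrow blocksE /it /ix /iv !eq_rshift eq_lrshift mul0r add0r big1.
  by rewrite mulr0 add0r eq_sym.
by move=> k _; rewrite eq_rshift eq_lrshift mul0r.
Qed.

Lemma iotaE (L : 'M[R]_n) a b : iota L a b =
  blocks (blocks 1 (fun=> 0) (fun=> 0) b)
    (fun i => blocks 0 (L i) (fun=> 0) b) (fun i => blocks 0 (fun=> 0) (L i) b) a.
Proof.
elim/coord_ind: a => [|i|i]; elim/coord_ind: b => [|j|j]; rewrite !blocksE.
- by rewrite block_mxEul mxE eqxx.
- by rewrite block_mxEur mxE.
- by rewrite block_mxEur mxE.
- by rewrite block_mxEdl mxE.
- by rewrite block_mxEdr block_mxEul.
- by rewrite block_mxEdr block_mxEur mxE.
- by rewrite block_mxEdl mxE.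
- by rewrite block_mxEdr block_mxEdl mxE.
- by rewrite block_mxEdr block_mxEdr.
Qed.

Lemma iota_smooth m (U : set 'rV[R]_m) (f : 'rV[R]_m -> 'M[R]_n) a b : open U ->
  (forall i j, smooth_fun U (fun y => f y i j)) -> smooth_fun U (fun y => iota (f y) a b).
Proof.
move=> oU sf; have cst (r : R) := @smooth_fun_cst R _ U r.
elim/coord_ind: a => [|i|i]; elim/coord_ind: b => [|j|j];
  first [ apply: (eq_smooth_fun oU _ (cst 1)); by move=> y _; rewrite iotaE !blocksE
        | apply: (eq_smooth_fun oU _ (cst 0)); by move=> y _; rewrite iotaE !blocksE
        | apply: (eq_smooth_fun oU _ (sf i j)); by move=> y _; rewrite iotaE !blocksE ].
Qed.

Definition inclusion (u : Pmanifold) : frameM (M1 M) := val (u : P).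

Definition incl_expr c (y : 'rV[R]_(1 + (n + n) + n * n)) :=
  row_mx (lsubmx y) (mxvec ((iota (vec_mx (rsubmx y)))^T *m lfexpr c (lsubmx y))).

Definition incl_domain c : set 'rV[R]_(1 + (n + n) + n * n) :=
  [set y | domain1 c (lsubmx y) /\ setT (rsubmx y)].

Lemma open_incl_domain c : matlas M c -> open (incl_domain c).
Proof. by move=> hc; apply: open_row_mx; [exact: open_domain1 | exact: openT]. Qed.

Lemma incl_expr_smooth c : matlas M c -> smooth_on (incl_domain c) (incl_expr c).
Proof.
move=> hc; have oW := open_incl_domain hc; have sid := smooth_on_id oW.
have sl := smooth_on_lsubmx oW sid; have sr := smooth_on_rsubmx oW sid.
apply: smooth_on_row_mx => //; apply: smooth_on_mxvec => // a b.
apply: (eq_smooth_fun oW (f := fun y => \sum_l iota (vec_mx (rsubmx y)) l a *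
     lfexpr c (lsubmx y) l b)).
  by move=> y _; rewrite [RHS]mxE; apply: eq_bigr => l _; rewrite [in RHS]mxE.
apply: smooth_fun_sum => // l; apply: smooth_funM => //.
  by apply: iota_smooth => // i j; exact: smooth_fun_vec_mx.
apply: (smooth_fun_comp oW (lfexpr_smooth l b hc)) => [k|y []//].
exact: (smooth_on_coord _ oW).1 sl k.
Qed.

Lemma inclE c (u : P) : chart_at (pbase u) c ->
  frame_chart (chart1 c : chart R (M1 M) _) (pframe u) = incl_expr c (pchart c u).
Proof.
move=> hc; rewrite pchartE /incl_expr row_mxKl row_mxKr mxvecK frame_chartE.
by rewrite (frame_by_mx (pframe_by hc)) (lfexprE hc).
Qed.

Lemma inclusion_local (u : P) : exists c, [/\ @chart_at R _ Pmanifold u (pchart c) /\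
    @chart_at R _ (frameM (M1 M)) (inclusion u) (frame_chart (chart1 c : chart R (M1 M) _)),
    open (incl_domain c) /\ incl_domain c (pchart c u),
    smooth_on (incl_domain c) (incl_expr c) &
    forall v : P, cdom (pchart c) v ->
      frame_chart (chart1 c : chart R (M1 M) _) (inclusion v) = incl_expr c (pchart c v)].
Proof.
have [c hc] := chart_exists hM (pbase u); exists c; split.
- split; first exact: pchart_at.
  by case: hc => hc cu; split => //; exists (chart1 c) => //; exists c.
- split; first by apply: open_incl_domain; case: hc.
  by rewrite pchartE; split => //; rewrite row_mxKl; exact: domain1_chart.
- by apply: incl_expr_smooth; case: hc.
- by move=> v cv; apply: inclE; split => //; case: hc.
Qed.

(** A left inverse in coordinates keeps (t, x, xdot) and reads L in the vertical block
    of the matrix of components. *)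
Lemma inclusion_immersion : immersion inclusion.
Proof.
have hF := smooth_atlas_frame (smooth_atlas_M1 hM).
apply: immersion_local; first exact: smooth_atlas_P.
  apply: smooth_map_local => //; first exact: smooth_atlas_P.
  move=> u; have [c [[hc hd] oW sh E]] := inclusion_local u.
  exists (pchart c), (frame_chart (chart1 c : chart R (M1 M) _)), (incl_domain c), (incl_expr c).
  by split => // v cv _; split; [exact: cv | exact: E].
move=> u; have [c [[hc hd] oW sh E]] := inclusion_local u.
pose l (y : 'rV[R]_(1 + (n + n) + (1 + (n + n)) * (1 + (n + n)))) :
    'rV[R]_(1 + (n + n) + n * n) :=
  row_mx (lsubmx y) (mxvec (\matrix_(i, j) vec_mx (rsubmx y) (iv j) (iv i))).
exists (pchart c), (frame_chart (chart1 c : chart R (M1 M) _)), (incl_domain c), (incl_expr c), l.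
split => //.
- apply: (smooth_on_diff (U := setT)) => //.
  have sid := @smooth_on_id R (1 + (n + n) + (1 + (n + n)) * (1 + (n + n))) _ openT.
  apply: smooth_on_row_mx; [exact: openT|by apply: smooth_on_lsubmx => //; exact: openT|].
  apply: smooth_on_mxvec => [|i j]; first exact: openT.
  apply: (eq_smooth_fun openT (f := fun y => vec_mx (rsubmx y) (iv j) (iv i))).
    by move=> y _; rewrite mxE.
  apply: smooth_fun_vec_mx; first exact: openT.
  by apply: smooth_on_rsubmx => //; exact: openT.
- split=> [v cv _|y _]; first exact: E.
  rewrite /l /incl_expr row_mxKl row_mxKr mxvecK.
  rewrite -[RHS]hsubmxK; congr row_mx; rewrite -[RHS]vec_mxK; congr mxvec.
  apply/matrixP => i j; rewrite mxE [LHS]mxE.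
  transitivity (\sum_k iota (vec_mx (rsubmx y)) k (iv j) *:
      (lfexpr c (lsubmx y) k (iv i) : R^o)).
    by apply: eq_bigr => k _; rewrite mxE.
  rewrite sum_iota_v (bigD1 i) //= lfexpr_v eqxx big1 ?addr0; first exact: mulr1.
  by move=> k /negbTE ki; rewrite lfexpr_v ki scaler0.
Qed.

End AdaptedFrames.

(** * The bundle of adapted frames *)

Section PrincipalBundle.
Variables (R : realType) (n : nat) (M : premanifold R n).
Hypothesis hM : smooth_atlas M.
Variable sigma : M1 M -> M2 M.
Hypothesis hsigma : is_sode sigma.
Implicit Types (c d : chart R M n) (J : M1 M).

Local Notation P := (adapted_frames sigma).
Local Notation PM := (Pmanifold sigma).
Local Notation GM := (Gmanifold R n).

Let hP : smooth_atlas PM := smooth_atlas_P hM hsigma.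
Let hG : smooth_atlas GM := @smooth_atlas_G R n.
Let hM1 : smooth_atlas (M1 M) := smooth_atlas_M1 hM.

Definition proj (u : PM) : M1 M := frame_pt (val (u : P)).

(** ** The action of G *)

Lemma frame_act_by c (u : P) (g : @G R n) : chart_at (pbase u) c ->
  frame_by sigma c (frame_act (pframe u) (val g)) (pmx c u *m gmx g).
Proof.
move=> hc; have [-> gU] := gmxP g.
exact: (frame_by_act (pframe_by hM hc) gU).
Qed.

Lemma frame_act_adapted (u : P) (g : @G R n) : P (frame_act (pframe u) (val g)).
Proof.
have [c hc] := chart_exists hM (pbase u).
apply: (frame_by_adapted hM hsigma (frame_act_by g hc)).
by rewrite frame_act_pt.
Qed.

Definition pact (z : prodM PM GM) : PM :=
  exist (fun u => u \in P) (frame_act (pframe (z.1 : P)) (val (z.2 : @G R n)))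
    (mem_set (@frame_act_adapted z.1 z.2)).

Lemma pact_pt (u : P) (g : @G R n) : fpt (pframe (pact (u, g) : P)) = fpt (pframe u).
Proof. exact: frame_act_pt. Qed.

Lemma pact_mx c (u : P) (g : @G R n) : chart_at (pbase u) c ->
  pmx c (pact (u, g) : P) = pmx c u *m gmx g.
Proof.
move=> hc; apply: (frame_by_vmx hM (frame_act_by g hc)).
by rewrite frame_act_pt.
Qed.

Lemma pact_smooth : smooth_map pact.
Proof.
apply: smooth_map_local => //; first exact: smooth_atlas_prod.
move=> [u g]; have [c hc] := chart_exists hM (pbase (u : P)).
have oT := @openT 'rV[R]_(1 + (n + n) + n * n + n * n).
have sid := smooth_on_id oT.
have sl := smooth_on_lsubmx oT sid; have sr := smooth_on_rsubmx oT sid.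
exists (chart_prod (pchart sigma c) (@G_chart R n)), (pchart sigma c), setT,
  (fun y => row_mx (lsubmx (lsubmx y))
     (mxvec (vec_mx (rsubmx (lsubmx y)) *m vec_mx (rsubmx y)))); split.
- split; last by split => //; case: hc.
  by exists (pchart sigma c), (@G_chart R n); split => //; exists c => //; case: hc.
- apply: pchart_at; rewrite /pbase pact_pt; exact: hc.
- by split.
- apply: smooth_on_row_mx => //; first exact: smooth_on_lsubmx.
  apply: smooth_on_mxvec => // i j.
  apply: (eq_smooth_fun oT (f := fun y => \sum_k vec_mx (rsubmx (lsubmx y)) i k *
      vec_mx (rsubmx y) k j)); first by move=> y _; rewrite mxE.
  apply: smooth_fun_sum => // k; apply: smooth_funM => //; apply: smooth_fun_vec_mx => //.
  exact: smooth_on_rsubmx.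
- move=> [v h] [cv _] _.
  have hcv : chart_at (pbase (v : P)) c by split => //; case: hc.
  split; first by rewrite /= /pbase pact_pt.
  rewrite row_mxKl pchart_l pchart_r row_mxKr G_chartE mxvecK.
  apply: etrans (pchartE c (pact (v, h) : P)) _.
  by rewrite pact_pt (pact_mx _ hcv).
Qed.

(** L_u g = L_u with L_u invertible. *)
Lemma act_free (u : PM) (g : GM) : frame_act (val u) (val g) = val u -> val g = 1%:M.
Proof.
move=> e; have [c hc] := chart_exists hM (pbase (u : P)).
have := frame_by_vmx hM (frame_act_by g hc); rewrite frame_act_pt => /(_ hc).
rewrite [frame_act _ _]e => /esym e1.
have := congr1 (mulmx (invmx (pmx c u))) e1.
rewrite -[vmx c _]/(pmx c u) mulKmx ?mulVmx ?(pmx_unit hM hc) // => e2.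
by rewrite (gmxP g).1 e2 iota1.
Qed.

(** ** The projection *)

Lemma proj_smooth : smooth_map proj.
Proof.
apply: smooth_map_local => // u; have [c hc] := chart_exists hM (pbase (u : P)).
exists (pchart sigma c), (chart1 c), setT, lsubmx; split => //.
- exact: pchart_at.
- exact: chart1_at.
- by split => //; exact: openT.
- by apply: smooth_on_lsubmx; [|apply: smooth_on_id]; exact: openT.
- by move=> v cv _; split => //; rewrite pchart_l.
Qed.

Lemma proj_surj J : exists u : PM, proj u = J.
Proof.
have [c hc] := chart_exists hM (jet_point J).
have [u [uJ _]] := padapted_exists hM hsigma hc (unitmx1 R n).
by exists u.
Qed.

(** Over one jet, the element of G from u to v is L_u^-1 L_v. *)
Lemma proj_fiber (u v : PM) :
  proj u = proj v <-> exists g : GM, val v = frame_act (val u) (val g).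
Proof.
split=> [e|[g e]]; last first.
  have := frame_act_pt (pframe (u : P)) (val g); rewrite -[frame_act _ _]e => e'.
  exact: esym e'.
have [c hc] := chart_exists hM (pbase (u : P)).
have euv : fpt (pframe (u : P)) = fpt (pframe (v : P)) by exact: e.
have hcv : chart_at (pbase (v : P)) c by rewrite /pbase -euv.
have gU : invmx (pmx c u) *m pmx c v \in unitmx.
  by rewrite unitmx_mul unitmx_inv (pmx_unit hM hc) (pmx_unit hM hcv).
have [g gE] := gmx_exists gU; exists g.
have -> : v = pact (u, g); last by [].
apply: (padapted_eq hM _ hcv); first by rewrite pact_pt.
by rewrite (pact_mx _ hc) gE mulKVmx // (pmx_unit hM hc).
Qed.

(** ** Local trivializations *)

Section Trivialization.
Variable c : chart R M n.
Hypothesis hc : matlas M c.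

Lemma jets_in_open : open (jets_in (cdom c)).
Proof.
apply: smooth_map_preim_open; first exact: (jet_point_smooth hM).
exact: cdom_open.
Qed.

(** Away from the chart domain the value is arbitrary. *)
Lemma vertical_part_exists : exists phi : PM -> GM,
  forall u : P, cdom c (pbase u) -> gmx (phi u) = pmx c u.
Proof.
suff /choice[phi] : forall u : PM, exists g : GM,
    cdom c (pbase (u : P)) -> gmx g = pmx c u by exists phi.
move=> u; have [cu|ncu] := pselect (cdom c (pbase (u : P))); last first.
  by have [g _] := gmx_exists (unitmx1 R n); exists g.
by have [g gE] := gmx_exists (pmx_unit hM (conj hc cu)); exists g.
Qed.

Lemma trivialization_inverse_exists : exists f : prodM (M1 M) GM -> PM,
  forall z, cdom c (jet_point (z.1 : M1 M)) ->
    fpt (pframe (f z : P)) = z.1 /\ pmx c (f z : P) = gmx z.2.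
Proof.
suff /choice[f] : forall z : prodM (M1 M) GM, exists u : PM,
    cdom c (jet_point (z.1 : M1 M)) ->
    fpt (pframe (u : P)) = z.1 /\ pmx c (u : P) = gmx z.2 by exists f.
move=> z.
have [cz|ncz] := pselect (cdom c (jet_point (z.1 : M1 M))); last first.
  by have [u _] := proj_surj z.1; exists u.
have [u [u1 u2]] := padapted_exists hM hsigma (conj hc cz) (gmxP z.2).2.
by exists u.
Qed.

Let tchart := chart_prod (chart1 c : chart R (M1 M) _) (@G_chart R n : chart R GM _).

Let tchart_atlas : matlas (prodM (M1 M) GM) tchart.
Proof. by exists (chart1 c), (@G_chart R n); split => //; exists c. Qed.

Let pchart_atlas : matlas PM (pchart sigma c).
Proof. by exists c. Qed.

(** In the coordinates (t, x, xdot, L) on both sides the trivialization and its inverse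
    are the identity. *)
Lemma trivialization : exists phi : PM -> GM,
  (forall (u v : PM) (g : GM), jets_in (cdom c) (proj u) ->
     val v = frame_act (val u) (val g) -> val (phi v) = val (phi u) *m val g) /\
  @diffeo_on R _ _ PM (prodM (M1 M) GM)
    (proj @^-1` jets_in (cdom c)) (jets_in (cdom c) `*` setT)
    (fun u => (proj u, phi u)).
Proof.
have [phi phiE] := vertical_part_exists.
have [f fE] := trivialization_inverse_exists.
have hMG : smooth_atlas (prodM (M1 M) GM) by exact: smooth_atlas_prod.
have oU := jets_in_open.
have oPU : open (proj @^-1` jets_in (cdom c)).
  by apply: (smooth_map_preim_open proj_smooth).
have oT := @openT 'rV[R]_(1 + (n + n) + n * n).
have sid := smooth_on_id oT.
have chartsE (u : P) (g : @G R n) : pmx c u = gmx g ->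
    pchart sigma c u = tchart (fpt (pframe u), g).
  by move=> e; apply: etrans (pchartE c u) _; rewrite e.
exists phi; split.
  move=> u v g cu e.
  have cu' : chart_at (pbase (u : P)) c by split.
  have ev : v = pact (u, g) by apply: val_inj; exact: e.
  have cv : cdom c (pbase (v : P)) by rewrite ev /pbase pact_pt.
  rewrite (gmxP (phi v)).1 (gmxP (phi u)).1 (gmxP g).1 -iotaM.
  by rewrite (phiE _ cv) (phiE _ cu) ev (pact_mx _ cu').
split => //.
- have -> : jets_in (cdom c) `*` setT =
      (fst : prodM (M1 M) GM -> M1 M) @^-1` jets_in (cdom c).
    by apply/seteqP; split=> z //= [].
  apply: smooth_map_preim_open oU.
  apply: smooth_map_local => // z; have [d hd] := chart_exists hM (jet_point (z.1 : M1 M)).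
  exists (chart_prod (chart1 d : chart R (M1 M) _) (@G_chart R n : chart R GM _)),
     (chart1 d), setT, lsubmx; split.
  + split; last by split => //; case: hd.
    by exists (chart1 d), (@G_chart R n); split => //; exists d => //; case: hd.
  + exact: chart1_at.
  + by split.
  + exact: smooth_on_lsubmx.
  + by move=> q [dq _] _; split => //; rewrite row_mxKl.
- apply: smooth_in_local => // u cu.
  exists (pchart sigma c), tchart, setT, id; split => //.
  by move=> v cv _; split => //; rewrite (chartsE v (phi v)) // phiE.
- exists f; split.
  + apply: smooth_in_local => //.
      have -> : jets_in (cdom c) `*` setT = cdom tchart by [].
      exact: cdom_open.
    move=> z [cz _]; exists tchart, (pchart sigma c), setT, id; split => //.
    * by split=> //; rewrite /= /pbase (fE z cz).1.
    * move=> q [cq _] _; have [f1 f2] := fE q cq.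
      split; first by rewrite /= /pbase f1.
      by rewrite (chartsE _ q.2 f2) f1 -surjective_pairing.
  + by move=> _ [u cu <-].
  + move=> _ [z [cz _] <-].
    have : cdom c (jet_point (fpt (pframe (f z : P)))) by rewrite (fE z cz).1.
    exact.
  + move=> u /set_mem cu; have [f1 f2] := fE (proj u, phi u) cu.
    apply: (padapted_eq hM f1 (c := c)).
      by rewrite /pbase f1.
    by rewrite f2 phiE.
  + move=> z /set_mem[cz _]; have [f1 f2] := fE z cz.
    rewrite [RHS]surjective_pairing; congr pair; first exact: f1.
    by apply: gmx_inj; rewrite phiE ?f2 // /pbase f1.
Qed.

(** ** Local sections *)

(** The adapted frames with L = 1. *)
Lemma local_section : exists s : openM (jets_in (cdom c)) -> PM,
  smooth_map s /\
  forall xi : openM (jets_in (cdom c)), let u : frameM (M1 M) := val (s xi : P) in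
    [/\ frame_pt u = val xi,
        fvec u = @local_frame R n M sigma c (frame_pt u) &
        dual_coframe (@local_coframe R n M sigma c (frame_pt u)) (fvec u)].
Proof.
have /choice[s sE] : forall xi : openM (jets_in (cdom c)), exists u : P,
    fpt (pframe u) = val xi /\ pmx c u = 1%:M.
  move=> xi; have cx : cdom c (jet_point (val xi : M1 M)) by exact: (set_valP xi).
  exact: (padapted_exists hM hsigma (conj hc cx) (unitmx1 R n)).
have hs xi : chart_at (pbase (s xi)) c.
  by split => //; rewrite /pbase (sE xi).1; exact: (set_valP xi).
exists s; split.
  apply: smooth_map_local => //.
    by apply: smooth_atlas_open => //; exact: jets_in_open.
  move=> xi; exists (chart_sub (jets_in (cdom c)) (chart1 c)), (pchart sigma c), setT,
    (fun y => row_mx y (mxvec 1%:M)); split.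
  - split; last exact: (set_valP xi).
    by exists (chart1 c) => //; exists c.
  - exact: pchart_at.
  - by split => //; exact: openT.
  - apply: smooth_on_row_mx; [exact: openT | exact: (smooth_on_id openT)|].
    by apply: smooth_on_cst; exact: openT.
  - move=> eta ceta _; split; first by case: (hs eta).
    by apply: etrans (pchartE c (s eta)) _; rewrite (sE eta).1 (sE eta).2.
move=> xi u; have uxi : frame_pt u = val xi by exact: (sE xi).1.
have ulf : fvec u = @local_frame R n M sigma c (frame_pt u).
  apply/funext => m; have := pframe_by hM (hs xi) m; rewrite (sE xi).2 iota1 => e.
  apply: (etrans e); rewrite (bigD1 m) // mxE eqxx scale1r big1; first exact: addr0.
  by move=> l /negbTE lm; rewrite mxE lm scale0r.
split => //; rewrite ulf; apply: (local_coframe_dual hM).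
exact: (hs xi).
Qed.

End Trivialization.

End PrincipalBundle.

Theorem proposition3p2 (R : realType) (n : nat) (M : premanifold R n)
    (hM : smooth_manifold M) (hmax : maximal_atlas M) (hconn : connected [set: M])
    (sigma : M1 M -> M2 M) (hsigma : is_sode sigma) :
  exists (k : nat) (PA : set (chart R (adapted_frames sigma) k)),
    is_G_structure [set @G_chart R n] PA /\
    forall c, matlas M c ->
    exists s : openM (jets_in (cdom c)) -> Premanifold (adapted_frames sigma) PA,
      smooth_map s /\
      forall xi : openM (jets_in (cdom c)), let u : frameM (M1 M) := val (s xi) in
        [/\ frame_pt u = val xi,
            fvec u = @local_frame R n M sigma c (frame_pt u) &
            dual_coframe (@local_coframe R n M sigma c (frame_pt u)) (fvec u)].
Proof.
have [hA hH hS] := hM.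
exists (1 + (n + n) + n * n)%N, [set pchart sigma c | c in matlas M]; split; last first.
  by move=> c hc; exact: (local_section hA hsigma hc).
split.
- by split; [exact: smooth_manifold_P | exact: inclusion_immersion].
- exists (@pact R n M hA sigma hsigma); first exact: pact_smooth.
  by [].
- exact: (act_free hA).
- split; [exact: proj_smooth | exact: proj_surj | exact: proj_fiber].
- move=> J; have [c [hc cJ]] := chart_exists hA (jet_point J).
  have [phi [phiM phiD]] := trivialization hA hsigma hc.
  by exists (jets_in (cdom c)), phi.
Qed.
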